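(* Let $X$ be a normally distributed random variable with mean $\mu\in\mathbb{R}^3$, $\mu\neq 0$, and isotropic variance $\sigma^2 I_3$, $\sigma>0$, i.e. $X\sim N(\mu,\sigma^2 I_3)$. Given independent measurements $(x_1,x_2,\dots,x_L)$ from $\mathrm{pr}(X)=X/\|X\|\in\mathbb{S}^2$, we can estimate $\lambda=\frac{\sigma^2}{\|\mu\|^2}$ by $$\hat\lambda=f^{-1}\left(\frac{\operatorname{trace}(\hat V)}{2}\right),$$ where $\hat V$ is the empirical covariance matrix of the sample $(x_1,\dots,x_L)$ and $f$ is the bijection given in the context. Moreover it holds that $$\hat\lambda\overset{\mathbb{P}}{\longrightarrow}\frac{\sigma^2}{\|\mu\|^2}$$ (convergence in probability) as $L\to\infty$, with rate of convergence $\sqrt{L}$.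
   Context: $\mathbb{S}^2\subset\mathbb{R}^3$ is the unit sphere with the Riemannian metric inherited from $\mathbb{R}^3$, geodesic distance $\operatorname{dist}$ and Riemannian volume measure $d\mathrm{Vol}$; $\mathrm{pr}(x)=x/\|x\|$ for $x\neq 0$. For $q\in\mathbb{S}^2$, $\log_q$ is the inverse of the Riemannian exponential map $\exp_q$, restricted to the points joined to $q$ by a unique minimizing geodesic, so $\log_q(y)\in T_q\mathbb{S}^2$ and $\|\log_q(y)\|=\operatorname{dist}(q,y)$. Empirical mean of $y_1,\dots,y_L\in\mathbb{S}^2$: the minimizer $\hat\xi$ (assumed unique) of $q\mapsto\sum_{\ell=1}^L\operatorname{dist}^2(y_\ell,q)$. Empirical covariance: the linear map $\hat V:T_{\hat\xi}\mathbb{S}^2\to T_{\hat\xi}\mathbb{S}^2$, $$\hat V=\frac{1}{L-1}\sum_{\ell=1}^L\log_{\hat\xi}(y_\ell)\log_{\hat\xi}(y_\ell)^T .$$ Intrinsic mean and covariance of a random variable $Y$ on $\mathbb{S}^2$ with density $p_Y$ with respect to $d\mathrm{Vol}$: the mean $m$ is the minimizer of $q\mapsto\int_{\mathbb{S}^2}\operatorname{dist}(q,y)^2p_Y(y)\,d\mathrm{Vol}(y)$, and $\operatorname{Cov}(Y)=\int_{\mathbb{S}^2}\log_m(y)\log_m(y)^Tp_Y(y)\,d\mathrm{Vol}(y)$, a linear map on $T_m\mathbb{S}^2$. For $X\sim N(\mu,\sigma^2I_3)$ one has $\operatorname{Cov}(\mathrm{pr}(X))=vI_2$ with $0\le v<\frac{\pi^2-4}{4}$,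 and the function $f$ is the relation $$f\left(\frac{\sigma^2}{\|\mu\|^2}\right)=\frac{\operatorname{trace}(\operatorname{Cov}(\mathrm{pr}(X)))}{2}=v,$$ which is a bijection between the values $\lambda=\sigma^2/\|\mu\|^2$ and the values $v$. Explicitly, with $\varphi(t)=\exp(-t^2/2)$ and $\Phi(a)=\int_{-\infty}^a\varphi(t)\,dt$ (no normalizing constant), for $\lambda>0$ and $x=1/\sqrt{\lambda}$, $$f(\lambda)=\frac{\pi}{(2\pi)^{3/2}}\,e^{-x^2/2}\int_0^\pi\phi^2\left(x\cos\phi+\left(x^2\cos^2\phi+1\right)\frac{\Phi(x\cos\phi)}{\varphi(x\cos\phi)}\right)\sin\phi\,d\phi ,$$ with the value $v=0$ corresponding to the limit $\lambda\to0$. *)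

(* Defs.v *)
From HB Require Import structures.
From mathcomp Require Import all_boot all_order all_algebra finmap.
From mathcomp Require Import all_classical all_reals all_analysis.

Set Implicit Arguments.
Unset Strict Implicit.
Unset Printing Implicit Defensive.

Import Order.TTheory GRing.Theory Num.Theory.
Import numFieldNormedType.Exports.

Local Open Scope classical_set_scope.
Local Open Scope ring_scope.

(* The norm that the library puts on 'rV[R]_3 is the sup norm, so the Euclidean
   structure of R^3 is introduced explicitly (the topology is the same). *)
Definition dot (R : realType) (u v : 'rV[R]_3) : R :=
  \sum_(k < 3) u 0 k * v 0 k.

Definition enorm (R : realType) (v : 'rV[R]_3) : R := Num.sqrt (dot v v).

Definition sphere2 (R : realType) : set 'rV[R]_3 := [set q | enorm q = 1].

(* [pr 0 = 0] by the convention 0^-1 = 0; a normal vector avoids 0 a.s. *)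
Definition pr (R : realType) (x : 'rV[R]_3) : 'rV[R]_3 := (enorm x)^-1 *: x.

(* Length of the shorter great-circle arc between two points of the sphere. *)
Definition sdist (R : realType) (p q : 'rV[R]_3) : R := acos (dot p q).

Definition tangent (R : realType) (q : 'rV[R]_3) : set 'rV[R]_3 :=
  [set v | dot q v = 0].

(* Geodesics of the sphere are the unit-speed great circles; for v = 0 the
   second term vanishes, so that exp_q(0) = q. *)
Definition sphere_exp (R : realType) (q v : 'rV[R]_3) : 'rV[R]_3 :=
  cos (enorm v) *: q + (sin (enorm v) / enorm v) *: v.

(* exp_q maps the open disc of radius pi of T_q bijectively onto the points
   joined to q by a unique minimizing geodesic, i.e. all points but - q.
   Where the logarithm is undefined the value is 0. *)
Definition sphere_log (R : realType) (q y : 'rV[R]_3) : 'rV[R]_3 :=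
  xget 0 [set v | [/\ tangent q v, enorm v < pi & sphere_exp q v = y]].

(* The sample y_1, ..., y_L is y 0, ..., y (L - 1). *)
Definition sum_sqdist (R : realType) (L : nat) (y : nat -> 'rV[R]_3)
    (q : 'rV[R]_3) : R :=
  \sum_(l < L) sdist (y l) q ^+ 2.

(* [q] is the unique minimizer on the sphere of the sum of squared distances. *)
Definition empirical_mean (R : realType) (L : nat) (y : nat -> 'rV[R]_3)
    (q : 'rV[R]_3) : Prop :=
  sphere2 q /\
  forall p, sphere2 p -> p <> q -> sum_sqdist L y q < sum_sqdist L y p.

(* The endomorphism of the tangent plane T_q is written as a 3 x 3 matrix
   vanishing on the normal line R q, which leaves its trace unchanged.  Vectors
   are rows, hence v v^T reads [v^T *m v]. *)
Definition empirical_cov (R : realType) (L : nat) (y : nat -> 'rV[R]_3)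
    (q : 'rV[R]_3) : 'M[R]_3 :=
  (L%:R - 1)^-1 *: \sum_(l < L) (sphere_log q (y l))^T *m sphere_log q (y l).

Definition gauss_phi (R : realType) (t : R) : R := expR (- t ^+ 2 / 2).

Definition gauss_Phi (R : realType) (a : R) : R :=
  \int[lebesgue_measure]_(t in `]-oo, a]) gauss_phi t.

(* Half the trace of the intrinsic covariance of pr(N(mu, s^2 I_3)) as a
   function of lam = s^2 / |mu|^2, with its limit value at lam = 0; [t] is the
   geodesic distance to pr(mu). *)
Definition f_cov (R : realType) (lam : R) : R :=
  if lam == 0 then 0 else
  let x := (Num.sqrt lam)^-1 in
  pi / (2 * pi) `^ (3 / 2) * expR (- x ^+ 2 / 2) *
  \int[lebesgue_measure]_(t in `[0, pi])
    (t ^+ 2 *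
     (x * cos t + (x ^+ 2 * cos t ^+ 2 + 1) *
        (gauss_Phi (x * cos t) / gauss_phi (x * cos t))) *
     sin t).

(* Inverse of f : [0, +oo[ -> [0, (pi^2 - 4)/4[; outside of the range of f the
   value is given by the arbitrary function [dflt]. *)
Definition f_cov_inv (R : realType) (dflt : R -> R) : R -> R :=
  'pinv_dflt `[0, +oo[ (@f_cov R).

Definition lambda_hat (R : realType) (dflt : R -> R) (L : nat)
    (y : nat -> 'rV[R]_3) (q : 'rV[R]_3) : R :=
  f_cov_inv dflt (\tr (empirical_cov L y q) / 2).

(* R^3 with its Borel sigma-algebra. *)
Definition borel3 (R : realType) :=
  g_sigma_algebraType (@open 'rV[R]_3).

Definition random_vector (R : realType) (d : measure_display)
    (T : measurableType d) (X : T -> 'rV[R]_3) : Prop :=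
  measurable_fun [set: T] (X : T -> borel3 R).

Definition vec3 (R : realType) (p : R * (R * R)) : 'rV[R]_3 :=
  \row_(k < 3) [:: p.1; p.2.1; p.2.2]`_k.

Definition normal3_pdf (R : realType) (mu : 'rV[R]_3) (s : R)
    (x : 'rV[R]_3) : R :=
  ((2 * pi * s ^+ 2) `^ (3 / 2))^-1 *
  expR (- enorm (x - mu) ^+ 2 / (2 * s ^+ 2)).

(* [X ~ N(mu, s^2 I_3)] *)
Definition isotropic_normal (R : realType) (d : measure_display)
    (T : measurableType d) (P : probability T R) (X : T -> 'rV[R]_3)
    (mu : 'rV[R]_3) (s : R) : Prop :=
  random_vector X /\
  forall B : set (borel3 R), measurable B ->
    P (X @^-1` B) =
    (\int[lebesgue_measure \x (lebesgue_measure \x lebesgue_measure)]_(p in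
        @vec3 R @^-1` B) (normal3_pdf mu s (vec3 p))%:E)%E.

Definition same_law (R : realType) (d d' : measure_display)
    (T : measurableType d) (T' : measurableType d')
    (P : probability T R) (P' : probability T' R)
    (Y : T -> 'rV[R]_3) (Z : T' -> 'rV[R]_3) : Prop :=
  forall B : set (borel3 R), measurable B -> P (Y @^-1` B) = P' (Z @^-1` B).

Definition mutually_independent (R : realType) (d : measure_display)
    (T : measurableType d) (P : probability T R)
    (Y : nat -> T -> 'rV[R]_3) : Prop :=
  forall (J : {fset nat}) (B : nat -> set (borel3 R)),
    (forall i, measurable (B i)) ->
    P (\bigcap_(i in [set` J]) (Y i @^-1` B i)) =
    (\prod_(i <- J) P (Y i @^-1` B i))%E.

(* Convergence in probability and boundedness in probability, Z_L = O_P(1).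
   The outer measure P^* agrees with P on events; it makes the notions
   meaningful without a measurability assumption on Z (an estimator may be
   arbitrary on the null set where its defining minimizer is not unique). *)
Definition cvg_in_prob (R : realType) (d : measure_display)
    (T : measurableType d) (P : probability T R) (Z : nat -> T -> R) (z : R)
    : Prop :=
  forall eps : R, 0 < eps ->
    (P^*)%mu [set w | eps <= `|Z L w - z|] @[L --> \oo] --> 0%E.

Definition bounded_in_prob (R : realType) (d : measure_display)
    (T : measurableType d) (P : probability T R) (Z : nat -> T -> R) : Prop :=
  forall delta : R, 0 < delta ->
    exists M : R, \forall L \near \oo,
      ((P^*)%mu [set w | (M < `|Z L w|)%R] <= delta%:E)%E.

(* Main.v *)
Require Import Defs.
From HB Require Import structures.
From mathcomp Require Import all_boot all_order all_algebra finmap.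
From mathcomp Require Import all_classical all_reals all_analysis.
From mathcomp Require Import measurable_realfun.
From mathcomp Require Import ring lra.

Set Implicit Arguments.
Unset Strict Implicit.
Unset Printing Implicit Defensive.

Import Order.TTheory GRing.Theory Num.Theory.
Import numFieldNormedType.Exports.

Local Open Scope classical_set_scope.
Local Open Scope ring_scope.

(** Let [lambda = sigma^2 / |mu|^2] and let [V] be half the trace of the
  empirical covariance.  The logarithm at [q] satisfies
  [|log_q y| = dist q y] for every [y] other than [- q], and no observation is
  antipodal to the empirical mean: along a great circle through the minimizer
  the term [(pi - |t|)^2] of an antipodal observation has a concave kink, which
  the other terms, all differentiable or antipodal as well, cannot compensate
  ([mean_not_antipodal]).  Hence
  [2 (L - 1) V / L] is the minimum over [q] on the sphere of the average
  [A_L q] of the squared distances from [q] to the observations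
  ([trace_empirical_cov]).

  The theorem follows from three facts about [G q], the expectation of the
  squared distance from [q] to [pr X].

  - [G] is minimal at [pr mu], with value [2 * f_cov lambda].  Minimality
    ([mean_sqdist_min]) is a reflection argument: the reflection exchanging
    [pr mu] and [q] shows that [G q - G (pr mu)] is half the integral of the
    product of two differences that have the same sign everywhere.  It uses
    the invariance of Lebesgue measure under reflections, obtained by
    averaging over translations against a Gaussian weight
    ([integral_leb3_isometry]).  The value comes from integration in polar
    coordinates, reached by scalings and Tonelli's theorem
    ([integral_polar3], [integral_sqr_colatitude]).

  - [A_L - G] is of size [1 / sqrt L] uniformly on the sphere
    ([uniform_law_rate]).  The squared distance [acos <q, y> ^ 2] is a uniform
    limit of kernels [sum_j a_j q * b_j y] with [sum_j a_j^2] and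
    [sum_j b_j^2] bounded by [pi^2] ([kernel_class_sqdist]).  For such a kernel
    the deviation is a sum of [a_j q] times the deviations of the empirical
    means of the [b_j]; the sum of the squares of these, which does not depend
    on [q], has expectation at most [pi^2 / L].  So the minimum of [A_L]
    differs from [2 * f_cov lambda] by [O(1 / sqrt L)] in expectation.

  - [f_cov] has an inverse that is Lipschitz at [f_cov lambda]
    ([f_cov_inv_stable]).  As a function of [a = sigma / sqrt lambda], [f_cov]
    is an integral of [angle a z ^ 2] against a fixed weight, where [angle a z]
    is the colatitude of the point [z] translated by [a] along the axis.
    It decreases pointwise in [a], at a rate that is bounded below when [z] is
    in a fixed box, and it is continuous by dominated convergence.

  Markov's inequality then gives the rate [sqrt L], and convergence in
  probability follows from the rate. *)

(** * Lebesgue measure on R and R^3 *)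

Lemma lebesgue_affine_preimage (R : realType) (a b : R) (A : set R) :
  0 < a -> measurable A ->
  (a%:E * (@lebesgue_measure R) ((fun x => (a * x + b)%R) @^-1` A) =
   (@lebesgue_measure R) A)%E.
Proof.
move=> a0 mA.
have mphi : measurable_fun setT (fun x : R => a * x + b).
  by apply: measurable_funD => //; exact: measurable_funM.
pose phi : measurableTypeR R -> measurableTypeR R := fun x : R => a * x + b.
have -> : (lebesgue_measure ((fun x => (a * x + b)%R) @^-1` A) =
  pushforward (@lebesgue_measure R) phi A)%E by [].
pose a' := NngNum (ltW a0).
pose mphi_mixin := isMeasurableFun.Build _ _ _ _ phi mphi.
pose phi' : {mfun _ >-> _} := HB.pack phi mphi_mixin.
rewrite (_ : _ * _ = mscale a' (pushforward (@lebesgue_measure R) phi') A)%E //.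
apply/esym/lebesgue_measure_unique => //= _ [[u v]] _ <-.
rewrite /mscale/= /pushforward/=.
have -> : phi @^-1` `]u, v] = `](u - b) / a, (v - b) / a]%classic.
  apply/seteqP; split => x /=; rewrite !in_itv/= /phi ltr_pdivrMr// ler_pdivlMr//.
    by rewrite ltrBlDr lerBrDr (mulrC a).
  by rewrite ltrBlDr lerBrDr (mulrC a).
rewrite !lebesgue_measure_itv/= !lte_fin ltr_pM2r ?invr_gt0//.
rewrite ltrD2r; case: ifPn => // _; last by rewrite mule0.
rewrite -!EFinD -EFinM; congr EFin; field.
by rewrite gt_eqF.
Qed.

Lemma integral_affine (R : realType) (a b : R) (f : R -> \bar R) :
  0 < a -> measurable_fun setT f -> (forall x, 0 <= f x)%E ->
  (a%:E * \int[lebesgue_measure]_x f (a * x + b)%R =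
   \int[lebesgue_measure]_x f x)%E.
Proof.
move=> a0 mf f0.
have mphi : measurable_fun setT (fun x : R => a * x + b).
  by apply: measurable_funD => //; exact: measurable_funM.
pose phi : measurableTypeR R -> measurableTypeR R := fun x : R => a * x + b.
pose mphi_mixin := isMeasurableFun.Build _ _ _ _ phi mphi.
pose phi' : {mfun _ >-> _} := HB.pack phi mphi_mixin.
have := @ge0_integral_pushforward _ _ _ _ R phi mphi (@lebesgue_measure R)
   setT f measurableT mf (fun x _ => f0 x).
rewrite preimage_setT => /= <-.
pose a' := NngNum (ltW a0).
rewrite (_ : a%:E = (a'%:num)%:E)//.
rewrite -(@ge0_integral_mscale _ _ R (pushforward (@lebesgue_measure R) phi') setT measurableT a' f mf (fun x _ => f0 x)).
apply: eq_measure_integral => //= A mA _.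
exact: lebesgue_affine_preimage.
Qed.

Lemma integral_shift (R : realType) (b : R) (f : R -> \bar R) :
  measurable_fun setT f -> (forall x, 0 <= f x)%E ->
  (\int[lebesgue_measure]_x f (x + b)%R =
   \int[lebesgue_measure]_x f x)%E.
Proof.
move=> mf f0; rewrite -(integral_affine b ltr01 mf f0) mul1e.
by under [RHS]eq_integral do rewrite mul1r.
Qed.

(** Sigma-finiteness of products is what lets Tonelli's theorem be iterated up to
  dimension three. *)
Section sigma_finite_product.
Context d1 d2 (T1 : measurableType d1) (T2 : measurableType d2) (R : realType).
Variables (m1 : {sigma_finite_measure set T1 -> \bar R})
  (m2 : {sigma_finite_measure set T2 -> \bar R}).

Lemma sigma_finite_product : sigma_finite setT (m1 \x m2)%E.
Proof.
have /sigma_finiteP[F [TF ndF Foo]] := sigma_finiteT m1.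
have /sigma_finiteP[G [TG ndG Goo]] := sigma_finiteT m2.
exists (fun n => F n `*` G n) => [|n].
  rewrite -setXTT TF TG; apply/seteqP; split => -[x y].
    move=> [[n _ Fx] [k _ Gy]]; exists (maxn n k) => //; split.
      exact: (subsetPset _ _ (ndF _ _ (leq_maxl n k))) Fx.
    exact: (subsetPset _ _ (ndG _ _ (leq_maxr n k))) Gy.
  by move=> [n _ [/= Fx Gy]]; split; exists n.
have [mF Ffin] := Foo n; have [mG Gfin] := Goo n.
split; first exact: measurableX.
by rewrite product_measure1E// lte_mul_pinfty// ge0_fin_numE.
Qed.

Definition prod_measure : {sigma_finite_measure set (T1 * T2)%type -> \bar R} :=
  HB.pack (m1 \x m2)%E
    (Measure_isSigmaFinite.Build _ _ _ (m1 \x m2)%E sigma_finite_product).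

End sigma_finite_product.

Arguments prod_measure : simpl never.

Notation leb1 R := (@lebesgue_measure R).
Notation leb2 R := (prod_measure (leb1 R) (leb1 R)).
Notation leb3 R := (prod_measure (leb1 R) (leb2 R)).

Lemma measurable_addp (R : realType) d (T : measurableType d)
    (f g : T -> R * (R * R)) :
  measurable_fun setT f -> measurable_fun setT g ->
  measurable_fun setT (fun t => f t + g t).
Proof.
move=> /measurable_fun_pairP[f1 /measurable_fun_pairP[f2 f3]].
move=> /measurable_fun_pairP[g1 /measurable_fun_pairP[g2 g3]].
apply/measurable_fun_pairP; split; first exact: measurable_funD f1 g1.
apply/measurable_fun_pairP; split; first exact: measurable_funD f2 g2.
exact: measurable_funD f3 g3.
Qed.

Lemma measurable_oppp (R : realType) d (T : measurableType d)
    (f : T -> R * (R * R)) :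
  measurable_fun setT f -> measurable_fun setT (fun t => - f t).
Proof.
move=> /measurable_fun_pairP[f1 /measurable_fun_pairP[f2 f3]].
apply/measurable_fun_pairP; split; first exact: measurable_funN f1.
apply/measurable_fun_pairP; split; first exact: measurable_funN f2.
exact: measurable_funN f3.
Qed.

Section leb3_integral.
Variables (R : realType) (f : R * (R * R) -> \bar R).
Hypotheses (mf : measurable_fun setT f) (f0 : forall p, (0 <= f p)%E).
Local Open Scope ereal_scope.

Lemma integral_leb2 (g : R * R -> \bar R) :
  measurable_fun setT g -> (forall p, 0 <= g p) ->
  \int[leb2 R]_p g p =
  \int[leb1 R]_x \int[leb1 R]_y g (x, y).
Proof. by move=> mg g0; rewrite fubini_tonelli1. Qed.

Lemma integral_leb3 :
  \int[leb3 R]_p f p =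
  \int[leb1 R]_x \int[leb1 R]_y
    \int[leb1 R]_z f (x, (y, z)).
Proof.
rewrite fubini_tonelli1//; apply: eq_integral => x _.
rewrite /fubini_F /= integral_leb2//.
exact: measurableT_comp mf (pair1_measurable x).
Qed.

End leb3_integral.

Lemma integral_leb3_shift (R : realType) (v : R * (R * R)) f :
  measurable_fun setT f -> (forall p, (0 <= f p)%E) ->
  (\int[leb3 R]_p f (p + v)%R = \int[leb3 R]_p f p)%E.
Proof.
move=> mf f0; case: v => a [b c].
rewrite [LHS]integral_leb3//; last first.
  apply: measurableT_comp => //.
  by apply: measurable_addp => //; exact: measurable_cst.
rewrite [RHS](integral_leb3 mf f0).
pose F x := (\int[leb1 R]_y \int[leb1 R]_z f (x, (y, z)))%E.
have mF : measurable_fun setT F.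
  have := @measurable_fun_fubini_tonelli_F _ _ _ _ R (leb2 R) f mf f0.
  apply: eq_measurable_fun => x _; rewrite /fubini_F integral_leb2//.
  exact: measurableT_comp mf (pair1_measurable x).
rewrite -[RHS](integral_shift a mF); last first.
  by move=> x; do 2 (apply: integral_ge0 => ? _).
apply: eq_integral => x _; rewrite /F.
pose G y := (\int[leb1 R]_z f ((x + a)%R, (y, z)))%E.
have mfx : measurable_fun setT (fun q : R * R => f ((x + a)%R, q)).
  exact: measurableT_comp mf (pair1_measurable (x + a)%R).
have mG : measurable_fun setT G.
  exact: (@measurable_fun_fubini_tonelli_F _ _ _ _ R lebesgue_measure _ mfx).
rewrite -[RHS](integral_shift b mG); last first.
  by move=> y; apply: integral_ge0.
apply: eq_integral => y _; rewrite /G.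
rewrite -[RHS](@integral_shift _ c)//.
exact: measurableT_comp mfx (pair1_measurable (y + b)%R).
Qed.

(** For a linear involution [A] and a weight [w] of mass one, invariant under [A]
  and under [-], the average of [f (A y)] over all its translates by [x] with
  weight [w x] becomes, after the substitution [x -> x - A y], an integral of
  [f x] against [w (x - A y) = w (y - A x)], whose integral in [y] is one.  Only
  translation invariance and Tonelli's theorem enter, so that no change of
  variables formula for linear maps is required. *)
Lemma integral_leb3_isometry (R : realType) (A : R * (R * R) -> R * (R * R))
    (w f : R * (R * R) -> \bar R) :
  measurable_fun setT A -> involutive A -> {morph A : p q / p + q} ->
  measurable_fun setT w -> (forall p, (0 <= w p)%E) ->
  (forall p, w (A p) = w p) -> (forall p, w (- p) = w p) ->
  (\int[leb3 R]_p w p = 1)%E ->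
  measurable_fun setT f -> (forall p, (0 <= f p)%E) ->
  (\int[leb3 R]_p f (A p) = \int[leb3 R]_p f p)%E.
Proof.
move=> mA AK AD mw w0 wA wN w1 mf f0.
have AN p : A (- p) = - A p.
  have A0 : A 0 = 0 by apply: (addrI (A 0)); rewrite -AD !addr0.
  by apply/eqP; rewrite -addr_eq0 -AD addNr A0.
have mfA : measurable_fun setT (fun p => f (A p)) by exact: measurableT_comp.
transitivity (\int[leb3 R]_x \int[leb3 R]_y (w x * f (A y + x)%R))%E.
  rewrite -[LHS]mul1e -w1 -ge0_integralZr//; last exact: integral_ge0.
  apply: eq_integral => x _.
  rewrite -(@integral_leb3_shift _ (A x))// -ge0_integralZl//; last first.
    apply: (measurableT_comp mfA).
    by apply: measurable_addp => //; exact: measurable_cst.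
  by apply: eq_integral => y _; rewrite AD AK.
have mwf : measurable_fun setT (fun z : (R * (R * R)) * (R * (R * R)) =>
    w z.1 * f (A z.2 + z.1)%R)%E.
  apply: emeasurable_funM; first exact: measurableT_comp.
  apply: (measurableT_comp mf); apply: measurable_addp => //.
  exact: (measurableT_comp mA).
etransitivity.
  by apply: (@fubini_tonelli _ _ _ _ R (leb3 R) (leb3 R) _ mwf) => z; exact: mule_ge0.
transitivity (\int[leb3 R]_y \int[leb3 R]_x (w (x - A y)%R * f x))%E.
  apply: eq_integral => y _.
  pose h x := (w (x - A y)%R * f x)%E.
  have mh : measurable_fun setT h.
    apply: emeasurable_funM => //; apply: (measurableT_comp mw).
    by apply: measurable_addp => //; exact: measurable_cst.
  have h0 x : (0 <= h x)%E by exact: mule_ge0.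
  rewrite -[RHS](integral_leb3_shift (A y) mh h0).
  by apply: eq_integral => x _; rewrite /h addrK addrC.
have mwf' : measurable_fun setT (fun z : (R * (R * R)) * (R * (R * R)) =>
    w (z.2 - A z.1)%R * f z.2)%E.
  apply: emeasurable_funM; last exact: measurableT_comp.
  apply: (measurableT_comp mw); apply: measurable_addp => //.
  by apply: measurable_oppp; exact: (measurableT_comp mA).
etransitivity.
  by apply: (@fubini_tonelli _ _ _ _ R (leb3 R) (leb3 R) _ mwf') => z; exact: mule_ge0.
apply: eq_integral => x _.
transitivity (\int[leb3 R]_y (w (y - A x)%R * f x))%E.
  apply: eq_integral => y _; congr (_ * _)%E.
  by rewrite -[LHS]wA AD AN AK -wN opprB.
rewrite ge0_integralZr//; last first.
  apply: (measurableT_comp mw).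
  by apply: measurable_addp => //; exact: measurable_cst.
by rewrite (integral_leb3_shift (- A x) mw w0) w1 mul1e.
Qed.

(** * Polar coordinates *)

Lemma measurable_sqrtr (R : realType) : measurable_fun setT (@Num.sqrt R).
Proof. by apply: continuous_measurable_fun; exact: sqrt_continuous. Qed.

Lemma eq_integral_neq0 (R : realType) (f g : R -> \bar R) :
  measurable_fun setT f -> measurable_fun setT g ->
  (forall x, x != 0 -> f x = g x) ->
  (\int[leb1 R]_x f x = \int[leb1 R]_x g x)%E.
Proof.
move=> mf mg fg.
have mD : measurable ([set: R] `\ 0) by apply: measurableD.
rewrite -(@integral_setD1 _ f 0 setT)//; last exact: measurable_funS mf.
rewrite -(@integral_setD1 _ g 0 setT)//; last exact: measurable_funS mg.
by apply: eq_integral => x; rewrite inE /= => -[_ /eqP]; exact: fg.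
Qed.

Lemma integral_oneDsqrV (R : realType) :
  (\int[leb1 R]_x ((1 + x ^+ 2)^-1)%:E = pi%:E)%E.
Proof.
have e0 : forall x : R, 0 <= (1 + x ^+ 2)^-1.
  by move=> x; rewrite invr_ge0 addr_ge0 ?sqr_ge0.
rewrite (@ge0_symfun_integralT R (fun x => (1 + x ^+ 2)^-1)) //.
- rewrite (_ : [set x | _] = `[0, +oo[%classic); last first.
    by apply/seteqP; split => x/=; rewrite in_itv/= andbT.
  by rewrite (@integral0y_oneDsqr R) -EFinM mulrC divfK.
- exact: continuous_oneDsqrV.
- by move=> x /=; rewrite sqrrN.
Qed.

Section polar.
Variable R : realType.
Local Open Scope ereal_scope.

(** The hypotenuse of the right triangle with legs 1 and [s]; it is [1 / sin t]
  when [s] is the cotangent of [t]. *)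
Definition hyp (s : R) : R := Num.sqrt (1 + s ^+ 2)%R.

Lemma hyp_gt0 s : (0 < hyp s)%R.
Proof. by rewrite sqrtr_gt0 ltr_pwDl// sqr_ge0. Qed.

Lemma hyp_ge0 s : (0 <= hyp s)%R. Proof. exact: ltW (hyp_gt0 s). Qed.

Lemma sqr_hyp s : (hyp s ^+ 2 = 1 + s ^+ 2)%R.
Proof. by rewrite sqr_sqrtr// addr_ge0 ?sqr_ge0. Qed.

Lemma measurable_hyp : measurable_fun setT hyp.
Proof.
apply: (measurableT_comp (@measurable_sqrtr R)).
by apply: measurable_funD => //; exact: measurable_funX.
Qed.

Lemma sqrt_sqrD_mul (y s : R) :
  (Num.sqrt (y ^+ 2 + (`|y| * s) ^+ 2) = `|y| * hyp s)%R.
Proof.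
rewrite exprMn real_normK ?num_real// -{1}[X in (X + _)%R]mulr1 -mulrDr.
by rewrite sqrtrM ?sqr_ge0// sqrtr_sqr.
Qed.

Let hypV_gt0 (s : R) : (0 < (hyp s)^-1)%R.
Proof. by rewrite invr_gt0 hyp_gt0. Qed.

(** Polar coordinates in the plane, with the slope [s = z / |y|] as angular
  variable: scaling [z] by [|y|] for fixed [y], and then [y] by [1 / hyp s] for
  fixed [s], turns [sqrt (y^2 + z^2)] into [|v|], and the angular factor
  [1 / (1 + s^2)] integrates to [pi]. *)
Lemma integral_polar2 (k : R -> \bar R) :
  measurable_fun setT k -> (forall v, 0 <= k v) ->
  \int[leb1 R]_y \int[leb1 R]_z k (Num.sqrt (y ^+ 2 + z ^+ 2)%R) =
  pi%:E * \int[leb1 R]_v (`|v|%:E * k `|v|%R).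
Proof.
move=> mk k0.
have mks : measurable_fun setT (fun z : R * R => k (Num.sqrt (z.1 ^+ 2 + z.2 ^+ 2)%R)).
  apply: (measurableT_comp mk); apply: (measurableT_comp (@measurable_sqrtr R)).
  by apply: measurable_funD; apply: measurable_funX.
have mkh : measurable_fun setT (fun z : R * R => `|z.1|%:E * k (`|z.1| * hyp z.2)%R).
  apply: emeasurable_funM; first exact/measurable_EFinP/measurableT_comp.
  apply: (measurableT_comp mk); apply: measurable_funM; first exact: measurableT_comp.
  exact: measurableT_comp measurable_hyp _.
have kh0 (z : R * R) : 0 <= `|z.1|%:E * k (`|z.1| * hyp z.2)%R by rewrite mule_ge0// lee_fin.
transitivity (\int[leb1 R]_y \int[leb1 R]_s (`|y|%:E * k (`|y| * hyp s)%R)).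
  apply: eq_integral_neq0.
  - exact: (@measurable_fun_fubini_tonelli_F _ _ _ _ R (leb1 R) _ mks).
  - exact: (@measurable_fun_fubini_tonelli_F _ _ _ _ R (leb1 R) _ mkh).
  - move=> y y0; rewrite -(@integral_affine _ `|y|%R 0)//; last 2 first.
    + by rewrite normr_gt0.
    + exact: measurableT_comp mks (pair1_measurable y).
    rewrite -ge0_integralZl//; last first.
      apply: (measurableT_comp (measurableT_comp mks (pair1_measurable y))).
      by apply: measurable_funD => //; exact: measurable_funM.
    by apply: eq_integral => s _; rewrite addr0 sqrt_sqrD_mul.
rewrite (@fubini_tonelli _ _ _ _ R (leb1 R) (leb1 R) _ mkh kh0) /=.
have mvk : measurable_fun setT (fun v : R => `|v|%:E * k `|v|%R).
  apply: emeasurable_funM.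
    by apply/measurable_EFinP; exact: normr_measurable.
  exact: (measurableT_comp mk (@normr_measurable R setT)).
have vk0 (v : R) : 0 <= `|v|%:E * k `|v|%R by rewrite mule_ge0// lee_fin.
have Ivk0 : 0 <= \int[leb1 R]_v (`|v|%:E * k `|v|%R).
  by apply: integral_ge0 => v _; exact: vk0.
have moV : measurable_fun setT (fun x : R => ((1 + x ^+ 2)^-1)%:E).
  apply/measurable_EFinP; apply: continuous_measurable_fun.
  exact: continuous_oneDsqrV.
have oV0 (x : R) : [set: R] x -> 0 <= ((1 + x ^+ 2)^-1)%:E.
  by rewrite lee_fin invr_ge0 addr_ge0 ?sqr_ge0.
rewrite -integral_oneDsqrV.
rewrite -ge0_integralZr; [|exact: measurableT|exact: moV|exact: oV0|exact: Ivk0].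
apply: eq_integral => s _.
rewrite -[in RHS](@integral_affine _ (hyp s) 0 _ (hyp_gt0 s) mvk vk0).
rewrite -sqr_hyp muleA -EFinM.
under [in RHS]eq_integral do rewrite addr0 normrM (gtr0_norm (hyp_gt0 s)) (mulrC (hyp s)) EFinM (muleC _ (hyp s)%:E) -muleA.
have mkhs := measurableT_comp mkh (pair2_measurable s).
rewrite ge0_integralZl; [|exact: measurableT|exact: mkhs
  |by move=> v _; exact: (kh0 (v, s))|by rewrite lee_fin hyp_ge0].
rewrite muleA -EFinM (_ : (_ * _ = 1)%R) ?mul1e//.
by field; rewrite gt_eqF ?hyp_gt0.
Qed.

(** Spherical coordinates for functions of the axial coordinate and of the
  distance to the axis.  The colatitude appears through its cotangent [s]: its
  cosine is [s / hyp s] and its sine is [1 / hyp s].  The radius [r] runs over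
  the whole line, each value of [|r|] being counted twice. *)
Lemma integral_polar3 (H : R * R -> \bar R) :
  measurable_fun setT H -> (forall z, 0 <= H z) ->
  \int[leb3 R]_p H (p.1, Num.sqrt (p.2.1 ^+ 2 + p.2.2 ^+ 2)%R) =
  pi%:E * \int[leb1 R]_s \int[leb1 R]_r
    (((hyp s)^-1 ^+ 3 * r ^+ 2)%:E * H (`|r| * (s / hyp s), `|r| / hyp s)%R).
Proof.
move=> mH H0.
have mHs : measurable_fun setT (fun p : R * (R * R) =>
    H (p.1, Num.sqrt (p.2.1 ^+ 2 + p.2.2 ^+ 2)%R)).
  apply: (measurableT_comp mH); apply/measurable_fun_pairP; split.
    exact: measurable_fst.
  apply: (measurableT_comp (@measurable_sqrtr R)).
  by apply: measurable_funD; apply: measurable_funX; exact: measurableT_comp.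
rewrite (integral_leb3 mHs (fun p => H0 _)).
have mHv : measurable_fun setT (fun z : R * R => `|z.2|%:E * H (z.1, `|z.2|%R)).
  apply: emeasurable_funM; first exact/measurable_EFinP/measurableT_comp.
  apply: (measurableT_comp mH); apply/measurable_fun_pairP; split.
    exact: measurable_fst.
  exact: (measurableT_comp (@normr_measurable R setT) measurable_snd).
have Hv0 (z : R * R) : 0 <= `|z.2|%:E * H (z.1, `|z.2|%R) by rewrite mule_ge0// lee_fin.
transitivity (\int[leb1 R]_x (pi%:E * \int[leb1 R]_v (`|v|%:E * H (x, `|v|%R)))).
  apply: eq_integral => x _.
  rewrite -(@integral_polar2 (fun v => H (x, v)))//.
  exact: measurableT_comp mH (pair1_measurable x).
rewrite ge0_integralZl; [|exact: measurableT
  |exact: (@measurable_fun_fubini_tonelli_F _ _ _ _ R (leb1 R) _ mHv Hv0)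
  |by move=> x _; apply: integral_ge0 => v _; exact: (Hv0 (x, v))
  |by rewrite lee_fin pi_ge0].
apply: (congr1 (fun u => pi%:E * u)).
rewrite (@fubini_tonelli _ _ _ _ R (leb1 R) (leb1 R) _ mHv Hv0).
have mV : measurable_fun setT (fun z : R * R =>
    (z.1 ^+ 2)%:E * H (`|z.1| * z.2, `|z.1|)%R).
  apply: emeasurable_funM; first exact/measurable_EFinP/measurable_funX.
  have m1 := measurableT_comp (@normr_measurable R setT) measurable_fst.
  apply: (measurableT_comp mH); apply/measurable_fun_pairP; split.
    by apply: measurable_funM; [exact: m1|exact: measurable_snd].
  exact: m1.
have V0 (z : R * R) : 0 <= (z.1 ^+ 2)%:E * H (`|z.1| * z.2, `|z.1|)%R.
  by rewrite mule_ge0// lee_fin sqr_ge0.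
transitivity (\int[leb1 R]_v \int[leb1 R]_s ((v ^+ 2)%:E * H (`|v| * s, `|v|)%R)).
  apply: eq_integral_neq0.
  - exact: (@measurable_fun_fubini_tonelli_G _ _ _ _ R (leb1 R) _ mHv Hv0).
  - exact: (@measurable_fun_fubini_tonelli_F _ _ _ _ R (leb1 R) _ mV V0).
  - move=> v v0.
    have mHx : measurable_fun setT (fun x : R => H (x, `|v|%R)).
      exact: measurableT_comp mH (pair2_measurable _).
    transitivity (\int[leb1 R]_x (`|v|%:E * H (x, `|v|%R))).
      by apply: eq_integral.
    rewrite ge0_integralZl; [|exact: measurableT|exact: mHx
      |by move=> x _; exact: H0|by rewrite lee_fin].
    have mHs1 : measurable_fun setT (fun s : R => H (`|v| * s + 0, `|v|)%R).
      by apply: (measurableT_comp mHx); apply: measurable_funD => //; exact: measurable_funM.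
    have v1 : (0 < `|v|)%R by rewrite normr_gt0.
    rewrite -(integral_affine 0 v1 mHx (fun x => H0 _)) muleA -EFinM -expr2.
    rewrite real_normK ?num_real// -ge0_integralZl; [|exact: measurableT|exact: mHs1
      |by move=> s _; exact: H0|by rewrite lee_fin sqr_ge0].
    by apply: eq_integral => s _; rewrite addr0.
rewrite (@fubini_tonelli _ _ _ _ R (leb1 R) (leb1 R) _ mV V0).
apply: eq_integral => s _.
have mVs := measurableT_comp mV (pair2_measurable s).
rewrite -(integral_affine 0 (hypV_gt0 s) mVs (fun v => V0 _)) -ge0_integralZl; [|exact: measurableT
  |apply: (measurableT_comp mVs); by apply: measurable_funD => //; exact: measurable_funM
  |by move=> v _; exact: V0|by rewrite lee_fin ltW].
apply: eq_integral => r _ /=.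
rewrite addr0 normrM (gtr0_norm (hypV_gt0 s)) muleA -EFinM.
congr (_%:E * H (_, _)).
- by ring.
- by ring.
- by ring.
Qed.

End polar.

(** * Gaussian moments on a half-line *)

Lemma is_derive_continuous (R : realType) (f : R -> R) (x df : R) :
  is_derive x 1 f df -> {for x, continuous f}.
Proof.
by move=> [fx _]; apply: differentiable_continuous; exact/derivable1_diffP.
Qed.

Section gaussian_moment.
Variable R : realType.
Implicit Types a y t : R.

Lemma gauss_phi_ge0 t : 0 <= gauss_phi t.
Proof. exact: expR_ge0. Qed.

Lemma is_derive_gauss_phi t : is_derive t 1 (@gauss_phi R) (- t * gauss_phi t).
Proof.
have h : is_derive t 1 (fun t : R => - t ^+ 2 / 2) (- t).
  by apply: is_derive_eq; rewrite /GRing.scale/=; field.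
have := @is_derive1_comp R expR (fun t => - t ^+ 2 / 2) t _ _ (is_derive_expR _) h.
by rewrite mulrC.
Qed.

Lemma continuous_gauss_phi : continuous (@gauss_phi R).
Proof. by move=> t; exact: is_derive_continuous (is_derive_gauss_phi t). Qed.

(** Completing the square: exponential domination at any rate [c], which gives
  integrability and the limits at infinity below. *)
Lemma gauss_phi_le t (c : R) : gauss_phi t <= expR (c ^+ 2 / 2 - c * t).
Proof.
rewrite ler_expR -subr_ge0 (_ : _ - _ = (t - c) ^+ 2 / 2); last by field.
by rewrite divr_ge0// sqr_ge0.
Qed.

Lemma integral_gauss_phi_le y :
  (\int[leb1 R]_(t in `]-oo, y]) (gauss_phi t)%:E <= (expR (1 / 2 + y))%:E)%E.
Proof.
rewrite -[in X in (X <= _)%E](opprK y) ge0_integration_by_substitutionNy; last 2 first.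
- by apply: continuous_subspaceT; exact: continuous_gauss_phi.
- by move=> x _; exact: gauss_phi_ge0.
pose F t := - expR (1 / 2 - t) : R.
have dF t : is_derive t 1 F (expR (1 / 2 - t)).
  have h : is_derive t 1 (fun t : R => 1 / 2 - t) (-1).
    by apply: is_derive_eq; rewrite /GRing.scale /=; ring.
  have h2 := @is_derive1_comp R expR (fun t => 1 / 2 - t) t _ _ (is_derive_expR _) h.
  by apply: (is_derive_eq (is_deriveN h2)); rewrite mulrN1 opprK.
have cF t : {for t, continuous (fun t : R => expR (1 / 2 - t))}.
  apply: continuous_comp; last exact: continuous_expR.
  by apply: cvgB; [exact: cvg_cst|exact: cvg_id].
have <- : (\int[leb1 R]_(t in `[(- y)%R, +oo[) (expR (1 / 2 - t))%:E =
    (expR (1 / 2 + y)%R)%:E)%E.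
  rewrite (@ge0_continuous_FTC2y R _ F (- y) 0).
  - by rewrite /F sub0e -EFinN !opprK.
  - by move=> x _; exact: expR_ge0.
  - exact: continuous_subspaceT.
  - have : - (expR (1 / 2) * expR (- t)) @[t --> +oo] --> - (expR (1 / 2) * 0 : R).
      by apply: cvgN; apply: cvgM; [exact: cvg_cst|exact: cvgr_expR].
    have <- : F = (fun t => - (expR (1 / 2) * expR (- t))).
      by apply/funext => t; rewrite /F -expRD.
    by rewrite mulr0 oppr0.
  - by move=> x _; have [] := dF x.
  - by apply: cvg_at_right_filter; exact: is_derive_continuous (dF _).
  - by move=> x _; rewrite derive1E; exact: derive_val.
apply: ge0_le_integral => //=.
- by move=> x _; rewrite lee_fin gauss_phi_ge0.
- apply/measurable_EFinP; apply: measurable_funTS.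
  apply: continuous_measurable_fun => x; apply: continuous_comp.
    exact: opp_continuous.
  exact: continuous_gauss_phi.
- apply/measurable_EFinP; apply: measurable_funTS.
  by apply: continuous_measurable_fun => x; exact: cF.
- move=> x _; rewrite lee_fin (le_trans (gauss_phi_le _ (-1)))//.
  by rewrite ler_expR; lra.
Qed.

Lemma integrable_gauss_phi y :
  (leb1 R).-integrable `]-oo, y] (EFin \o @gauss_phi R).
Proof.
apply/integrableP; split.
  apply/measurable_EFinP; apply: measurable_funTS.
  by apply: continuous_measurable_fun; exact: continuous_gauss_phi.
under eq_integral do rewrite /= ger0_norm ?gauss_phi_ge0//.
by rewrite (le_lt_trans (integral_gauss_phi_le y)) ?ltry.
Qed.

Lemma gauss_Phi_ge0 a : 0 <= gauss_Phi a.
Proof. by apply: Rintegral_ge0 => t _; exact: gauss_phi_ge0. Qed.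

Lemma gauss_Phi_le a : gauss_Phi a <= expR (1 / 2 + a).
Proof.
rewrite /gauss_Phi /Rintegral -lee_fin fineK; first exact: integral_gauss_phi_le.
exact: integrable_fin_num (integrable_gauss_phi a).
Qed.

Lemma is_derive_gauss_Phi a : is_derive a 1 (@gauss_Phi R) (gauss_phi a).
Proof.
have a1 : a < a + 1 by rewrite ltrDl.
have ca : {for a, continuous (@gauss_phi R)} by exact: continuous_gauss_phi.
have [d1 d2] := continuous_FTC1 a1 (integrable_gauss_phi (a + 1)) (ltNyr a)
  ca.
by apply: DeriveDef; [exact: d1|rewrite -derive1E; exact: d2].
Qed.

(** The integral of [r ^+ 2 * gauss_phi (r - a)] over [r >= 0]. *)
Definition gauss_moment a := a * gauss_phi a + (a ^+ 2 + 1) * gauss_Phi a.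

Lemma integral_sqr_gauss a :
  (\int[leb1 R]_(r in `[0%R, +oo[) (r ^+ 2 * gauss_phi (r - a))%:E =
   (gauss_moment a)%:E)%E.
Proof.
(* an antiderivative of [r ^+ 2 * gauss_phi (r - a)] that vanishes at +oo *)
pose F r := - ((a + r) * gauss_phi (r - a) + (a ^+ 2 + 1) * gauss_Phi (a - r)).
have dF (r : R) : is_derive r 1 F (r ^+ 2 * gauss_phi (r - a)).
  have d1 : is_derive r 1 (fun r : R => r - a) 1.
    by apply: is_derive_eq; rewrite /GRing.scale /=; ring.
  have d2 : is_derive r 1 (fun r : R => a - r) (-1).
    by apply: is_derive_eq; rewrite /GRing.scale /=; ring.
  have d3 : is_derive r 1 (fun r : R => a + r) 1.
    by apply: is_derive_eq; rewrite /GRing.scale /=; ring.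
  have d4 := @is_derive1_comp R (@gauss_phi R) (fun r => r - a) r _ _ (is_derive_gauss_phi _) d1.
  have d5 := @is_derive1_comp R (@gauss_Phi R) (fun r => a - r) r _ _ (is_derive_gauss_Phi _) d2.
  have d6 := is_deriveN (is_deriveD (is_deriveM d3 d4) (is_deriveZ (a ^+ 2 + 1) d5)).
  apply: (is_derive_eq d6).
  rewrite /GRing.scale /= (_ : gauss_phi (a - r) = gauss_phi (r - a)); last first.
    by rewrite /gauss_phi -opprB sqrrN.
  ring.
rewrite (@ge0_continuous_FTC2y R _ F 0 0).
- rewrite /F sub0e -EFinN opprK /gauss_moment addr0 subr0 sub0r.
  by rewrite /gauss_phi sqrrN.
- by move=> r _; rewrite mulr_ge0 ?sqr_ge0 ?gauss_phi_ge0.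
- apply: continuous_subspaceT => r; apply: cvgM.
    exact: exprn_continuous.
  apply: (@continuous_comp _ _ _ (fun r => r - a)); last exact: continuous_gauss_phi.
  by apply: cvgB; [exact: cvg_id|exact: cvg_cst].
(* [a + r <= expR (a + r)] and [gauss_phi (r - a) <= expR (2 - 2 * (r - a))],
   so that [F] is dominated by [C * expR (- r)] *)
- pose C := expR (2 + 3 * a) + (a ^+ 2 + 1) * expR (1 / 2 + a).
  apply: (@squeeze_cvgr _ _ _ _ (fun r => - (C * expR (- r))) (cst 0)); last 2 first.
  + have : - (C * expR (- t)) @[t --> +oo] --> - (C * 0).
      by apply: cvgN; apply: cvgM; [exact: cvg_cst|exact: cvgr_expR].
    by rewrite mulr0 oppr0.
  + exact: cvg_cst.
  near=> r.
  have ar : 0 <= a + r by rewrite -lerBlDl sub0r; near: r; apply: nbhs_pinfty_ge; rewrite num_real.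
  rewrite /F lerN2 /= oppr_le0; apply/andP; split; last first.
    by rewrite addr_ge0// mulr_ge0 ?gauss_phi_ge0 ?gauss_Phi_ge0// addr_ge0 ?sqr_ge0.
  rewrite /C [leRHS]mulrDl; apply: lerD.
    rewrite (_ : expR _ * _ = expR (a + r) * expR (2 - 2 * (r - a))); last first.
      by rewrite -!expRD; congr expR; ring.
    apply: ler_pM => //; first exact: gauss_phi_ge0.
      by rewrite (le_trans _ (expR_ge1Dx _))// lerDr.
    by rewrite (le_trans (gauss_phi_le _ 2))// ler_expR; lra.
  rewrite -mulrA ler_wpM2l// ?addr_ge0 ?sqr_ge0//.
  by rewrite -expRD -addrA gauss_Phi_le.
- by move=> r _; have [] := dF r.
- by apply: cvg_at_right_filter; exact: is_derive_continuous (dF _).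
- by move=> r _; rewrite derive1E; exact: derive_val.
Unshelve. all: by end_near. Qed.

End gaussian_moment.

(** * The colatitude and the integral formula for f *)

Lemma ler_acos (R : realType) (u v : R) :
  -1 <= u -> u <= v -> v <= 1 -> acos v <= acos u.
Proof.
move=> u1 uv v1.
have uI : -1 <= u <= 1 by rewrite u1 (le_trans uv).
have vI : -1 <= v <= 1 by rewrite v1 (le_trans u1).
rewrite leNgt; apply/negP => ltuv.
have : cos (acos v) < cos (acos u).
  by rewrite ltr_cos// in_itv/= ?acos_ge0 ?acos_lepi.
by rewrite !acosK ?in_itv//= ltNge uv.
Qed.

(** [acos] is monotone on [-1, 1] and constant outside of it. *)
Lemma measurable_acos (R : realType) : measurable_fun setT (@acos R).
Proof.
pose clip (x : R) := Num.max (-1) (Num.min x 1).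
have clipI x : -1 <= clip x <= 1.
  by rewrite /clip ge_max le_max lexx /= ge_min lexx orbT andbT; lra.
have mclip : measurable_fun setT (fun x => acos (clip x)).
  apply: nonincreasing_measurable => // x y xy.
  have /andP[? ?] := clipI x; have /andP[? ?] := clipI y.
  apply: ler_acos => //; rewrite /clip ge_max !le_max lexx/=.
  by rewrite le_min !ge_min xy lexx ?orbT.
have -> : @acos R = fun x => if -1 <= x <= 1 then acos (clip x) else point.
  apply/funext => x; case: ifPn => [/andP[x1 x2]|xN].
    by rewrite /clip (min_idPl x2) (max_idPr x1).
  rewrite unlock; apply: getPN => y [_ ex].
  by move: xN; rewrite -ex cos_geN1 cos_le1.
apply: measurable_fun_ifT => //.
by apply: measurable_and; apply: measurable_fun_ler.
Qed.

Section colatitude.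
Variable R : realType.
Implicit Types s t : R.

Lemma sin_atan s : sin (atan s) = s / hyp s.
Proof.
have := atanK s; rewrite /tan => /(canRL (mulfVK _)) ->; last first.
  by rewrite cos_atan invr_eq0 gt_eqF// hyp_gt0.
by rewrite cos_atan.
Qed.

Lemma cos_colatitude s : cos (pi / 2 - atan s) = s / hyp s.
Proof. by rewrite -opprB cosN cosBpihalf sin_atan. Qed.

Lemma sin_colatitude s : sin (pi / 2 - atan s) = (hyp s)^-1.
Proof. by rewrite -opprB sinN sinBpihalf opprK cos_atan. Qed.

Lemma colatitude_itv s : 0 < pi / 2 - atan s < pi.
Proof.
have := atan_ltpi2 s; have := atan_gtNpi2 s; move: (atan s) => b ? ?.
by apply/andP; split; lra.
Qed.

Lemma acos_colatitude s : acos (s / hyp s) = pi / 2 - atan s.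
Proof.
rewrite -cos_colatitude cosK// in_itv/=.
by have /andP[/ltW -> /ltW ->] := colatitude_itv s.
Qed.

Lemma colatitude_onto t : 0 < t < pi -> exists s, pi / 2 - atan s = t.
Proof.
move=> /andP[t0 tpi]; exists (tan (pi / 2 - t)).
rewrite tanK; first by rewrite opprB addrC subrK.
by rewrite in_itv/=; apply/andP; split; lra.
Qed.

(** The substitution [t = pi / 2 - atan s], for which
  [dt = - (hyp s)^-2 ds] and [sin t = (hyp s)^-1].  It is performed on the
  segments [-n, n], whose images exhaust ]0, pi[. *)
Lemma integral_colatitude (g : R -> R) :
  continuous g -> (forall t, 0 <= g t) ->
  (\int[leb1 R]_s ((hyp s)^-1 ^+ 3 * g (pi / 2 - atan s))%:E =
   \int[leb1 R]_(t in `[0%R, pi]) (g t * sin t)%:E)%E.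
Proof.
move=> cg g0.
pose F s := pi / 2 - atan s; pose G t := g t * sin t.
pose f s := (hyp s)^-1 ^+ 3 * g (F s).
have dF s : is_derive s 1 F (- (1 + s ^+ 2)^-1).
  have h := is_deriveB (is_derive_cst (pi / 2 : R) s (1 : R)) (is_derive1_atan s).
  by apply: (is_derive_eq h); rewrite sub0r.
have F'E : F^`()%classic = fun s => - (1 + s ^+ 2)^-1.
  by apply/funext => s; rewrite derive1E; exact: derive_val.
have cF : continuous F by move=> s; exact: is_derive_continuous (dF s).
have cF' : continuous F^`()%classic.
  by rewrite F'E => s; apply: cvgN; exact: continuous_oneDsqrV.
have cG : continuous G by move=> t; apply: cvgM; [exact: cg|exact: continuous_sin].
have FE s : ((G \o F) * - F^`()%classic) s = f s.
  rewrite /f F'E /G /= !fctE opprK sin_colatitude -sqr_hyp -/(F s).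
  by field; rewrite gt_eqF ?hyp_gt0.
have Flt s t : s < t -> F t < F s by move=> st; rewrite ltrD2l ltrN2 lt_atan.
have F_itv s : 0 < F s < pi := colatitude_itv s.
have step n : (\int[leb1 R]_(t in `[F n%:R, F (- n%:R)%R]) (G t)%:E =
    \int[leb1 R]_(s in `[(- n%:R)%R, n%:R]) (f s)%:E)%E.
  rewrite integration_by_substitution_decreasing.
  - by apply: eq_integral => s _; rewrite FE.
  - by rewrite (@le_trans _ _ 0)// oppr_le0.
  - by move=> s t _ _; exact: Flt.
  - by move=> s _; exact: cF'.
  - by apply: cvgP; apply: cvg_at_right_filter; exact: cF'.
  - by apply: cvgP; apply: cvg_at_left_filter; exact: cF'.
  - split; first by move=> s _; have [] := dF s.
      by apply: cvg_at_right_filter; exact: cF.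
    by apply: cvg_at_left_filter; exact: cF.
  - exact: continuous_subspaceT.
have mG : measurable_fun setT G by exact: continuous_measurable_fun.
have mf : measurable_fun setT f.
  rewrite -(_ : ((G \o F) * - F^`()%classic) = f); last by apply/funext.
  apply: measurable_funM.
    by apply: (measurableT_comp mG); exact: continuous_measurable_fun.
  by apply: measurable_funN; exact: continuous_measurable_fun.
have f0 s : 0 <= f s by rewrite mulr_ge0// exprn_ge0// invr_ge0 hyp_ge0.
have G0 t : `[0, pi]%classic t -> 0 <= G t.
  by rewrite /= in_itv/= => tI; rewrite mulr_ge0// sin_ge0_pi.
have subI n : `[F n%:R, F (- n%:R)%R] `<=` `[0, pi].
  move=> t /=; rewrite !in_itv/= => /andP[t1 t2].
  have /andP[/ltW a1 _] := F_itv n%:R; have /andP[_ /ltW a2] := F_itv (- n%:R).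
  by rewrite (le_trans a1)// (le_trans t2).
have le_nat (m n : nat) : (m <= n)%N -> m%:R <= n%:R :> R by rewrite ler_nat.
have leF s t : s <= t -> F t <= F s by move=> st; rewrite lerB// le_atan.
have c1 := @ge0_nondecreasing_set_cvg_integral _ (measurableTypeR R) R
  (fun n => `[F n%:R, F (- n%:R)%R]%classic) (EFin \o G) (leb1 R).
have c2 := @ge0_nondecreasing_set_cvg_integral _ (measurableTypeR R) R
  (fun n => `[(- n%:R)%R, n%:R]%classic) (EFin \o f) (leb1 R).
have U1 : \bigcup_n `[F n%:R, F (- n%:R)%R]%classic = `]0, pi[%classic.
  apply/seteqP; split => [t [n _] /=|t /=]; rewrite !in_itv/=.
    move=> /andP[t1 t2].
    have /andP[a1 _] := F_itv n%:R; have /andP[_ a2] := F_itv (- n%:R).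
    by rewrite (lt_le_trans a1)// (le_lt_trans t2).
  move=> /colatitude_onto[s <-].
  exists (Num.truncn `|s|).+1 => //=; rewrite in_itv/= -/(F s).
  have sn : `|s| <= (Num.truncn `|s|).+1%:R by exact/ltW/truncnS_gt.
  by move: sn; rewrite ler_norml => /andP[? ?]; rewrite !leF.
have U2 : \bigcup_n `[(- n%:R)%R, n%:R]%classic = [set: R].
  apply/seteqP; split => // s _.
  exists (Num.truncn `|s|).+1 => //=; rewrite in_itv/= -ler_norml.
  exact/ltW/truncnS_gt.
have h1 : (\int[leb1 R]_(t in `[F n%:R, F (- n%:R)%R]) (G t)%:E @[n --> \oo]
    --> \int[leb1 R]_(t in `]0%R, pi[) (G t)%:E)%E.
  rewrite -U1; apply: c1.
  - move=> m n mn; apply/subsetPset => t /=; rewrite !in_itv/= => /andP[t1 t2].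
    by rewrite (le_trans _ t1)/= ?(le_trans t2) ?leF ?lerN2 ?le_nat.
  - by move=> n; exact: measurable_itv.
  - by move=> n; apply: measurable_funTS; exact/measurable_EFinP.
  - by move=> n t /subI tI; rewrite lee_fin G0.
have h2 : (\int[leb1 R]_(s in `[(- n%:R)%R, n%:R]) (f s)%:E @[n --> \oo]
    --> \int[leb1 R]_s (f s)%:E)%E.
  rewrite -U2; apply: c2.
  - move=> m n mn; apply/subsetPset => t /=; rewrite !in_itv/= => /andP[t1 t2].
    by rewrite (le_trans _ t1)/= ?(le_trans t2) ?lerN2 ?le_nat.
  - by move=> n; exact: measurable_itv.
  - by move=> n; apply: measurable_funTS; exact/measurable_EFinP.
  - by move=> n t _; rewrite lee_fin f0.
rewrite (@integral_itv_bndoo _ _ _ _ true false); last first.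
  by apply: measurable_funTS; exact/measurable_EFinP.
move: h1; rewrite (_ : (fun n => _) = (fun n : nat => \int[leb1 R]_(s in `[(- n%:R)%R, n%:R]) (f s)%:E)%E); last first.
  by apply/funext => n; exact: step.
by move=> h1; apply: (cvg_unique _ h2 h1).
Qed.

End colatitude.

Lemma measurable_invr (R : realType) : measurable_fun setT (@GRing.inv R).
Proof.
have oD : open (~` [set (0 : R)]).
  by apply: closed_openC; exact/accessible_closed_set1/hausdorff_accessible/Rhausdorff.
have mD : measurable_fun (~` [set (0 : R)]) (@GRing.inv R).
  apply: open_continuous_measurable_fun => // r.
  by rewrite inE /= => /eqP r0; exact: inv_continuous.
rewrite -(setvU [set (0 : R)]); apply/measurable_funU.
- exact: open_measurable.
- exact: measurable_set1.
- by split => //; exact: measurable_fun_set1.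
Qed.

Section gaussian_colatitude.
Variables (R : realType) (m s : R).
Hypotheses (m_gt0 : 0 < m) (s_gt0 : 0 < s).

(** The bracket in the integral formula for [f_cov]. *)
Definition mills_moment (a : R) := a + (a ^+ 2 + 1) * (gauss_Phi a / gauss_phi a).

Lemma gauss_phi_gt0 (a : R) : 0 < gauss_phi a. Proof. exact: expR_gt0. Qed.

Lemma gauss_momentE (a : R) : gauss_moment a = gauss_phi a * mills_moment a.
Proof.
rewrite /gauss_moment /mills_moment; field.
by rewrite gt_eqF ?gauss_phi_gt0.
Qed.

Lemma mills_moment_ge0 (a : R) : 0 <= mills_moment a.
Proof.
rewrite -(pmulr_rge0 _ (gauss_phi_gt0 a)) -gauss_momentE -lee_fin.
rewrite -integral_sqr_gauss integral_ge0// => r _.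
by rewrite lee_fin mulr_ge0 ?sqr_ge0 ?gauss_phi_ge0.
Qed.

Lemma continuous_mills_moment : continuous mills_moment.
Proof.
move=> a; apply: cvgD; first exact: cvg_id.
apply: cvgM.
  by apply: cvgD; [exact: exprn_continuous|exact: cvg_cst].
apply: cvgM; first exact: is_derive_continuous (is_derive_gauss_Phi a).
by apply: cvgV; [rewrite gt_eqF ?gauss_phi_gt0|exact: continuous_gauss_phi].
Qed.

Let x := m / s.

(** Integral along the line at angle of cosine [c] to the mean [m]: scaling by
  [s] and completing the square leave the half-line moment at [x * c]. *)
Lemma integral_radial (c : R) :
  (\int[leb1 R]_r
     (r ^+ 2 * expR (- (r ^+ 2 - 2 * `|r| * (m * c) + m ^+ 2) / (2 * s ^+ 2)))%:E =
   (2 * s ^+ 3 * expR (- x ^+ 2 / 2) * mills_moment (x * c))%:E)%E.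
Proof.
pose f (r : R) := r ^+ 2 * expR (- (r ^+ 2 - 2 * `|r| * (m * c) + m ^+ 2) / (2 * s ^+ 2)).
have f0 r : 0 <= f r by rewrite mulr_ge0 ?sqr_ge0 ?expR_ge0.
have cf : continuous f.
  move=> r; apply: cvgM; first exact: exprn_continuous.
  apply: continuous_comp; last exact: continuous_expR.
  apply: cvgM; last exact: cvg_cst.
  apply: cvgN; apply: cvgD; last exact: cvg_cst.
  apply: cvgB; first exact: exprn_continuous.
  apply: cvgM; last exact: cvg_cst.
  apply: cvgM; first exact: cvg_cst.
  exact: norm_continuous.
have mf : measurable_fun setT (EFin \o f).
  by apply/measurable_EFinP; exact: continuous_measurable_fun.
rewrite -(@integral_affine _ s 0 _ s_gt0 mf) => [|r]; last by rewrite lee_fin.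
pose g (u : R) := f (s * u + 0).
have cg : continuous g.
  move=> u; apply: (@continuous_comp _ _ _ (fun u => s * u + 0)); last exact: cf.
  apply: cvgD; last exact: cvg_cst.
  by apply: cvgM; [exact: cvg_cst|exact: cvg_id].
have sN0 : s != 0 by rewrite gt_eqF.
rewrite (_ : (\int[leb1 R]_u _)%E = (\int[leb1 R]_u (g u)%:E)%E)//.
rewrite ge0_symfun_integralT//; last 2 first.
- by move=> u; exact: f0.
- by move=> u; rewrite /g /= !addr0 mulrN /f normrN sqrrN.
rewrite (_ : [set u | _] = `[0, +oo[%classic); last first.
  by apply/seteqP; split => u/=; rewrite in_itv/= andbT.
pose k := s ^+ 2 * expR ((x * c) ^+ 2 / 2 - x ^+ 2 / 2).
transitivity (s%:E * (2 * \int[leb1 R]_(u in `[0%R, +oo[)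
    (k%:E * (u ^+ 2 * gauss_phi (u - x * c))%:E)))%E.
  congr (_ * (_ * _))%E; apply: eq_integral => u; rewrite inE/= in_itv/= andbT => u0.
  rewrite -EFinM /g /f /k addr0 normrM !ger0_norm//; last exact: ltW.
  congr EFin; rewrite [RHS](_ : _ = (s * u) ^+ 2 *
    (expR ((x * c) ^+ 2 / 2 - x ^+ 2 / 2) * gauss_phi (u - x * c))); last by ring.
  rewrite /gauss_phi -expRD; congr (_ * expR _).
  by rewrite /x; field.
rewrite ge0_integralZl_EFin//; last 3 first.
- by move=> u _; rewrite lee_fin mulr_ge0 ?sqr_ge0 ?gauss_phi_ge0.
- apply/measurable_EFinP/measurable_funTS; apply: measurable_funM.
    exact: measurable_funX.
  apply: (measurableT_comp (continuous_measurable_fun (@continuous_gauss_phi R))).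
  exact: measurable_funB.
- by rewrite mulr_ge0 ?sqr_ge0 ?expR_ge0.
rewrite integral_sqr_gauss -!EFinM gauss_momentE; congr EFin.
have -> : k = s ^+ 2 * (expR (- x ^+ 2 / 2) * (gauss_phi (x * c))^-1).
  rewrite /k /gauss_phi -expRN -expRD; congr (_ * expR _); ring.
by field; rewrite gt_eqF ?gauss_phi_gt0.
Qed.

Definition gauss3_cst : R := ((2 * pi * s ^+ 2) `^ (3 / 2))^-1.

Lemma gauss3_cstE : gauss3_cst * s ^+ 3 = ((2 * pi) `^ (3 / 2))^-1.
Proof.
have s0 : 0 <= s by exact: ltW.
have e : (s ^+ 2) `^ (3 / 2) = s ^+ 3.
  by rewrite -!powR_mulrn// -powRrM; congr (_ `^ _); field.
have -> : gauss3_cst = ((2 * pi) `^ (3 / 2) * s ^+ 3)^-1.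
  rewrite /gauss3_cst powRM ?mulr_ge0 ?pi_ge0 ?sqr_ge0//.
  by apply: congr1; apply: congr1; exact: e.
by field; rewrite !gt_eqF// powR_gt0// mulr_gt0// pi_gt0.
Qed.

(** In spherical coordinates about the axis of the mean the radial integral is
  [integral_radial] and the angular one is the integral that defines
  [f_cov]. *)
Lemma integral_sqr_colatitude :
  (\int[leb3 R]_p (acos (p.1 / Num.sqrt (p.1 ^+ 2 +
         (Num.sqrt (p.2.1 ^+ 2 + p.2.2 ^+ 2)) ^+ 2)) ^+ 2 *
      (gauss3_cst * expR (- ((p.1 - m) ^+ 2 +
         (Num.sqrt (p.2.1 ^+ 2 + p.2.2 ^+ 2)) ^+ 2) / (2 * s ^+ 2))))%:E =
   (2 * f_cov (s ^+ 2 / m ^+ 2))%:E)%E.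
Proof.
pose H (z : R * R) := acos (z.1 / Num.sqrt (z.1 ^+ 2 + z.2 ^+ 2)) ^+ 2 *
  (gauss3_cst * expR (- ((z.1 - m) ^+ 2 + z.2 ^+ 2) / (2 * s ^+ 2))).
have K0 : 0 <= gauss3_cst by rewrite invr_ge0 powR_ge0.
have H0 z : 0 <= H z by rewrite mulr_ge0 ?sqr_ge0// mulr_ge0 ?expR_ge0.
have mH : measurable_fun setT (EFin \o H).
  have m1 : measurable_fun setT (fun z : R * R => z.1 ^+ 2 + z.2 ^+ 2).
    by apply: measurable_funD; apply: measurable_funX.
  apply/measurable_EFinP; apply: measurable_funM.
    apply: measurable_funX; apply: (measurableT_comp (@measurable_acos R)).
    apply: measurable_funM => //; apply: (measurableT_comp (@measurable_invr R)).
    exact: (measurableT_comp (@measurable_sqrtr R)).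
  apply: measurable_funM => //; apply: (measurableT_comp (@measurable_expR R)).
  apply: measurable_funM => //; apply: measurable_funN.
  apply: measurable_funD; apply: measurable_funX => //.
  exact: measurable_funB.
rewrite (integral_polar3 mH (fun z => H0 z)).
pose C := gauss3_cst * (2 * s ^+ 3 * expR (- x ^+ 2 / 2)).
have C0 : 0 <= C.
  by rewrite mulr_ge0// mulr_ge0 ?expR_ge0// mulr_ge0// exprn_ge0// ltW.
pose g (t : R) := t ^+ 2 * mills_moment (x * cos t).
have g0 t : 0 <= g t by rewrite mulr_ge0 ?sqr_ge0 ?mills_moment_ge0.
have cg : continuous g.
  move=> t; apply: cvgM; first exact: exprn_continuous.
  apply: (@continuous_comp _ _ _ (fun t => x * cos t)); last exact: continuous_mills_moment.
  by apply: cvgM; [exact: cvg_cst|exact: continuous_cos].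
have mg : measurable_fun setT g by exact: continuous_measurable_fun.
transitivity (pi%:E * (C%:E * \int[leb1 R]_t
    ((hyp t)^-1 ^+ 3 * g (pi / 2 - atan t))%:E))%E.
  apply: (congr1 (fun u => pi%:E * u)%E).
  rewrite -ge0_integralZl_EFin//; last 2 first.
  - by move=> t _; rewrite lee_fin mulr_ge0// exprn_ge0// invr_ge0 hyp_ge0.
  - apply/measurable_EFinP; apply: measurable_funM.
      apply: measurable_funX; apply: (measurableT_comp (@measurable_invr R)).
      exact: measurable_hyp.
    apply: (measurableT_comp mg); apply: measurable_funB => //.
    apply: continuous_measurable_fun => t; exact: continuous_atan.
  apply: eq_integral => t _.
  have h0 := hyp_gt0 t.
  have hN0 : hyp t != 0 by rewrite gt_eqF.
  pose q := (hyp t)^-1 ^+ 3 * ((pi / 2 - atan t) ^+ 2 * gauss3_cst).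
  transitivity (\int[leb1 R]_r (q%:E * (r ^+ 2 * expR (- (r ^+ 2 -
      2 * `|r| * (m * (t / hyp t)) + m ^+ 2) / (2 * s ^+ 2)))%:E))%E.
    apply: eq_integral => r _; rewrite -!EFinM; congr EFin.
    have [->|r0] := eqVneq r 0; first by rewrite expr0n/= !(mulr0, mul0r).
    have e1 : (`|r| * (t / hyp t)) ^+ 2 + (`|r| / hyp t) ^+ 2 = r ^+ 2.
      transitivity (`|r| ^+ 2 * ((1 + t ^+ 2) / hyp t ^+ 2)); first by field.
      by rewrite -sqr_hyp divff ?expf_neq0// mulr1 real_normK ?num_real.
    rewrite /H /= e1 sqrtr_sqr (mulrC `|r| (t / hyp t)) mulfK ?normr_eq0//.
    rewrite acos_colatitude.
    rewrite (_ : (t / hyp t * `|r| - m) ^+ 2 + (`|r| / hyp t) ^+ 2 =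
      r ^+ 2 - 2 * `|r| * (m * (t / hyp t)) + m ^+ 2); last first.
      by rewrite -[in RHS]e1; ring.
    by rewrite /q; ring.
  rewrite ge0_integralZl_EFin//; last 3 first.
  - by move=> r _; rewrite lee_fin mulr_ge0 ?sqr_ge0 ?expR_ge0.
  - apply/measurable_EFinP; apply: measurable_funM; first exact: measurable_funX.
    apply: (measurableT_comp (@measurable_expR R)).
    apply: measurable_funM => //; apply: measurable_funN.
    apply: measurable_funD => //; apply: measurable_funB.
      exact: measurable_funX.
    by apply: measurable_funM => //; apply: measurable_funM => //; exact: normr_measurable.
  - by rewrite /q mulr_ge0 ?exprn_ge0 ?invr_ge0 ?hyp_ge0// mulr_ge0 ?sqr_ge0.
  rewrite integral_radial -!EFinM /g cos_colatitude; congr EFin.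
  by rewrite /q /C; ring.
rewrite integral_colatitude//.
have ig : (leb1 R).-integrable `[0%R, pi] (EFin \o (fun t => g t * sin t)).
  apply: continuous_compact_integrable; first exact: segment_compact.
  apply: continuous_subspaceT => t.
  by apply: cvgM; [exact: cg|exact: continuous_sin].
have Ifin : (\int[leb1 R]_(t in `[0%R, pi]) (g t * sin t)%:E)%E \is a fin_num.
  by apply: integrable_fin_num.
rewrite -(fineK Ifin) -!EFinM; congr EFin.
have lN0 : s ^+ 2 / m ^+ 2 != 0 by rewrite gt_eqF// divr_gt0// exprn_gt0.
have xE : (Num.sqrt (s ^+ 2 / m ^+ 2))^-1 = x.
  by rewrite -expr_div_n sqrtr_sqr gtr0_norm ?divr_gt0// invf_div.
rewrite /f_cov (negbTE lN0) xE.
set I1 := fine _; set I2 := Rintegral _ _ _.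
have -> : I2 = I1.
  rewrite /I1 /I2 /Rintegral; congr fine; apply: eq_integral => t _.
  by congr EFin; rewrite /g /mills_moment /=; ring.
have := gauss3_cstE; rewrite /C => e.
rewrite (_ : _ * (_ * I1) = 2 * (pi * (gauss3_cst * s ^+ 3) * expR (- x ^+ 2 / 2) * I1)).
  by rewrite e.
ring.
Qed.

End gaussian_colatitude.

(** * Row vectors and triples *)

Section coordinates.
Variable R : realType.
Implicit Types (p : R * (R * R)) (x y : 'rV[R]_3).

Definition coord3 x : R * (R * R) := (x 0 0, (x 0 1, x 0 (2%:R : 'I_3))).

Lemma big_ord3 (F : 'I_3 -> R) : \sum_(k < 3) F k = F 0 + F 1 + F (2%:R : 'I_3).
Proof.
rewrite !big_ord_recl big_ord0 addr0 addrA.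
by congr (_ + F _ + F _); apply/val_inj.
Qed.

Lemma ord3E (P : 'I_3 -> Prop) : P 0 -> P 1 -> P (2%:R : 'I_3) -> forall k, P k.
Proof.
move=> P0 P1 P2 [[|[|[|//]]] ki].
- by rewrite (_ : Ordinal ki = 0)//; exact/val_inj.
- by rewrite (_ : Ordinal ki = 1)//; exact/val_inj.
- by rewrite (_ : Ordinal ki = (2%:R : 'I_3))//; exact/val_inj.
Qed.

Lemma vec3_0 p : vec3 p 0 0 = p.1. Proof. by rewrite mxE. Qed.
Lemma vec3_1 p : vec3 p 0 1 = p.2.1. Proof. by rewrite mxE. Qed.
Lemma vec3_2 p : vec3 p 0 (2%:R : 'I_3) = p.2.2. Proof. by rewrite mxE. Qed.
Definition vec3E := (vec3_0, vec3_1, vec3_2).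

Lemma coord3K : cancel coord3 (@vec3 R).
Proof.
by move=> x; apply/rowP; apply: ord3E; rewrite ?vec3E.
Qed.

Lemma vec3K : cancel (@vec3 R) coord3.
Proof. by move=> [a [b c]]; rewrite /coord3 !vec3E. Qed.

Lemma dotE x y : dot x y = x 0 0 * y 0 0 + x 0 1 * y 0 1
  + x 0 (2%:R : 'I_3) * y 0 (2%:R : 'I_3).
Proof. by rewrite /dot big_ord3. Qed.

(** The Borel sets of the space of row vectors are generated by the open sets, and
  the preimage of an open set is the union of the rational boxes it
  contains. *)
Lemma measurable_vec3 : measurable_fun setT (@vec3 R : R * (R * R) -> borel3 R).
Proof.
apply: (@measurability _ _ _ (borel3 R) setT _ (@open 'rV[R]_3)) => //.
move=> _ [U oU <-]; rewrite setTI.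
pose box (i : (rat * rat) * ((rat * rat) * (rat * rat))) : set (R * (R * R)) :=
  `]ratr i.1.1, ratr i.1.2[ `*`
  (`]ratr i.2.1.1, ratr i.2.1.2[ `*` `]ratr i.2.2.1, ratr i.2.2.2[).
pose F i := if `[< box i `<=` @vec3 R @^-1` U >] then box i else set0.
rewrite (_ : _ @^-1` _ = \bigcup_i F i).
  apply: countable_bigcupT_measurable => [|i]; first exact: countableP.
  rewrite /F; case: asboolP => // _.
  by apply: measurableX; [|apply: measurableX]; exact: measurable_itv.
apply/seteqP; split => [p Up|p [i _]]; last first.
  by rewrite /F; case: asboolP => // sub /sub.
have [e e0 eU] : exists2 e : R, 0 < e & forall y, (forall k, `|vec3 p 0 k - y 0 k| < e) -> U y.
  move: oU; rewrite openE => /(_ _ Up)/nbhs_ballP[e /= e0 eU].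
  exists e => // y ye; apply: eU; split => // i j.
  by rewrite (ord1 i); exact: ye.
have near_lt (t : R) : exists ab : rat * rat, [/\ ratr ab.1 < t, t < ratr ab.2 &
    forall u, ratr ab.1 < u < ratr ab.2 -> `|t - u| < e].
  have /rat_in_itvoo[a] : t - e < t by rewrite ltrBlDr ltrDl.
  have /rat_in_itvoo[b] : t < t + e by rewrite ltrDl.
  rewrite !in_itv/= => /andP[? ?] /andP[? ?]; exists (a, b); split => // u /andP[/= ? ?].
  by rewrite ltr_norml; apply/andP; split; lra.
have [i1 [a1 b1 c1]] := near_lt p.1.
have [i2 [a2 b2 c2]] := near_lt p.2.1.
have [i3 [a3 b3 c3]] := near_lt p.2.2.
exists (i1, (i2, i3)) => //; rewrite /F asboolT; last first.
  move=> q [/= h1 [/= h2 h3]]; move: h1 h2 h3; rewrite !in_itv/=.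
  by move=> /c1 h1 /c2 h2 /c3 h3; apply: eU; apply: ord3E; rewrite !vec3E.
by rewrite /box /= !in_itv/= a1 b1 a2 b2 a3 b3.
Qed.

Lemma continuous_measurable_borel3 (f : 'rV[R]_3 -> R) :
  continuous f -> measurable_fun setT (f : borel3 R -> R).
Proof.
move=> /continuousP cf; apply: (measurability _ (RGenOpens.measurableE R)).
move=> _ [_ [a [b ->] <-]]; rewrite setTI.
by apply: sub_sigma_algebra; apply/cf/interval_open.
Qed.

Lemma measurable_coord (k : 'I_3) :
  measurable_fun setT (fun x : borel3 R => (x : 'rV[R]_3) 0 k).
Proof. by apply: continuous_measurable_borel3; exact: coord_continuous. Qed.

Lemma measurable_to_borel3 d (T : measurableType d) (f : T -> 'rV[R]_3) :
  (forall k, measurable_fun setT (fun t => f t 0 k)) ->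
  measurable_fun setT (f : T -> borel3 R).
Proof.
move=> mf.
have -> : f = @vec3 R \o (fun t => coord3 (f t)).
  by apply/funext => t; rewrite /= coord3K.
apply: (measurableT_comp measurable_vec3).
by apply/measurable_fun_pairP; split; [|apply/measurable_fun_pairP; split]; exact: mf.
Qed.

Lemma measurable_dot d (T : measurableType d) (f g : T -> 'rV[R]_3) :
  measurable_fun setT (f : T -> borel3 R) ->
  measurable_fun setT (g : T -> borel3 R) ->
  measurable_fun setT (fun t => dot (f t) (g t)).
Proof.
move=> mf mg.
have mfk k := measurableT_comp (measurable_coord k) mf.
have mgk k := measurableT_comp (measurable_coord k) mg.
rewrite (_ : (fun t => _) = fun t => f t 0 0 * g t 0 0 + f t 0 1 * g t 0 1
  + f t 0 (2%:R : 'I_3) * g t 0 (2%:R : 'I_3)); last first.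
  by apply/funext => t; rewrite dotE.
apply: measurable_funD; last exact: measurable_funM (mfk _) (mgk _).
by apply: measurable_funD; exact: measurable_funM (mfk _) (mgk _).
Qed.

Lemma measurable_enorm : measurable_fun setT (@enorm R : borel3 R -> R).
Proof.
apply: (measurableT_comp (@measurable_sqrtr R)).
by apply: measurable_dot; exact: measurable_id.
Qed.

Lemma measurable_pr : measurable_fun setT (@pr R : borel3 R -> borel3 R).
Proof.
apply: measurable_to_borel3 => k.
rewrite (_ : (fun t => _) = fun t : borel3 R => (enorm t)^-1 * (t : 'rV[R]_3) 0 k).
  apply: measurable_funM; last exact: measurable_coord.
  exact: (measurableT_comp (@measurable_invr R) measurable_enorm).
by apply/funext => t; rewrite mxE.
Qed.

End coordinates.

(** * Integration against a density *)

Section density.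
Context d d' (S : measurableType d) (T : measurableType d') (R : realType).
Variables (lam : {measure set S -> \bar R}) (nu : {measure set T -> \bar R}).
Variables (g : S -> T) (rho : S -> R).
Hypotheses (mg : measurable_fun setT g) (mrho : measurable_fun setT rho)
  (rho0 : forall s, 0 <= rho s)
  (nuE : forall B, measurable B ->
    nu B = (\int[lam]_(s in g @^-1` B) (rho s)%:E)%E).
Local Open Scope ereal_scope.

Import HBNNSimple.

(** [nu] is the image under [g] of the measure with density [rho] with respect to
  [lam]; the formula passes from indicators to simple functions and then to
  their monotone limits. *)
Lemma integral_density (phi : T -> \bar R) :
  measurable_fun setT phi -> (forall t, 0 <= phi t) ->
  \int[nu]_t phi t = \int[lam]_s (phi (g s) * (rho s)%:E).
Proof.
move=> mphi phi0.
pose f_ := nnsfun_approx measurableT mphi.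
have cf t : (f_ n t)%:E @[n --> \oo] --> phi t by apply: cvg_nnsfun_approx.
have ndf t : {homo (fun n => (f_ n t)%:E) : m n / (m <= n)%N >-> m <= n}.
  by move=> m n mn; rewrite lee_fin; exact/lefP/nd_nnsfun_approx.
have mgB (B : set T) : measurable B -> measurable (g @^-1` B).
  by move=> mB; rewrite -[X in measurable X]setTI; exact: mg.
have indicE' (B : set T) : measurable B ->
    \int[nu]_t (\1_B t)%:E = \int[lam]_s ((\1_B (g s) * rho s)%R)%:E.
  move=> mB; rewrite integral_indic// setIT nuE// integral_mkcond.
  apply: eq_integral => s _; rewrite patchE indicE/=.
  rewrite (_ : (s \in g @^-1` B) = (g s \in B)); last by apply/idP/idP; rewrite !inE.
  by case: ifPn => _; rewrite ?mul1r ?mul0r.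
have nn (f : {nnsfun T >-> R}) :
    \int[nu]_t (f t)%:E = \int[lam]_s ((f (g s) * rho s)%R)%:E.
  transitivity (\sum_(k \in range f)
      \int[lam]_s ((k * \1_(f @^-1` [set k]) (g s) * rho s)%R)%:E).
    under eq_integral do rewrite fimfunE -fsumEFin//.
    rewrite ge0_integral_fsum//; last 2 first.
    - by move=> k; exact/measurable_EFinP/measurable_funM.
    - by move=> k t _; rewrite nnfun_muleindic_ge0.
    apply: eq_fsbigr => k _; have [k0|k0] := leP 0%R k; last first.
      rewrite preimage_nnfun0//; rewrite [LHS]integral0_eq; last first.
        by move=> t _; rewrite indic0 mulr0.
      by rewrite [RHS]integral0_eq// => s _; rewrite indic0 mulr0 mul0r.
    under eq_integral do rewrite EFinM.
    rewrite ge0_integralZl_EFin//; last exact/measurable_EFinP.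
    rewrite indicE'// -ge0_integralZl_EFin//.
    - by apply: eq_integral => s _; rewrite -EFinM mulrA.
    - by move=> s _; rewrite lee_fin mulr_ge0// rho0.
    - apply/measurable_EFinP; apply: measurable_funM => //.
      exact: (measurableT_comp (measurable_indic _)).
  rewrite -ge0_integral_fsum//.
  - apply: eq_integral => s _; rewrite fsumEFin// [in RHS]fimfunE.
    by rewrite mulr_fsuml.
  - move=> k; apply/measurable_EFinP; apply: measurable_funM => //.
    apply: measurable_funM => //.
    exact: (measurableT_comp (measurable_indic _)).
  - move=> k s _; rewrite EFinM mule_ge0// ?lee_fin ?rho0//.
    by have := nnfun_muleindic_ge0 f k (g s); rewrite lee_fin.
have mf n : measurable_fun setT (fun t => (f_ n t)%:E) by exact/measurable_EFinP.
have f0 n t : [set: T] t -> 0 <= (f_ n t)%:E by rewrite lee_fin.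
have mfg n : measurable_fun setT (fun s => ((f_ n (g s) * rho s)%R)%:E).
  apply/measurable_EFinP; apply: measurable_funM => //.
  exact: (measurableT_comp _ mg).
have fg0 n s : [set: S] s -> 0 <= ((f_ n (g s) * rho s)%R)%:E.
  by move=> _; rewrite lee_fin mulr_ge0 ?rho0.
have ndfg s : [set: S] s -> {homo (fun n => ((f_ n (g s) * rho s)%R)%:E) :
    m n / (m <= n)%N >-> m <= n}.
  move=> _ m n mn; rewrite lee_fin ler_wpM2r ?rho0//.
  by rewrite -lee_fin; exact: ndf.
have e1 := monotone_convergence nu measurableT mf f0 (fun t _ => ndf t).
have e2 := monotone_convergence lam measurableT mfg fg0 ndfg.
transitivity (limn (fun n => \int[nu]_t (f_ n t)%:E)).
  rewrite -e1; apply: eq_integral => t _; apply/esym/cvg_lim => //; exact: cf.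
rewrite (_ : (fun n => _) = (fun n => \int[lam]_s ((f_ n (g s) * rho s)%R)%:E)).
  rewrite -e2; apply: eq_integral => s _; apply/cvg_lim => //.
  under eq_fun do rewrite EFinM.
  by apply: cvgeZr => //; exact: cf.
by apply/funext => n; exact: nn.
Qed.

End density.

(** * The mean squared distance from a point to a projected Gaussian *)

Section reflection.
Variable R : realType.
Local Notation R3 := (R * (R * R))%type.
Implicit Types (p q n u v : R3) (a : R).

Definition dotp p q : R := p.1 * q.1 + p.2.1 * q.2.1 + p.2.2 * q.2.2.

Definition scalep a p : R3 := (a * p.1, (a * p.2.1, a * p.2.2)).

(** The reflection in the plane orthogonal to [n], and the identity for
  [n = 0]. *)
Definition reflp n p : R3 := p - scalep (2 * dotp n p / dotp n n) n.

Lemma dotpp_ge0 p : 0 <= dotp p p.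
Proof. by rewrite /dotp -!expr2 !addr_ge0 ?sqr_ge0. Qed.

Lemma dotpp_eq0 p : dotp p p = 0 -> p = 0.
Proof.
case: p => a [b c] /eqP; rewrite /dotp /= -!expr2.
rewrite paddr_eq0 ?addr_ge0 ?sqr_ge0// paddr_eq0 ?sqr_ge0// !sqrf_eq0.
by move=> /andP[/andP[/eqP -> /eqP ->] /eqP ->].
Qed.

Lemma dotpC p q : dotp p q = dotp q p.
Proof. by rewrite /dotp; ring. Qed.

Lemma dotpBl p q u : dotp (p - q) u = dotp p u - dotp q u.
Proof. by rewrite /dotp /=; ring. Qed.

Lemma dotpZl a p q : dotp (scalep a p) q = a * dotp p q.
Proof. by rewrite /dotp /=; ring. Qed.

Lemma dotpDr p q u : dotp u (p + q) = dotp u p + dotp u q.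
Proof. by rewrite /dotp /=; ring. Qed.

Lemma dotpBr p q u : dotp u (p - q) = dotp u p - dotp u q.
Proof. by rewrite /dotp /=; ring. Qed.

Lemma dotpZr a p q : dotp q (scalep a p) = a * dotp q p.
Proof. by rewrite /dotp /=; ring. Qed.

Lemma scalepDl a b p : scalep (a + b) p = scalep a p + scalep b p.
Proof. by congr (_, (_, _)) => /=; ring. Qed.

Lemma reflp0 p : reflp 0 p = p.
Proof.
by case: p => a [b c]; rewrite /reflp; congr (_, (_, _)) => /=; rewrite mulr0 subr0.
Qed.

Lemma dotp_reflp n p q : dotp (reflp n p) (reflp n q) = dotp p q.
Proof.
have [n0|n0] := eqVneq (dotp n n) 0; first by rewrite (dotpp_eq0 n0) !reflp0.
rewrite /reflp !(dotpBl, dotpBr, dotpZl, dotpZr) (dotpC p n).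
by field.
Qed.

Lemma reflpD n : {morph reflp n : p q / p + q}.
Proof.
move=> p q; rewrite /reflp dotpDr mulrDr mulrDl scalepDl opprD.
by rewrite addrACA.
Qed.

Lemma reflpK n : involutive (reflp n).
Proof.
move=> p; have [n0|n0] := eqVneq (dotp n n) 0; first by rewrite (dotpp_eq0 n0) !reflp0.
rewrite {1}/reflp {2}/reflp dotpBr dotpZr.
case: p => a [b c]; case: n n0 => x [y z] n0.
by rewrite /reflp /scalep; congr (_, (_, _)) => /=; field.
Qed.

Lemma reflpZ n a p : reflp n (scalep a p) = scalep a (reflp n p).
Proof. by rewrite /reflp dotpZr; congr (_, (_, _)) => /=; ring. Qed.

(** [u] and [v] have the same norm, so the plane bisecting them passes through
  the origin. *)
Lemma reflp_swap u v : dotp u u = dotp v v -> reflp (u - v) u = v.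
Proof.
move=> uv; have [n0|n0] := eqVneq (dotp (u - v) (u - v)) 0.
  have e := dotpp_eq0 n0; rewrite e reflp0.
  by apply/eqP; rewrite -subr_eq0 e.
rewrite /reflp.
have -> : 2 * dotp (u - v) u = dotp (u - v) (u - v).
  by rewrite !(dotpBl, dotpBr) (dotpC v u) -uv; ring.
rewrite divff//; case: u v {uv n0} => a [b c] [x [y z]].
by congr (_, (_, _)) => /=; ring.
Qed.

Lemma measurable_dotp d (T : measurableType d) (f g : T -> R3) :
  measurable_fun setT f -> measurable_fun setT g ->
  measurable_fun setT (fun t => dotp (f t) (g t)).
Proof.
move=> /measurable_fun_pairP[f1 /measurable_fun_pairP[f2 f3]].
move=> /measurable_fun_pairP[g1 /measurable_fun_pairP[g2 g3]].
apply: measurable_funD; last exact: measurable_funM f3 g3.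
by apply: measurable_funD; [exact: measurable_funM f1 g1|exact: measurable_funM f2 g2].
Qed.

Lemma measurable_reflp n : measurable_fun setT (reflp n).
Proof.
have mc : measurable_fun setT (fun p => 2 * dotp n p / dotp n n).
  apply: measurable_funM => //; apply: measurable_funM => //.
  by apply: measurable_dotp => //; exact: measurable_cst.
apply: measurable_addp; first exact: measurable_id.
apply: measurable_oppp; apply/measurable_fun_pairP; split.
  by apply: measurable_funM.
by apply/measurable_fun_pairP; split; apply: measurable_funM.
Qed.

End reflection.

Section gaussian_mean.
Variables (R : realType) (s : R).
Local Notation R3 := (R * (R * R))%type.
Implicit Types (p q n u v M : R3) (a : R).

Definition dens M p : R :=
  gauss3_cst s * expR (- dotp (p - M) (p - M) / (2 * s ^+ 2)).

Lemma dens_ge0 M p : 0 <= dens M p.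
Proof. by rewrite mulr_ge0 ?expR_ge0// invr_ge0 powR_ge0. Qed.

Lemma dens_le_dist p M N :
  dotp (p - N) (p - N) <= dotp (p - M) (p - M) -> dens M p <= dens N p.
Proof.
move=> h; apply: ler_wpM2l; first by rewrite invr_ge0 powR_ge0.
rewrite ler_expR; apply: ler_wpM2r; last by rewrite lerN2.
by rewrite invr_ge0 mulr_ge0// sqr_ge0.
Qed.

Lemma measurable_dens M : measurable_fun setT (dens M).
Proof.
apply: measurable_funM => //; apply: (measurableT_comp (@measurable_expR R)).
apply: measurable_funM => //; apply: measurable_funN.
by apply: measurable_dotp; apply: measurable_addp => //; exact: measurable_cst.
Qed.

Lemma dens_reflp n M p : dens M (reflp n p) = dens (reflp n M) p.
Proof.
have e : reflp n (reflp n p - M) = p - reflp n M.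
  have -> : reflp n p - M = reflp n p + scalep (-1) M.
    by case: M => a [b c]; congr (_, (_, _)) => /=; ring.
  rewrite reflpD reflpK reflpZ.
  by case: (reflp n M) => a [b c]; congr (_, (_, _)) => /=; ring.
by rewrite /dens -(dotp_reflp n (reflp n p - M)) e.
Qed.

(** For [q] on the unit sphere, the squared geodesic distance from [q] to the
  radial projection of [p]. *)
Definition sqcolat q p : R := acos (dotp p q / Num.sqrt (dotp p p)) ^+ 2.

Lemma sqcolat_ge0 q p : 0 <= sqcolat q p. Proof. exact: sqr_ge0. Qed.

Lemma measurable_sqcolat q : measurable_fun setT (sqcolat q).
Proof.
apply: measurable_funX; apply: (measurableT_comp (@measurable_acos R)).
apply: measurable_funM.
  by apply: measurable_dotp => //; exact: measurable_cst.
apply: (measurableT_comp (@measurable_invr R)).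
by apply: (measurableT_comp (@measurable_sqrtr R)); exact: measurable_dotp.
Qed.

Lemma sqcolat_reflp n q p : sqcolat q (reflp n p) = sqcolat (reflp n q) p.
Proof. by rewrite /sqcolat dotp_reflp -{1}(reflpK n q) dotp_reflp. Qed.

(* the normalization of the density is read off a Gaussian law, see
   [normal_dens_mass] *)
Hypothesis dens_mass : forall M, (\int[leb3 R]_p (dens M p)%:E = 1)%E.
Local Open Scope ereal_scope.

Lemma integral_reflp n (f : R3 -> \bar R) :
  measurable_fun setT f -> (forall p, 0 <= f p) ->
  \int[leb3 R]_p f (reflp n p) = \int[leb3 R]_p f p.
Proof.
move=> mf f0.
apply: (@integral_leb3_isometry R (reflp n) (fun p => (dens 0%R p)%:E)) => //.
- exact: measurable_reflp.
- exact: reflpK.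
- exact: reflpD.
- by apply/measurable_EFinP; exact: measurable_dens.
- by move=> p; rewrite lee_fin dens_ge0.
- move=> p; rewrite dens_reflp.
  suff -> : reflp n 0%R = 0%R by [].
  by apply: (addrI (reflp n 0%R)); rewrite -reflpD !addr0.
- move=> p; rewrite /dens !subr0.
  suff -> : dotp (- p)%R (- p)%R = dotp p p by [].
  by rewrite /dotp /=; ring.
Qed.

Definition mean_sqdist M q := \int[leb3 R]_p (sqcolat q p * dens M p)%:E.

Lemma measurable_sqcolat_dens M q : measurable_fun setT (fun p => (sqcolat q p * dens M p)%:E).
Proof.
apply/measurable_EFinP; apply: measurable_funM.
  exact: measurable_sqcolat.
exact: measurable_dens.
Qed.

Lemma sqcolat_dens_ge0 M q p : 0 <= (sqcolat q p * dens M p)%:E.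
Proof. by rewrite lee_fin mulr_ge0 ?sqcolat_ge0 ?dens_ge0. Qed.

Lemma mean_sqdist_reflp n M q : mean_sqdist (reflp n M) (reflp n q) = mean_sqdist M q.
Proof.
rewrite /mean_sqdist -[RHS](integral_reflp n (measurable_sqcolat_dens M q) (sqcolat_dens_ge0 M q)).
by apply: eq_integral => p _; rewrite sqcolat_reflp dens_reflp.
Qed.

Lemma acos_itv_bound p q : dotp q q = 1%R ->
  (-1 <= dotp p q / Num.sqrt (dotp p p) <= 1)%R.
Proof.
move=> q1; have [p0|p0] := eqVneq (dotp p p) 0%R.
  by rewrite p0 sqrtr0 invr0 mulr0 oppr_le0 ler01.
have pp : (0 < dotp p p)%R by rewrite lt_neqAle eq_sym p0 dotpp_ge0.
have sp : (0 < Num.sqrt (dotp p p))%R by rewrite sqrtr_gt0.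
rewrite -ler_norml normrM normfV (gtr0_norm sp) ler_pdivrMr// mul1r.
rewrite -sqrtr_sqr ler_sqrt ?dotpp_ge0//.
have := dotpp_ge0 (p - scalep (dotp p q) q)%R.
rewrite !(dotpBl, dotpBr, dotpZl, dotpZr) q1 (dotpC q p) => h.
by rewrite -subr_ge0; apply: (le_trans h); rewrite le_eqVlt; apply/orP; left;
  apply/eqP; ring.
Qed.

Lemma sqcolat_le_pi p q : dotp q q = 1%R -> (sqcolat q p <= pi ^+ 2)%R.
Proof.
move=> q1; have I := acos_itv_bound p q1.
by rewrite ler_sqr ?nnegrE ?acos_ge0 ?acos_lepi ?pi_ge0.
Qed.

Lemma mean_sqdist_fin M q : dotp q q = 1%R -> mean_sqdist M q <= (pi ^+ 2)%:E.
Proof.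
move=> q1.
rewrite -[leRHS]mule1 -(dens_mass M) -ge0_integralZl_EFin; last 4 first.
- exact: measurableT.
- by move=> p _; rewrite lee_fin dens_ge0.
- by apply/measurable_EFinP; exact: measurable_dens.
- exact: sqr_ge0.
apply: ge0_le_integral; first exact: measurableT.
- by move=> p _; exact: sqcolat_dens_ge0.
- exact: measurable_sqcolat_dens.
- by apply/measurable_EFinP; apply: measurable_funM => //; exact: measurable_dens.
- by move=> p _; rewrite -EFinM lee_fin ler_wpM2r ?dens_ge0 ?sqcolat_le_pi.
Qed.

(** Let [n = u - q], so that the reflection [reflp n] exchanges [u] and [q].
  Adding to each side its image under the reflection shows that twice the
  difference of the two sides is the integral of
  [(sqcolat q p - sqcolat u p) * (dens M p - dens (reflp n M) p)].  Both factors
  are nonnegative when [p] is closer to [u] than to [q], and nonpositive in the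
  opposite case. *)
Lemma mean_sqdist_min u q a : (0 <= a)%R -> dotp u u = 1%R -> dotp q q = 1%R ->
  mean_sqdist (scalep a u) u <= mean_sqdist (scalep a u) q.
Proof.
move=> a0 u1 q1; set M := scalep a u; pose n := (u - q)%R.
have nu : reflp n u = q by apply: reflp_swap; rewrite u1 q1.
have nq : reflp n q = u by rewrite -nu reflpK.
have e1 : mean_sqdist (reflp n M) u = mean_sqdist M q.
  by rewrite -nq mean_sqdist_reflp.
have e2 : mean_sqdist (reflp n M) q = mean_sqdist M u.
  by rewrite -[in LHS]nu mean_sqdist_reflp.
have fin N v : dotp v v = 1%R -> mean_sqdist N v \is a fin_num.
  move=> v1; rewrite ge0_fin_numE; last by apply: integral_ge0 => p _; exact: sqcolat_dens_ge0.
  by rewrite (le_lt_trans (mean_sqdist_fin N v1)) ?ltry.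
suff : mean_sqdist M u + mean_sqdist (reflp n M) q <=
       mean_sqdist M q + mean_sqdist (reflp n M) u.
  rewrite e1 e2 -(fineK (fin M u u1)) -(fineK (fin M q q1)) -!EFinD !lee_fin.
  lra.
rewrite -!ge0_integralD; try exact: measurableT; try exact: measurable_sqcolat_dens;
  try by move=> p _; exact: sqcolat_dens_ge0.
apply: ge0_le_integral; first exact: measurableT.
- by move=> p _; rewrite adde_ge0// sqcolat_dens_ge0.
- by apply: emeasurable_funD; exact: measurable_sqcolat_dens.
- by apply: emeasurable_funD; exact: measurable_sqcolat_dens.
move=> p _; rewrite -!EFinD lee_fin -subr_ge0.
rewrite (_ : _ - _ = (sqcolat q p - sqcolat u p) * (dens M p - dens (reflp n M) p))%R; last by ring.
have s0 : (0 <= Num.sqrt (dotp p p))%R by exact: sqrtr_ge0.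
have dens_le N N' : dotp N N = dotp N' N' -> (dotp p N <= dotp p N')%R ->
    (dens N p <= dens N' p)%R.
  move=> NN NN'; apply: dens_le_dist.
  by rewrite !(dotpBl, dotpBr) (dotpC N p) (dotpC N' p) NN; lra.
have colat_le v v' : dotp v v = 1%R -> dotp v' v' = 1%R -> (dotp p v <= dotp p v')%R ->
    (sqcolat v' p <= sqcolat v p)%R.
  move=> v1 v1' vv; have /andP[i1 i2] := acos_itv_bound p v1.
  have /andP[i3 i4] := acos_itv_bound p v1'.
  rewrite ler_sqr ?nnegrE ?acos_ge0 ?i1 ?i3//.
  by apply: ler_acos => //; rewrite ler_wpM2r ?invr_ge0.
have dM : dotp M M = dotp (reflp n M) (reflp n M) by rewrite dotp_reflp.
have pM : dotp p M = (a * dotp p u)%R by rewrite dotpZr.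
have prM : dotp p (reflp n M) = (a * dotp p q)%R by rewrite reflpZ nu dotpZr.
have [le_uq|/ltW le_qu] := leP (dotp p u) (dotp p q).
  rewrite mulr_le0// subr_le0; first exact: colat_le.
  by apply: dens_le => //; rewrite pM prM ler_wpM2l.
rewrite mulr_ge0// subr_ge0; first exact: colat_le.
by apply: dens_le => //; rewrite pM prM ler_wpM2l.
Qed.

Lemma mean_sqdist_axis u v a : dotp u u = dotp v v ->
  mean_sqdist (scalep a u) u = mean_sqdist (scalep a v) v.
Proof.
move=> uv; rewrite -(mean_sqdist_reflp (u - v)%R) reflpZ.
by rewrite reflp_swap.
Qed.

Lemma mean_sqdistE u a : (0 < s)%R -> (0 < a)%R -> dotp u u = 1%R ->
  mean_sqdist (scalep a u) u = (2 * f_cov (s ^+ 2 / a ^+ 2))%:E.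
Proof.
move=> s0 a0 u1; pose e : R3 := (1%R, (0%R, 0%R)).
rewrite (@mean_sqdist_axis u e); last by rewrite u1 /dotp /=; ring.
rewrite -integral_sqr_colatitude//; apply: eq_integral => p _.
rewrite /sqcolat /dens sqr_sqrtr; last by rewrite addr_ge0 ?sqr_ge0.
have -> : dotp p e = p.1 by rewrite /dotp /=; ring.
have -> : dotp p p = (p.1 ^+ 2 + (p.2.1 ^+ 2 + p.2.2 ^+ 2))%R by rewrite /dotp; ring.
suff -> : dotp (p - scalep a e)%R (p - scalep a e)%R =
    ((p.1 - a) ^+ 2 + (p.2.1 ^+ 2 + p.2.2 ^+ 2))%R by [].
by rewrite /dotp /=; ring.
Qed.

End gaussian_mean.

(** * Monotonicity of f and stability of its inverse *)

Lemma le_atanB (R : realType) (C u v : R) : 0 <= u -> u <= v -> v <= C ->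
  (v - u) / (1 + C ^+ 2) <= atan v - atan u.
Proof.
move=> u0; rewrite le_eqVlt => /predU1P[->|uv] vC; first by rewrite !subrr mul0r.
have datan z : z \in `]u, v[ -> is_derive z 1 atan (1 + z ^+ 2)^-1.
  by move=> _; exact: is_derive1_atan.
have catan : {within `[u, v], continuous atan}.
  by apply: derivable_within_continuous => z _; exact: ex_derive.
have [c + ->] := MVT uv datan catan; rewrite in_itv/= => /andP[uc cv].
have vu : 0 <= v - u by rewrite subr_ge0 ltW.
have c0 : 0 <= c by rewrite (le_trans u0)// ltW.
have cC : c <= C by rewrite (le_trans (ltW cv)).
rewrite mulrC ler_wpM2r// lef_pV2 ?posrE ?ltr_pwDl ?sqr_ge0//.
by rewrite lerD2l ler_sqr ?nnegrE// (le_trans c0).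
Qed.

Section profile.
Variables (R : realType) (s : R).
Hypothesis s_gt0 : 0 < s.
Local Notation R2 := (R * R)%type.
Local Notation R3 := (R * (R * R))%type.
Implicit Types (z : R2) (a : R).
Hypothesis dens_mass : forall M : R3, (\int[leb3 R]_p (dens s M p)%:E = 1)%E.

(** The Gaussian in cylindrical coordinates about the axis of its mean: [z.1] is
  the axial coordinate relative to the mean and [z.2] the distance to the axis,
  with a sign that is immaterial by symmetry. *)
Definition weight z : R :=
  `|z.2| * (gauss3_cst s * expR (- (z.1 ^+ 2 + z.2 ^+ 2) / (2 * s ^+ 2))).

(** The colatitude of the point with axial coordinate [z.1 + a] at distance
  [|z.2|] from the axis. *)
Definition angle a z : R := pi / 2 - atan ((z.1 + a) / `|z.2|).

Definition profile a : R := \int[leb2 R]_z (weight z * angle a z ^+ 2).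

Lemma weight_ge0 z : 0 <= weight z.
Proof. by rewrite mulr_ge0// mulr_ge0 ?expR_ge0// invr_ge0 powR_ge0. Qed.

Lemma measurable_weight : measurable_fun setT weight.
Proof.
apply: measurable_funM; first exact: (measurableT_comp (@normr_measurable R setT) measurable_snd).
apply: measurable_funM => //; apply: (measurableT_comp (@measurable_expR R)).
apply: measurable_funM => //; apply: measurable_funN.
by apply: measurable_funD; apply: measurable_funX.
Qed.

Lemma measurable_angle a : measurable_fun setT (angle a).
Proof.
apply: measurable_funB => //.
have mat : measurable_fun setT (@atan R).
  by apply: continuous_measurable_fun => t; exact: continuous_atan.
apply: (measurableT_comp mat); apply: measurable_funM.
  by apply: measurable_funD => //; exact: measurable_fst.
apply: (measurableT_comp (@measurable_invr R)).
exact: (measurableT_comp (@normr_measurable R setT) measurable_snd).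
Qed.

Lemma angle_gt0 a z : 0 < angle a z.
Proof. by rewrite subr_gt0 atan_ltpi2. Qed.

Lemma angle_le_pi a z : angle a z <= pi.
Proof.
have := atan_gtNpi2 ((z.1 + a) / `|z.2|); rewrite /angle.
by move: (atan _) => b hb; lra.
Qed.

Lemma le_angle a b z : a <= b -> angle b z <= angle a z.
Proof.
by move=> ab; rewrite lerB// le_atan// ler_wpM2r ?invr_ge0// lerD2l.
Qed.

(** Integrating out the azimuth. *)
Lemma integral_dens0 (k : R2 -> R) :
  measurable_fun setT k -> (forall z, 0 <= k z) ->
  (\int[leb3 R]_p (k (p.1, Num.sqrt (p.2.1 ^+ 2 + p.2.2 ^+ 2)) * dens s 0 p)%:E =
   pi%:E * \int[leb2 R]_z (weight z * k (z.1, `|z.2|))%:E)%E.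
Proof.
move=> mk k0.
pose f (z : R2) := k z *
  (gauss3_cst s * expR (- (z.1 ^+ 2 + z.2 ^+ 2) / (2 * s ^+ 2))).
have f0 z : 0 <= f z.
  by rewrite mulr_ge0// mulr_ge0 ?expR_ge0// invr_ge0 powR_ge0.
have mf : measurable_fun setT f.
  apply: measurable_funM => //; apply: measurable_funM => //.
  apply: (measurableT_comp (@measurable_expR R)).
  apply: measurable_funM => //; apply: measurable_funN.
  by apply: measurable_funD; apply: measurable_funX.
have mEf : measurable_fun setT (EFin \o f) by exact/measurable_EFinP.
pose h (p : R3) : \bar R := (f (p.1, Num.sqrt (p.2.1 ^+ 2 + p.2.2 ^+ 2)))%:E.
have mh : measurable_fun setT h.
  apply: (measurableT_comp mEf); apply/measurable_fun_pairP; split.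
    exact: measurable_fst.
  apply: (measurableT_comp (@measurable_sqrtr R)).
  by apply: measurable_funD; apply: measurable_funX; exact: measurableT_comp.
have h0 p : (0 <= h p)%E by rewrite lee_fin.
transitivity (\int[leb3 R]_p h p)%E.
  apply: eq_integral => p _; rewrite /h /f /dens !subr0 /dotp.
  by rewrite sqr_sqrtr ?addr_ge0 ?sqr_ge0// -!expr2 addrA.
rewrite (integral_leb3 mh h0).
have mw : measurable_fun setT (fun z : R2 => (weight z * k (z.1, `|z.2|))%:E).
  apply/measurable_EFinP; apply: measurable_funM; first exact: measurable_weight.
  apply: (measurableT_comp mk); apply/measurable_fun_pairP; split.
    exact: measurable_fst.
  exact: (measurableT_comp (@normr_measurable R setT) measurable_snd).
have w0 z : (0 <= (weight z * k (z.1, `|z.2|))%:E)%E.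
  by rewrite lee_fin mulr_ge0 ?weight_ge0.
rewrite integral_leb2; [|exact: mw|exact: w0].
rewrite -ge0_integralZl; [|exact: measurableT
  |exact: (@measurable_fun_fubini_tonelli_F _ _ _ _ R (leb1 R) _ mw w0)
  |by move=> x _; apply: integral_ge0 => v _; exact: (w0 (x, v))
  |by rewrite lee_fin pi_ge0].
apply: eq_integral => x _.
rewrite (@integral_polar2 R (fun v => (f (x, v))%:E)); last 2 first.
- exact: (measurableT_comp mEf (pair1_measurable x)).
- by move=> v; rewrite lee_fin.
apply: (congr1 (fun u => pi%:E * u)%E); apply: eq_integral => v _.
rewrite -EFinM /f /weight /= real_normK ?num_real//.
by congr EFin; ring.
Qed.

Lemma integrable_weight : (leb2 R).-integrable setT (EFin \o weight).
Proof.
apply/integrableP; split; first by apply/measurable_EFinP; exact: measurable_weight.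
have m1 : measurable_fun setT (fun _ : R2 => 1 : R) by exact: measurable_cst.
have := integral_dens0 m1 (fun=> ler01).
under eq_integral do rewrite mul1r.
rewrite dens_mass; under eq_integral do rewrite mulr1.
move=> e.
have -> : (\int[leb2 R]_z `|(EFin \o weight) z| = \int[leb2 R]_z (weight z)%:E)%E.
  by apply: eq_integral => z _; rewrite /= ger0_norm ?weight_ge0.
rewrite ltey; apply/eqP => ey; move: e; rewrite ey gt0_muley ?lte_fin ?pi_gt0//.
Qed.

Lemma integrable_profile a :
  (leb2 R).-integrable setT (EFin \o (fun z => weight z * angle a z ^+ 2)).
Proof.
apply: (le_integrable measurableT _ _ (integrableZl measurableT (pi ^+ 2) integrable_weight)).
- apply/measurable_EFinP; apply: measurable_funM; first exact: measurable_weight.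
  by apply: measurable_funX; exact: measurable_angle.
- move=> z _; rewrite -EFinM /= lee_fin !ger0_norm.
  + rewrite mulrC ler_wpM2r ?weight_ge0// ler_sqr ?nnegrE ?pi_ge0 ?angle_le_pi//.
    exact/ltW/angle_gt0.
  + by rewrite mulr_ge0 ?sqr_ge0 ?weight_ge0.
  + by rewrite mulr_ge0 ?sqr_ge0 ?weight_ge0.
Qed.

Lemma profile_ge0 a : 0 <= profile a.
Proof. by apply: Rintegral_ge0 => z _; rewrite mulr_ge0 ?sqr_ge0 ?weight_ge0. Qed.

Lemma profile_nonincreasing a b : a <= b -> profile b <= profile a.
Proof.
move=> ab; apply: le_Rintegral; [exact: measurableT|exact: integrable_profile
  |exact: integrable_profile|move=> z _].
rewrite ler_wpM2l ?weight_ge0// ler_sqr ?nnegrE ?le_angle//; exact/ltW/angle_gt0.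
Qed.

(** Translating the Gaussian to the origin moves its mean [a] from the density to
  the colatitude; the dependence on [a] becomes pointwise monotone. *)
Lemma f_cov_profile a : 0 < a -> f_cov (s ^+ 2 / a ^+ 2) = pi / 2 * profile a.
Proof.
move=> a0; pose e : R3 := (1, (0, 0)).
have e1 : dotp e e = 1 by rewrite /dotp /=; ring.
pose k (z : R2) := acos ((z.1 + a) / Num.sqrt ((z.1 + a) ^+ 2 + z.2 ^+ 2)) ^+ 2.
have mk : measurable_fun setT k.
  have m1 : measurable_fun setT (fun z : R2 => z.1 + a) by exact: measurable_funD.
  apply: measurable_funX; apply: (measurableT_comp (@measurable_acos R)).
  apply: measurable_funM => //; apply: (measurableT_comp (@measurable_invr R)).
  apply: (measurableT_comp (@measurable_sqrtr R)).
  by apply: measurable_funD; apply: measurable_funX.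
have := mean_sqdistE dens_mass s_gt0 a0 e1.
rewrite /mean_sqdist.
rewrite -(@integral_leb3_shift _ (scalep a e)); [|exact: measurable_sqcolat_dens|exact: sqcolat_dens_ge0].
have -> : (\int[leb3 R]_p (sqcolat e (p + scalep a e) * dens s (scalep a e) (p + scalep a e))%:E =
  \int[leb3 R]_p (k (p.1, Num.sqrt (p.2.1 ^+ 2 + p.2.2 ^+ 2)) * dens s 0 p)%:E)%E.
  apply: eq_integral => p _; rewrite /dens addrK subr0 /sqcolat /k /=.
  rewrite sqr_sqrtr ?addr_ge0 ?sqr_ge0//.
  have -> : dotp (p + scalep a e) e = p.1 + a by rewrite /dotp /=; ring.
  suff -> : dotp (p + scalep a e) (p + scalep a e) =
    (p.1 + a) ^+ 2 + (p.2.1 ^+ 2 + p.2.2 ^+ 2) by [].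
  by rewrite /dotp /=; ring.
rewrite integral_dens0; [|exact: mk|by move=> z; exact: sqr_ge0].
have -> : (\int[leb2 R]_z (weight z * k (z.1, `|z.2|))%:E =
    \int[leb2 R]_z (weight z * angle a z ^+ 2)%:E)%E.
  apply: eq_integral => z _; congr EFin.
  have [z0|z0] := eqVneq `|z.2| 0; first by rewrite /weight z0 !mul0r.
  have zp : 0 < `|z.2| by rewrite lt_neqAle eq_sym z0 normr_ge0.
  rewrite /k /angle -acos_colatitude /=; congr (_ * acos _ ^+ 2).
  rewrite (_ : (z.1 + a) ^+ 2 + `|z.2| ^+ 2 = `|z.2| ^+ 2 * (1 + ((z.1 + a) / `|z.2|) ^+ 2)); last by field.
  rewrite sqrtrM ?sqr_ge0// sqrtr_sqr normr_id -/(hyp _).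
  by field; rewrite z0 gt_eqF ?hyp_gt0.
have fin : (\int[leb2 R]_z (weight z * angle a z ^+ 2)%:E)%E \is a fin_num.
  by apply: integrable_fin_num => //; exact: integrable_profile.
rewrite -(fineK fin) -EFinM => -[].
rewrite -/(Rintegral _ _ _) -/(profile a) => h; lra.
Qed.

Lemma continuous_profile : continuous profile.
Proof.
move=> a.
have angle_cont z : continuous (angle ^~ z).
  move=> b; apply: cvgB; first exact: cvg_cst.
  apply: (@continuous_comp _ _ _ (fun b => (z.1 + b) / `|z.2|)); last exact: continuous_atan.
  apply: cvgM; last exact: cvg_cst.
  by apply: cvgD; [exact: cvg_cst|exact: cvg_id].
have aI : a \in `]a - 1, a + 1[%classic.
  by rewrite inE /= in_itv/=; apply/andP; split; lra.
have H1 : {ae leb2 R, forall z, [set: R2] z ->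
    {in `]a - 1, a + 1[%classic, continuous (fun b => weight z * angle b z ^+ 2)}}.
  apply: aeW => z _ b _; apply: cvgM; first exact: cvg_cst.
  apply: (@continuous_comp _ _ _ (angle ^~ z) (fun t => t ^+ 2)).
    exact: angle_cont.
  exact: exprn_continuous.
have H2 : (leb2 R).-integrable setT (EFin \o (fun z => pi ^+ 2 * weight z)).
  exact: (integrableZl measurableT (pi ^+ 2) integrable_weight).
have H3 b : `]a - 1, a + 1[%classic b ->
    {ae leb2 R, forall z, [set: R2] z -> `|weight z * angle b z ^+ 2| <= pi ^+ 2 * weight z}.
  move=> _; apply: aeW => z _.
  have h0 : 0 <= weight z * angle b z ^+ 2 by rewrite mulr_ge0 ?sqr_ge0 ?weight_ge0.
  rewrite (ger0_norm h0) mulrC; apply: ler_wpM2r; first exact: weight_ge0.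
  rewrite ler_sqr ?nnegrE ?pi_ge0 ?angle_le_pi//; exact/ltW/angle_gt0.
exact: (continuity_under_integral measurableT (fun b _ => integrable_profile b) H1 H2 H3 aI).
Qed.

(** The rate of decrease of the profile on ]0, B] contributed by the points with
  [z.1] in [0, 1] and [z.2] in [1, 2].  There [z.1 ^+ 2 + z.2 ^+ 2 <= 5] bounds
  the weight from below, [(z.1 + b) / z.2 <= 1 + B] bounds the angles from
  below by [pi / 2 - atan (1 + B)] and the derivative of [atan] by
  [1 / (1 + (1 + B) ^+ 2)], and [z.2 <= 2] gives the factor 1/2. *)
Definition profile_rate (B : R) : R :=
  gauss3_cst s * expR (- 5 / (2 * s ^+ 2)) *
  ((pi / 2 - atan (1 + B)) * (2^-1 / (1 + (1 + B) ^+ 2))).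

Lemma profile_rate_gt0 B : 0 < profile_rate B.
Proof.
apply: mulr_gt0; apply: mulr_gt0.
- by rewrite invr_gt0 powR_gt0// mulr_gt0 ?exprn_gt0// mulr_gt0 ?pi_gt0.
- exact: expR_gt0.
- by rewrite subr_gt0 atan_ltpi2.
- by rewrite divr_gt0// ltr_pwDl// sqr_ge0.
Qed.

Lemma profile_gap (B a b : R) : 0 < a -> a <= b -> b <= B ->
  profile_rate B * (b - a) <= profile a - profile b.
Proof.
move=> a0 ab bB; set kap := profile_rate B * _.
have kap0 : 0 <= kap by rewrite mulr_ge0 ?subr_ge0//; exact/ltW/profile_rate_gt0.
pose Q : set R2 := `[0, 1]%classic `*` `[1, 2]%classic.
have mQ : measurable Q by apply: measurableX; exact: measurable_itv.
have leb2Q : leb2 R Q = 1%E.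
  rewrite [LHS]product_measure1E; [|exact: measurable_itv|exact: measurable_itv].
  rewrite [X in (X * _)%E]lebesgue_measure_itv [X in (_ * X)%E]lebesgue_measure_itv.
  rewrite /= !lte_fin ltr01 (_ : 1 < 2 = true) ?ltr1n//.
  by rewrite -!EFinD -EFinM; congr EFin; ring.
have i1Q : (leb2 R).-integrable setT (EFin \o (\1_Q : R2 -> R)).
  apply/integrableP; split; first by apply/measurable_EFinP; exact: measurable_indic.
  have -> : (\int[leb2 R]_z `|(EFin \o (\1_Q : R2 -> R)) z| =
      \int[leb2 R]_z (\1_Q z)%:E)%E.
    by apply: eq_integral => z _; rewrite /= ger0_norm.
  rewrite integral_indic; [|exact: measurableT|exact: mQ].
  by rewrite setIT [X in (X < _)%E]leb2Q ltry.
have iQ : (leb2 R).-integrable setT (EFin \o (fun z => kap * \1_Q z)).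
  exact: (integrableZl measurableT kap i1Q).
have IQ : \int[leb2 R]_z (kap * \1_Q z) = kap.
  rewrite RintegralZl; [|exact: measurableT|exact: i1Q].
  rewrite /Rintegral integral_indic; [|exact: measurableT|exact: mQ].
  by rewrite setIT [X in fine X]leb2Q mulr1.
(* the box has measure one, so it suffices to compare integrands, with [kap]
   on the box *)
rewrite lerBrDr -[X in X + _]IQ -RintegralD//; last exact: integrable_profile.
apply: le_Rintegral; first exact: measurableT.
- exact: (integrableD measurableT iQ (integrable_profile b)).
- exact: integrable_profile.
move=> z _; rewrite indicE; case: (boolP (z \in Q)) => [|_]; last first.
  rewrite mulr0 add0r ler_wpM2l ?weight_ge0// ler_sqr ?nnegrE ?le_angle//;
    exact/ltW/angle_gt0.
rewrite inE => -[/=]; rewrite !in_itv/= mulr1 => /andP[z10 z11] /andP[z21 z22].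
have z2 : `|z.2| = z.2 by rewrite ger0_norm// (le_trans ler01).
have z20 : 0 < z.2 by rewrite (lt_le_trans ltr01).
have z2N : z.2 != 0 by rewrite gt_eqF.
rewrite -lerBrDr -mulrBr subr_sqr.
set w := gauss3_cst s * expR (- 5 / (2 * s ^+ 2)).
have w0 : 0 <= w by rewrite mulr_ge0 ?expR_ge0// invr_ge0 powR_ge0.
have ww : w <= weight z.
  rewrite /weight z2 -[leLHS]mul1r ler_pM// ler_wpM2l ?invr_ge0 ?powR_ge0//.
  rewrite ler_expR; apply: ler_wpM2r; first by rewrite invr_ge0 mulr_ge0// sqr_ge0.
  have : z.1 ^+ 2 <= 1 ^+ 2 by rewrite ler_sqr ?nnegrE.
  have : z.2 ^+ 2 <= 2 ^+ 2 by rewrite ler_sqr ?nnegrE// ltW.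
  lra.
have ca : (z.1 + a) / z.2 <= (z.1 + b) / z.2 by apply: ler_wpM2r; [rewrite invr_ge0 ltW|rewrite lerD2l].
have ca0 : 0 <= (z.1 + a) / z.2.
  by apply: divr_ge0; [apply: addr_ge0 => //; exact: ltW|exact: ltW].
have B0 : 0 <= B by rewrite (le_trans (ltW a0))// (le_trans ab).
have cb : (z.1 + b) / z.2 <= 1 + B.
  rewrite ler_pdivrMr//; apply: (@le_trans _ _ (1 + B)); first exact: lerD.
  by apply: ler_peMr => //; exact: addr_ge0.
have gap := le_atanB ca0 ca cb.
have bet : pi / 2 - atan (1 + B) <= angle b z.
  by rewrite /angle z2 lerB// le_atan.
have bet0 : 0 <= pi / 2 - atan (1 + B) by rewrite subr_ge0 ltW// atan_ltpi2.
have ang0 := ltW (angle_gt0 a z).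
pose d := 2^-1 / (1 + (1 + B) ^+ 2) * (b - a).
have den0 : 0 <= (1 + (1 + B) ^+ 2)^-1 by rewrite invr_ge0 addr_ge0 ?sqr_ge0.
have ba0 : 0 <= b - a by rewrite subr_ge0.
have d0 : 0 <= d by rewrite mulr_ge0// mulr_ge0.
have dD : d <= angle a z - angle b z.
  rewrite (_ : _ - _ = atan ((z.1 + b) / z.2) - atan ((z.1 + a) / z.2)); last first.
    by rewrite /angle z2; ring.
  apply: le_trans gap; rewrite /d mulrAC ler_wpM2r//.
  rewrite -mulrBl opprD addrACA subrr add0r mulrC ler_wpM2l//.
  by rewrite lef_pV2 ?posrE.
have kE : kap = w * (d * (pi / 2 - atan (1 + B))).
  by rewrite /kap /profile_rate -/w /d; ring.
rewrite kE; apply: ler_pM => //; first by rewrite mulr_ge0.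
apply: ler_pM => //.
by rewrite (le_trans bet)// lerDr.
Qed.

End profile.

Section inverse_profile.
Variables (R : realType) (s : R).
Hypothesis s_gt0 : 0 < s.
Hypothesis dens_mass : forall M : R * (R * R),
  (\int[leb3 R]_p (dens s M p)%:E = 1)%E.

(** By the intermediate value theorem a value [v] near [f_cov lam] is attained,
  so that [f_cov_inv dflt v] is a true preimage.  Every preimage is positive,
  as [f_cov 0 = 0] while [v] exceeds the value at [a = 2 * a0], hence it is
  [s ^+ 2 / b ^+ 2] for some [b]; monotonicity confines [b] to [a0 / 2, 2 * a0], where the
  profile decreases at a definite rate.  The constants are uniform in
  [dflt]. *)
Lemma f_cov_inv_stable (a0 : R) : 0 < a0 ->
  let lam := s ^+ 2 / a0 ^+ 2 in
  exists C : R, 0 < C /\ exists eta : R, 0 < eta /\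
  forall (dflt : R -> R) (v : R), `|v - f_cov lam| < eta ->
    `|f_cov_inv dflt v - lam| <= C * `|v - f_cov lam|.
Proof.
move=> a00 lam.
pose A := a0 / 2; pose B := 2 * a0.
have A0 : 0 < A by rewrite divr_gt0.
have Aa : A <= a0 by rewrite /A; lra.
have aB : a0 <= B by rewrite /B; lra.
pose phi (a : R) := pi / 2 * profile s a.
have phiE a : 0 < a -> f_cov (s ^+ 2 / a ^+ 2) = phi a.
  exact: f_cov_profile.
pose kap := pi / 2 * profile_rate s B.
have kap0 : 0 < kap by rewrite mulr_gt0 ?profile_rate_gt0// divr_gt0// pi_gt0.
have gap a b : 0 < a -> a <= b -> b <= B -> kap * (b - a) <= phi a - phi b.
  move=> ha ab bB; rewrite /phi -mulrBr -mulrA ler_wpM2l ?divr_ge0 ?pi_ge0//.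
  exact: profile_gap.
have mono a b : a <= b -> phi b <= phi a.
  by move=> ab; rewrite ler_wpM2l ?divr_ge0 ?pi_ge0// profile_nonincreasing.
have phi_ge0 a : 0 <= phi a by rewrite mulr_ge0 ?profile_ge0// divr_ge0 ?pi_ge0.
have cphi : continuous phi.
  move=> a; apply: cvgM; first exact: cvg_cst.
  exact: (continuous_profile dens_mass).
have lamE : f_cov lam = phi a0 by exact: phiE.
(* a Lipschitz constant at [a0] of [b |-> s ^+ 2 / b ^+ 2] on [A, B] *)
pose D := 4 * s ^+ 2 * (3 * a0) / (a0 ^+ 2 * a0 ^+ 2).
have D0 : 0 < D.
  by rewrite divr_gt0// ?mulr_gt0// ?exprn_gt0.
clearbody phi kap.
exists (D / kap); split; first exact: divr_gt0.
exists (kap * A); split; first exact: mulr_gt0.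
move=> dflt v; rewrite lamE => hv.
have /andP[v1 v2] : (phi a0 - kap * A < v) && (v < phi a0 + kap * A).
  by move: hv; rewrite ltr_norml => /andP[? ?]; apply/andP; split; lra.
have vA : v < phi A.
  have := gap _ _ A0 Aa aB; have -> : a0 - A = A by rewrite /A; lra.
  by move=> ?; lra.
have vB : phi B < v.
  have h := gap _ _ a00 aB (lexx B).
  have : kap * A <= kap * (B - a0) by rewrite ler_wpM2l ?ltW// /A /B; lra.
  by move=> ?; lra.
have [a aI va] : exists2 a, a \in `[A, B] & phi a = v.
  apply: IVT; first exact: le_trans Aa aB.
  - exact: continuous_subspaceT.
  - by rewrite ge_min le_max (ltW vA) (ltW vB) orbT.
move: aI; rewrite in_itv/= => /andP[Aa' aB'].
have a_gt0 : 0 < a by rewrite (lt_le_trans A0).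
pose I : set R := `[0, +oo[%classic.
have vim : (@f_cov R @` I) v.
  exists (s ^+ 2 / a ^+ 2); last by rewrite phiE.
  by rewrite /I /= in_itv/= andbT divr_ge0// sqr_ge0.
have fK : f_cov (f_cov_inv dflt v) = v by apply: pinvK; rewrite inE.
have : I (f_cov_inv dflt v).
  have surj : set_surj I (@f_cov R @` I) (@f_cov R) by [].
  by apply: (surjpinv_image_sub surj); exists v.
move: (f_cov_inv dflt v) fK => l fK.
rewrite /I /= in_itv/= andbT => l0.
have l_gt0 : 0 < l.
  rewrite lt_neqAle eq_sym l0 andbT; apply/eqP => le0.
  have := phi_ge0 B; rewrite leNgt => /negP; apply.
  by move: fK; rewrite le0 /f_cov eqxx => ->.
pose b := s / Num.sqrt l.
have b_gt0 : 0 < b by rewrite divr_gt0 ?sqrtr_gt0.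
have lE : l = s ^+ 2 / b ^+ 2.
  rewrite /b expr_div_n sqr_sqrtr// invf_div mulrC divfK//.
  by rewrite gt_eqF// exprn_gt0.
have vb : phi b = v by have := phiE b b_gt0; rewrite -lE fK => ->.
clearbody b.
have Ab : A <= b.
  rewrite leNgt; apply/negP => /ltW /mono; rewrite vb leNgt => /negP; apply.
  exact: vA.
have bB : b <= B.
  rewrite leNgt; apply/negP => /ltW /mono; rewrite vb leNgt => /negP; apply.
  exact: vB.
have dist : kap * `|b - a0| <= `|v - phi a0|.
  have [ba|/ltW ba] := leP a0 b.
    have h1 : v <= phi a0 by rewrite -vb mono.
    have h2 := gap _ _ a00 ba bB; rewrite vb in h2.
    by rewrite distrC (distrC v) distrC (ger0_norm (_ : 0 <= b - a0)) ?subr_ge0//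
      (ger0_norm (_ : 0 <= phi a0 - v)) ?subr_ge0.
  have h1 : phi a0 <= v by rewrite -vb mono.
  have h2 := gap _ _ b_gt0 ba aB; rewrite vb in h2.
  by rewrite distrC (ger0_norm (_ : 0 <= a0 - b)) ?subr_ge0//
    (ger0_norm (_ : 0 <= v - phi a0)) ?subr_ge0.
have ldist : `|l - lam| <= D * `|b - a0|.
  have -> : l - lam = (s ^+ 2 * (a0 + b) / (b ^+ 2 * a0 ^+ 2)) * (a0 - b).
    by rewrite lE /lam; field; rewrite !gt_eqF.
  rewrite normrM (distrC b) ler_wpM2r// ger0_norm; last first.
    by apply: divr_ge0; apply: mulr_ge0; rewrite ?sqr_ge0// addr_ge0// ltW.
  rewrite ler_pdivrMr ?mulr_gt0 ?exprn_gt0// /D.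
  have -> : 4 * s ^+ 2 * (3 * a0) / (a0 ^+ 2 * a0 ^+ 2) * (b ^+ 2 * a0 ^+ 2) =
    s ^+ 2 * ((3 * a0) * (4 * b ^+ 2 / a0 ^+ 2)).
    by field; rewrite gt_eqF.
  rewrite ler_wpM2l ?sqr_ge0//; apply: (@le_trans _ _ (3 * a0)).
    have -> : 3 * a0 = a0 + B by rewrite /B; ring.
    by rewrite lerD2l.
  have a3 : 0 <= 3 * a0 by rewrite mulr_ge0// ltW.
  apply: ler_peMr => //; rewrite ler_pdivlMr ?exprn_gt0// mul1r.
  have -> : 4 * b ^+ 2 = (2 * b) ^+ 2 by ring.
  have b0 : 0 <= b by exact: ltW.
  have a0' : 0 <= a0 by exact: ltW.
  rewrite ler_sqr ?nnegrE ?mulr_ge0//.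
  by rewrite -ler_pdivrMl// mulrC.
apply: (le_trans ldist); rewrite -mulrA; apply: ler_wpM2l; first exact: ltW.
by rewrite mulrC ler_pdivlMr// mulrC.
Qed.

End inverse_profile.

(** * Kernels with bounded features *)

Section finite_rank.
Variable R : realType.
Local Notation V := 'rV[R]_3.
Implicit Types (k : V -> V -> R) (q y : V) (C c : R).

(** Factorizations through a finite-dimensional Euclidean space by maps of
  squared norm at most [C].  Only the features of the observation [y] have to
  be measurable. *)
Definition finite_rank C k : Prop :=
  exists (J : finType) (al be : J -> V -> R),
  [/\ forall j, measurable_fun setT (be j : borel3 R -> R),
      forall q, sphere2 q -> \sum_j al j q ^+ 2 <= C,
      forall y, sphere2 y -> \sum_j be j y ^+ 2 <= C &
      forall q y, sphere2 q -> sphere2 y -> k q y = \sum_j al j q * be j y].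

Lemma finite_rank_le C c k : C <= c -> finite_rank C k -> finite_rank c k.
Proof.
move=> Cc [J [al [be [mbe h1 h2 h3]]]]; exists J, al, be; split => //.
  by move=> q /h1 h; exact: le_trans h Cc.
by move=> y /h2 h; exact: le_trans h Cc.
Qed.

Lemma finite_rank_cst c : 0 <= c -> finite_rank c (fun _ _ => c).
Proof.
move=> c0; exists unit, (fun _ _ => Num.sqrt c), (fun _ _ => Num.sqrt c).
have e : \sum_(j : unit) Num.sqrt c ^+ 2 = c.
  by rewrite (big_pred1 tt) ?sqr_sqrtr.
split; first by [].
- by move=> q _; rewrite e.
- by move=> q _; rewrite e.
- by move=> q y _ _; rewrite -[LHS]e; apply: eq_bigr => j _; rewrite expr2.
Qed.

Lemma finite_rank_add C1 C2 k1 k2 : finite_rank C1 k1 -> finite_rank C2 k2 ->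
  finite_rank (C1 + C2) (fun q y => k1 q y + k2 q y).
Proof.
move=> [J1 [a1 [b1 [m1 u1 v1 e1]]]] [J2 [a2 [b2 [m2 u2 v2 e2]]]].
exists (J1 + J2)%type.
exists (fun j q => match j with inl i => a1 i q | inr i => a2 i q end).
exists (fun j y => match j with inl i => b1 i y | inr i => b2 i y end).
split; first by case.
- by move=> q Sq; rewrite big_sumType/= lerD ?u1 ?u2.
- by move=> y Sy; rewrite big_sumType/= lerD ?v1 ?v2.
- by move=> q y Sq Sy; rewrite big_sumType/= e1// e2.
Qed.

(** The features of a product are the tensor products of the features. *)
Lemma finite_rank_mul C1 C2 k1 k2 : 0 <= C1 -> finite_rank C1 k1 -> finite_rank C2 k2 ->
  finite_rank (C1 * C2) (fun q y => k1 q y * k2 q y).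
Proof.
move=> C10 [J1 [a1 [b1 [m1 u1 v1 e1]]]] [J2 [a2 [b2 [m2 u2 v2 e2]]]].
have sumM (f : J1 -> R) (g : J2 -> R) :
    \sum_(j : J1 * J2) f j.1 * g j.2 = (\sum_i f i) * (\sum_i g i).
  rewrite big_distrl/= -(pair_bigA _ (fun i j => f i * g j))/=.
  by apply: eq_bigr => i _; rewrite big_distrr.
exists (J1 * J2)%type, (fun j q => a1 j.1 q * a2 j.2 q), (fun j y => b1 j.1 y * b2 j.2 y).
have sq0 (J : finType) (f : J -> R) : 0 <= \sum_j f j ^+ 2 by rewrite sumr_ge0// => j _; exact: sqr_ge0.
split.
- by move=> j; exact: measurable_funM.
- move=> q Sq; under eq_bigr do rewrite exprMn.
  by rewrite (sumM (fun i => a1 i q ^+ 2) (fun i => a2 i q ^+ 2)) ler_pM ?sq0 ?u1 ?u2.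
- move=> y Sy; under eq_bigr do rewrite exprMn.
  by rewrite (sumM (fun i => b1 i y ^+ 2) (fun i => b2 i y ^+ 2)) ler_pM ?sq0 ?v1 ?v2.
- move=> q y Sq Sy; rewrite e1// e2// -sumM; apply: eq_bigr => j _; ring.
Qed.

Lemma finite_rank_scale c C k : 0 <= c -> finite_rank C k ->
  finite_rank (c * C) (fun q y => c * k q y).
Proof. by move=> c0 kC; apply: finite_rank_mul => //; exact: finite_rank_cst. Qed.

Lemma dot_sphere q : sphere2 q -> dot q q = 1.
Proof.
rewrite /sphere2 /= /enorm => h.
have d0 : 0 <= dot q q by rewrite sumr_ge0// => k _; rewrite -expr2 sqr_ge0.
by rewrite -(sqr_sqrtr d0) h expr1n.
Qed.

Lemma finite_rank_chord : finite_rank 1 (fun q y => (1 - dot q y) / 2).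
Proof.
pose r := Num.sqrt (2^-1 : R).
have r2 : r ^+ 2 = 2^-1 by rewrite sqr_sqrtr.
have h : finite_rank 2^-1 (fun q y => - dot q y / 2).
  exists 'I_3, (fun j q => - r * q 0 j), (fun j y => r * y 0 j); split.
  - by move=> j; apply: measurable_funM => //; exact: measurable_coord.
  - move=> q /dot_sphere; rewrite /dot => e; under eq_bigr do rewrite exprMn sqrrN r2 expr2.
    by rewrite -mulr_sumr e mulr1.
  - move=> q /dot_sphere; rewrite /dot => e; under eq_bigr do rewrite exprMn r2 expr2.
    by rewrite -mulr_sumr e mulr1.
  - move=> q y _ _; rewrite /dot -r2 mulNr mulr_suml -sumrN.
    by apply: eq_bigr => j _; ring.
have half0 : 0 <= 2^-1 :> R by [].
have := finite_rank_add (finite_rank_cst half0) h.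
have -> : 2^-1 + 2^-1 = 1 :> R by field.
suff -> : (fun q y => 2^-1 + - dot q y / 2) = (fun q y => (1 - dot q y) / 2) by [].
by apply/funext => q; apply/funext => y; field.
Qed.

Lemma finite_rank_bound C k q y : finite_rank C k -> sphere2 q -> sphere2 y ->
  `|k q y| <= C.
Proof.
move=> [J [al [be [_ h1 h2 h3]]]] Sq Sy; rewrite h3//.
apply: (le_trans (ler_norm_sum _ _ _)).
apply: (@le_trans _ _ (\sum_j (al j q ^+ 2 + be j y ^+ 2) / 2)).
  apply: ler_sum => j _; rewrite ler_norml; move: (al j q) (be j y) => a b.
  have h : 0 <= (a - b) ^+ 2 by exact: sqr_ge0.
  have h' : 0 <= (a + b) ^+ 2 by exact: sqr_ge0.
  by clear -h h'; apply/andP; split; nra.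
rewrite -mulr_suml big_split/= ler_pdivrMr//.
by have := lerD (h1 _ Sq) (h2 _ Sy); rewrite mulr_natr mulr2n.
Qed.

(** The iteration [t -> (x + t ^ 2) / 2], which converges to [1 - sqrt (1 - x)] on
  [0, 1].  It consists of sums and products with nonnegative coefficients, so
  that it acts on kernels without losing control of the features: their squared
  norm [C] becomes [sqrt_iter n C]. *)
Fixpoint sqrt_iter (n : nat) (x : R) : R :=
  if n is m.+1 then 2^-1 * (x + sqrt_iter m x * sqrt_iter m x) else 0.

Definition vers (x : R) : R := 1 - Num.sqrt (1 - x).

Lemma vers_fix x : x <= 1 -> vers x = 2^-1 * (x + vers x * vers x).
Proof.
move=> x1; have h : Num.sqrt (1 - x) ^+ 2 = 1 - x by rewrite sqr_sqrtr ?subr_ge0.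
rewrite /vers; move: (Num.sqrt (1 - x)) h => t h.
have -> : x = 1 - t ^+ 2 by rewrite h; ring.
by field.
Qed.

Lemma sqrt_iter_ge0 n x : 0 <= x -> 0 <= sqrt_iter n x.
Proof.
by move=> x0; case: n => //= n; rewrite mulr_ge0// addr_ge0// -expr2 sqr_ge0.
Qed.

(** The error [e] satisfies [0 <= e' <= e * (1 - e / 2)], from which
  [e_n <= 2 / (n + 1)] by induction; the bound does not depend on [x], even
  though the convergence is not geometric at [x = 1]. *)
Lemma sqrt_iter_err n x : 0 <= x -> x <= 1 ->
  0 <= vers x - sqrt_iter n x <= 2 / n.+1%:R.
Proof.
move=> x0 x1.
have s0 : 0 <= Num.sqrt (1 - x) by exact: sqrtr_ge0.
have v1 : vers x <= 1 by rewrite /vers; move: (Num.sqrt _) s0 => t; lra.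
have v0 : 0 <= vers x.
  by rewrite subr_ge0 -[leRHS]sqrtr1 ler_sqrt// gerBl.
elim: n => [|n /andP[e0 e1]] /=.
  by rewrite subr0 v0 divr1/=; move: (vers x) v1 => t; lra.
rewrite {1 2}(vers_fix x1).
have := sqrt_iter_ge0 n x0; move: (sqrt_iter n x) (vers x) v0 v1 e0 e1 => t v.
move=> v0 v1 e0 e1 t0.
have -> : 2^-1 * (x + v * v) - 2^-1 * (x + t * t) = (v - t) * (v - (v - t) / 2).
  by field.
have e2 : v - t <= 1 by lra.
apply/andP; split; first by rewrite mulr_ge0//; lra.
apply: (@le_trans _ _ ((v - t) * (1 - (v - t) / 2))).
  by rewrite ler_wpM2l// lerB.
move: (v - t) e0 e1 e2 => e; clear -e; move=> e0 e1 e2.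
rewrite ler_pdivlMr//; rewrite ler_pdivlMr// in e1.
have h : e * n.+2%:R <= 2 + e by rewrite -[n.+2%:R]natr1 mulrDr mulr1 lerD2r.
rewrite mulrAC; apply: (@le_trans _ _ ((2 + e) * (1 - e / 2))).
  by rewrite ler_wpM2r//; lra.
have := sqr_ge0 e; nra.
Qed.

Lemma sqrt_iter_le1 n x : `|x| <= 1 -> `|sqrt_iter n x| <= 1.
Proof.
move=> x1; elim: n => [|n IHn] /=; first by rewrite normr0.
rewrite normrM ger0_norm// ler_pdivrMl// mulr1.
apply: (le_trans (ler_normD _ _)); rewrite normrM.
apply: (@le_trans _ _ (1 + 1)); last by [].
by apply: lerD => //; rewrite -[leRHS]mulr1; apply: ler_pM.
Qed.

Lemma sqrt_iter_lip n x z : `|x| <= 1 -> `|z| <= 1 ->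
  `|sqrt_iter n x - sqrt_iter n z| <= n%:R * `|x - z|.
Proof.
move=> x1 z1; elim: n => [|n IHn] /=; first by rewrite subr0 normr0 mul0r.
have := sqrt_iter_le1 n x1; have := sqrt_iter_le1 n z1.
move: (sqrt_iter n x) (sqrt_iter n z) IHn => u v IHn v1 u1.
have -> : 2^-1 * (x + u * u) - 2^-1 * (z + v * v) = 2^-1 * ((x - z) + (u - v) * (u + v)) by field.
rewrite normrM ger0_norm// ler_pdivrMl//.
apply: (le_trans (ler_normD _ _)); rewrite normrM.
have uv : `|u + v| <= 2 by apply: (le_trans (ler_normD _ _)); rewrite -[2]/(1 + 1) lerD.
have h : `|u - v| * `|u + v| <= (n%:R * `|x - z|) * 2 by rewrite ler_pM.
apply: (le_trans (lerD (lexx _) h)).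
have := normr_ge0 (x - z); rewrite -[n.+1%:R]natr1; move: (`|x - z|) (n%:R : R) => w t w0.
have -> : 2 * ((t + 1) * w) = w + t * w * 2 + w by ring.
by rewrite lerDl.
Qed.

Lemma finite_rank_sqrt_iter n C k : 0 <= C -> finite_rank C k ->
  finite_rank (sqrt_iter n C) (fun q y => sqrt_iter n (k q y)).
Proof.
move=> C0 kC; elim: n => [|n IHn] /=; first exact: finite_rank_cst.
apply: (@finite_rank_scale _ _ (fun q y => k q y + sqrt_iter n (k q y) * sqrt_iter n (k q y))) => //.
apply: finite_rank_add => //; apply: finite_rank_mul => //.
exact: sqrt_iter_ge0.
Qed.

(** The rank of the approximation may grow with its precision, but not the bound
  [C] on the features, which is what the variance estimate sees. *)
Definition kernel_class C k : Prop := forall eps, 0 < eps ->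
  exists2 k', finite_rank C k' &
    forall q y, sphere2 q -> sphere2 y -> `|k q y - k' q y| <= eps.

Lemma kernel_class_fin C k : finite_rank C k -> kernel_class C k.
Proof. by move=> kC e e0; exists k => // q y _ _; rewrite subrr normr0 ltW. Qed.

Lemma kernel_class_le C c k : C <= c -> kernel_class C k -> kernel_class c k.
Proof.
by move=> Cc kC e /kC[k' k'C h]; exists k' => //; exact: finite_rank_le k'C.
Qed.

Lemma kernel_class_ext C k k2 :
  (forall q y, sphere2 q -> sphere2 y -> k q y = k2 q y) ->
  kernel_class C k -> kernel_class C k2.
Proof.
move=> e kC eps /kC[k' k'C h]; exists k' => // q y Sq Sy.
by rewrite -e// h.
Qed.

Lemma kernel_class_scale c C k : 0 <= c -> kernel_class C k ->
  kernel_class (c * C) (fun q y => c * k q y).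
Proof.
move=> c0 kC e e0; have ec0 : 0 < e / (c + 1) by rewrite divr_gt0// ltr_wpDl.
have [k' k'C h] := kC _ ec0.
exists (fun q y => c * k' q y); first exact: finite_rank_scale.
move=> q y Sq Sy; rewrite -mulrBr normrM (ger0_norm c0).
apply: (le_trans (ler_wpM2l c0 (h q y Sq Sy))).
rewrite mulrA ler_pdivrMr ?ltr_wpDl//.
have -> : e * (c + 1) = c * e + e by ring.
by rewrite lerDl ltW.
Qed.

(** [vers] is approximated uniformly on [0, 1] by [sqrt_iter n], and
  [sqrt_iter n C] increases to [vers C], so that the constant is [vers C]. *)
Lemma kernel_class_vers C k : 0 <= C -> C <= 1 ->
  (forall q y, sphere2 q -> sphere2 y -> 0 <= k q y <= 1) ->
  kernel_class C k -> kernel_class (vers C) (fun q y => vers (k q y)).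
Proof.
move=> C0 C1 kI kC e e0.
pose n := (Num.truncn (4 / e)).+1.
have n0 : 0 < n%:R :> R by [].
have ne : 2 / n.+1%:R <= e / 2.
  have h : 4 / e < n%:R by exact: truncnS_gt.
  rewrite ltr_pdivrMr// in h.
  have h2 : n%:R * e <= n.+1%:R * e by apply: ler_wpM2r; [exact: ltW|rewrite ler_nat].
  rewrite ler_pdivrMr// mulrAC ler_pdivlMr// (mulrC e).
  by apply: le_trans h2; apply: le_trans (ltW h); rewrite -natrM.
have en0 : 0 < e / (2 * n%:R) by rewrite divr_gt0// mulr_gt0.
have [k' k'C h] := kC _ en0.
exists (fun q y => sqrt_iter n (k' q y)).
  apply: (@finite_rank_le (sqrt_iter n C)); last exact: finite_rank_sqrt_iter.
  by have /andP[+ _] := sqrt_iter_err n C0 C1; rewrite subr_ge0.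
move=> q y Sq Sy; have /andP[k0 k1] := kI _ _ Sq Sy.
have kn : `|k q y| <= 1 by rewrite ger0_norm.
have k'n : `|k' q y| <= 1 by exact: le_trans (finite_rank_bound k'C Sq Sy) C1.
have l := sqrt_iter_lip n kn k'n.
have /andP[e1 e2] := sqrt_iter_err n k0 k1.
apply: (le_trans (ler_distD (sqrt_iter n (k q y)) _ _)).
rewrite [leRHS](splitr e); apply: lerD; first by rewrite ger0_norm// (le_trans e2).
apply: (le_trans l); rewrite mulrC -ler_pdivlMr//.
by rewrite (le_trans (h _ _ Sq Sy))// invfM mulrA.
Qed.

End finite_rank.

(** * The squared distance as a kernel *)

Section sqdist_kernel.
Variable R : realType.
Local Notation V := 'rV[R]_3.
Implicit Types (t : R) (q y : V).

Lemma MVT_sin t : 0 < t -> exists2 c, 0 < c < t & sin t = t * cos c.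
Proof.
move=> t0.
have ds z : z \in `]0, t[ -> is_derive z 1 sin (cos z).
  by move=> _; exact: is_derive_sin.
have cs : {within `[0, t], continuous (@sin R)}.
  by apply: continuous_subspaceT => z; exact: continuous_sin.
have [c + ] := MVT t0 ds cs; rewrite in_itv/= => cI.
by rewrite sin0 !subr0 mulrC => e; exists c.
Qed.

Lemma sin_le t : 0 <= t -> sin t <= t.
Proof.
rewrite le_eqVlt => /predU1P[<-|t0]; first by rewrite sin0.
have [c _ ->] := MVT_sin t0.
by rewrite ler_piMr ?cos_le1// ltW.
Qed.

Lemma sqr_sin_le t : 0 <= t -> t <= pi -> sin t ^+ 2 <= t ^+ 2.
Proof. by move=> t0 tpi; rewrite ler_sqr ?nnegrE ?sin_ge0_pi ?t0 ?sin_le. Qed.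

Lemma cos_ge t : 0 <= t -> t <= pi -> 1 - t ^+ 2 / 2 <= cos t.
Proof.
move=> t0 tpi; have -> : cos t = 1 - 2 * sin (t / 2) ^+ 2.
  by rewrite {1}(splitr t) cosD -!expr2 cos2sin2; ring.
have : sin (t / 2) ^+ 2 <= (t / 2) ^+ 2 by apply: sqr_sin_le; lra.
rewrite expr_div_n; lra.
Qed.

Lemma sqr_sin_ge t : 0 <= t -> t <= pi -> t ^+ 2 - sin t ^+ 2 <= t ^+ 4.
Proof.
rewrite le_eqVlt => /predU1P[<- _|t0 tpi]; first by rewrite sin0 !expr0n/= subr0.
have [t1|t1] := leP 1 t.
  apply: (@le_trans _ _ (t ^+ 2)); first by rewrite gerBl sqr_ge0.
  by rewrite ler_weXn2l.
have [c /andP[c0 ct] st] := MVT_sin t0.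
have cc : 1 - t ^+ 2 / 2 <= cos c.
  apply: le_trans (cos_ge (ltW c0) _); last by rewrite (le_trans (ltW ct)).
  by rewrite lerD2l lerN2 ler_wpM2r// ler_sqr ?nnegrE ltW.
rewrite st exprMn.
have h : 1 - t ^+ 2 <= cos c ^+ 2.
  have t2 : t ^+ 2 <= 1 by rewrite expr_le1// ltW.
  have t20 : 0 <= t ^+ 2 by exact: sqr_ge0.
  have : (1 - t ^+ 2 / 2) ^+ 2 <= cos c ^+ 2.
    by rewrite ler_sqr ?nnegrE//; [|apply: le_trans cc]; lra.
  move: (t ^+ 2) t20 t2 => w w0 w1; move: (cos c ^+ 2) => k.
  have := sqr_ge0 w; rewrite expr2; clear; nra.
have h2 := ler_wpM2l (sqr_ge0 t) h.
rewrite lerBlDr (le_trans _ (lerD (lexx _) h2))//.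
by rewrite mulrBr mulr1 -exprD addrC subrK.
Qed.

Lemma vers_sqr_sin t : 0 <= t -> t <= pi / 2 ->
  2^-1 * vers (sin t ^+ 2) = sin (t / 2) ^+ 2.
Proof.
move=> t0 tpi; rewrite /vers.
have -> : 1 - sin t ^+ 2 = cos t ^+ 2 by rewrite -cos2sin2.
have pi0 := pi_gt0 R.
rewrite sqrtr_sqr ger0_norm; last by rewrite cos_ge0_pihalf//; apply/andP; split; lra.
by rewrite {1}(splitr t) cosD -!expr2 cos2sin2; field.
Qed.

Lemma dot_sphere_itv q y : sphere2 q -> sphere2 y -> -1 <= dot q y <= 1.
Proof.
move=> /dot_sphere Sq /dot_sphere Sy; rewrite !dotE in Sq Sy *.
move: (q 0 0) (q 0 1) (q 0 (2%:R : 'I_3)) Sq => a b c.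
move: (y 0 0) (y 0 1) (y 0 (2%:R : 'I_3)) Sy => a' b' c' h h'.
have h1 : 0 <= (a - a') ^+ 2 + (b - b') ^+ 2 + (c - c') ^+ 2.
  by rewrite !addr_ge0 ?sqr_ge0.
have h2 : 0 <= (a + a') ^+ 2 + (b + b') ^+ 2 + (c + c') ^+ 2.
  by rewrite !addr_ge0 ?sqr_ge0.
rewrite (_ : _ + _ = (a * a + b * b + c * c) + (a' * a' + b' * b' + c' * c') -
  2 * (a * a' + b * b' + c * c')) in h1; last by ring.
rewrite (_ : _ + _ = (a * a + b * b + c * c) + (a' * a' + b' * b' + c' * c') +
  2 * (a * a' + b * b' + c * c')) in h2; last by ring.
by rewrite h h' in h1 h2; apply/andP; split; lra.
Qed.

(** [(1 - <q, y>) / 2] is [sin (theta / 2) ^+ 2], where [theta] is the distance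
  from [q] to [y], and each application of [2^-1 * vers] halves the angle
  ([vers_sqr_sin]); the constant follows the same recursion from [theta = pi]. *)
Lemma kernel_class_sin n :
  kernel_class (sin (pi / 2 ^+ n.+1) ^+ 2)
    (fun q y => sin (acos (dot q y) / 2 ^+ n.+1) ^+ 2 : R).
Proof.
have pi0 := pi_gt0 R.
elim: n => [|n IHn].
  rewrite expr1 sin_pihalf expr1n.
  apply: (@kernel_class_ext _ _ (fun q y => (1 - dot q y) / 2)).
    move=> q y Sq Sy; have I := dot_sphere_itv Sq Sy.
    rewrite -{1}(@acosK _ (dot q y)) ?in_itv//=; move: (acos _) => t.
    by rewrite {1}(splitr t) cosD -!expr2 cos2sin2; field.
  exact/kernel_class_fin/finite_rank_chord.
have p1 : 0 < 2 ^+ n :> R by rewrite exprn_gt0.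
have p1' : 1 <= 2 ^+ n :> R by rewrite exprn_ege1// ler1n.
have arg t : 0 <= t -> t <= pi -> 0 <= t / 2 ^+ n.+1 /\ t / 2 ^+ n.+1 <= pi / 2.
  move=> t0 tpi; have p2 : 0 < 2 ^+ n.+1 :> R by rewrite exprn_gt0.
  split; first by rewrite divr_ge0// ltW.
  rewrite ler_pdivrMr// exprS mulrA divfK//.
  by rewrite (le_trans tpi)// ler_peMr// ltW.
have step t : 0 <= t -> t <= pi ->
    2^-1 * vers (sin (t / 2 ^+ n.+1) ^+ 2) = sin (t / 2 ^+ n.+2) ^+ 2.
  move=> t0 tpi; have [a1 a2] := arg t t0 tpi.
  rewrite vers_sqr_sin//; congr (sin _ ^+ 2).
  by rewrite [in RHS]exprSr invfM mulrA.
have sin01 t : 0 <= sin t ^+ 2 <= 1.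
  by rewrite sqr_ge0/= sin2cos2 gerBl sqr_ge0.
have /andP[c0 c1] := sin01 (pi / 2 ^+ n.+1).
have half0 : 0 <= 2^-1 :> R by [].
have := kernel_class_scale half0
  (kernel_class_vers c0 c1 (fun q y _ _ => sin01 _) IHn).
rewrite (step pi (ltW pi0) (lexx pi)); apply: kernel_class_ext => q y Sq Sy.
by have I := dot_sphere_itv Sq Sy; rewrite step ?acos_ge0 ?acos_lepi.
Qed.

(** [theta ^+ 2] is the limit of [(P * sin (theta / P)) ^+ 2] as [P = 2 ^+ n] grows,
  uniformly on [0, pi], and the constants [(P * sin (pi / P)) ^+ 2] stay below
  [pi ^+ 2]. *)
Lemma kernel_class_sqdist : kernel_class (pi ^+ 2) (fun q y => acos (dot q y) ^+ 2 : R).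
Proof.
move=> e e0; have pi0 := pi_gt0 R.
pose n := (Num.truncn (pi ^+ 4 / (e / 2) : R)).+1.
pose P : R := 2 ^+ n.+1.
have P0 : 0 < P by rewrite exprn_gt0.
have P1 : 1 <= P by rewrite exprn_ege1// ler1n.
have nP : n%:R <= P ^+ 2.
  apply: (@le_trans _ _ P); last by rewrite expr2 ler_peMr// ltW.
  by rewrite /P -natrX ler_nat; apply: ltnW; apply: ltn_trans (ltn_expl _ _); rewrite ?ltnS.
have errP : pi ^+ 4 / P ^+ 2 <= e / 2.
  have h : pi ^+ 4 / (e / 2) < n%:R by exact: truncnS_gt.
  rewrite ltr_pdivrMr ?divr_gt0// in h.
  rewrite ler_pdivrMr ?exprn_gt0// (le_trans (ltW h))// mulrC.
  by apply: ler_wpM2l => //; rewrite ltW// divr_gt0.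
have K := kernel_class_scale (sqr_ge0 P) (kernel_class_sin n).
have e20 : 0 < e / 2 by rewrite divr_gt0.
have {K}K : kernel_class (pi ^+ 2) (fun q y => P ^+ 2 * sin (acos (dot q y) / P) ^+ 2).
  apply: kernel_class_le K.
  have h : sin (pi / P) ^+ 2 <= (pi / P) ^+ 2.
    apply: sqr_sin_le; first by rewrite divr_ge0// ltW.
    by rewrite ler_pdivrMr// ler_peMr// ltW.
  rewrite expr_div_n ler_pdivlMr ?exprn_gt0// in h.
  by rewrite mulrC.
have [k' k'C h] := K _ e20.
exists k' => // q y Sq Sy.
have I := dot_sphere_itv Sq Sy.
apply: (le_trans (ler_distD (P ^+ 2 * sin (acos (dot q y) / P) ^+ 2) _ _)).
rewrite [leRHS](splitr e); apply: lerD; last exact: h.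
have t0 := acos_ge0 I; have tpi := acos_lepi I; move: (acos _) t0 tpi => t t0 tpi.
have tP0 : 0 <= t / P by rewrite divr_ge0// ltW.
have tPpi : t / P <= pi.
  by rewrite ler_pdivrMr// (le_trans tpi)// ler_peMr// ltW.
have PN : P != 0 by rewrite gt_eqF.
have -> : t ^+ 2 - P ^+ 2 * sin (t / P) ^+ 2 = P ^+ 2 * ((t / P) ^+ 2 - sin (t / P) ^+ 2).
  by move: (sin _) => w; field.
rewrite ger0_norm; last by rewrite mulr_ge0 ?sqr_ge0// subr_ge0 sqr_sin_le.
apply: le_trans (ler_wpM2l (sqr_ge0 P) (sqr_sin_ge tP0 tPpi)) _.
have -> : P ^+ 2 * (t / P) ^+ 4 = t ^+ 4 / P ^+ 2 by field.
apply: le_trans errP; rewrite ler_wpM2r ?invr_ge0 ?sqr_ge0//.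
by rewrite lerXn2r ?nnegrE// ltW.
Qed.

End sqdist_kernel.

(** * Bounded random variables *)

Section bounded_measurable.
Context d (T : measurableType d) (R : realType) (P : probability T R).
Implicit Types f g : T -> R.

Definition bounded_mfun f : Prop :=
  measurable_fun setT f /\ exists M, forall w, `|f w| <= M.

Lemma bm_integrable f : bounded_mfun f -> P.-integrable setT (EFin \o f).
Proof.
move=> [mf [M fM]].
have PT : (P [set: T] < +oo)%E by rewrite probability_setT ltry.
apply: (measurable_bounded_integrable measurableT PT mf).
by exists M; split; [exact: num_real|move=> r Mr w _; exact: le_trans (fM w) (ltW Mr)].
Qed.

Lemma bm_cst c : bounded_mfun (fun _ => c).
Proof. by split; [exact: measurable_cst|exists `|c|]. Qed.

Lemma bmD f g : bounded_mfun f -> bounded_mfun g -> bounded_mfun (fun w => f w + g w).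
Proof.
move=> [mf [M fM]] [mg [N gN]]; split; first exact: measurable_funD.
by exists (M + N) => w; apply: (le_trans (ler_normD _ _)); exact: lerD.
Qed.

Lemma bmM f g : bounded_mfun f -> bounded_mfun g -> bounded_mfun (fun w => f w * g w).
Proof.
move=> [mf [M fM]] [mg [N gN]]; split; first exact: measurable_funM.
by exists (M * N) => w; rewrite normrM; apply: ler_pM.
Qed.

Lemma bmZ c f : bounded_mfun f -> bounded_mfun (fun w => c * f w).
Proof. by move=> bf; apply: bmM => //; exact: bm_cst. Qed.

Lemma bmB f g : bounded_mfun f -> bounded_mfun g -> bounded_mfun (fun w => f w - g w).
Proof.
move=> bf bg; have := bmD bf (bmZ (-1) bg).
by under eq_fun do rewrite mulN1r.
Qed.

Lemma bm_sum (I : Type) (r : seq I) (F : I -> T -> R) :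
  (forall i, bounded_mfun (F i)) -> bounded_mfun (fun w => \sum_(i <- r) F i w).
Proof.
move=> bF; elim: r => [|i r IHr].
  by under eq_fun do rewrite big_nil; exact: bm_cst.
by under eq_fun do rewrite big_cons; exact: bmD.
Qed.

Definition mean f : R := \int[P]_w f w.

Lemma mean_cst c : mean (fun _ => c) = c.
Proof. by rewrite /mean Rintegral_cst//= probability_setT mulr1. Qed.

Lemma meanD f g : bounded_mfun f -> bounded_mfun g -> mean (fun w => f w + g w) = mean f + mean g.
Proof. by move=> bf bg; rewrite /mean RintegralD//; exact: bm_integrable. Qed.

Lemma meanZ c f : bounded_mfun f -> mean (fun w => c * f w) = c * mean f.
Proof. by move=> bf; rewrite /mean RintegralZl//; exact: bm_integrable. Qed.

Lemma meanB f g : bounded_mfun f -> bounded_mfun g -> mean (fun w => f w - g w) = mean f - mean g.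
Proof. by move=> bf bg; rewrite /mean RintegralB//; exact: bm_integrable. Qed.

Lemma mean_sum (I : Type) (r : seq I) (F : I -> T -> R) :
  (forall i, bounded_mfun (F i)) -> mean (fun w => \sum_(i <- r) F i w) = \sum_(i <- r) mean (F i).
Proof.
move=> bF; elim: r => [|i r IHr].
  by under eq_fun do rewrite big_nil; rewrite mean_cst big_nil.
under eq_fun do rewrite big_cons.
by rewrite meanD// ?big_cons ?IHr//; exact: bm_sum.
Qed.

Lemma le_mean f g : bounded_mfun f -> bounded_mfun g -> (forall w, f w <= g w) -> mean f <= mean g.
Proof. by move=> bf bg fg; apply: le_Rintegral => //; exact: bm_integrable. Qed.

Lemma mean_dist f g e : bounded_mfun f -> bounded_mfun g -> (forall w, `|f w - g w| <= e) ->
  `|mean f - mean g| <= e.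
Proof.
move=> bf bg fg; rewrite -meanB// ler_norml.
have bfg := bmB bf bg.
apply/andP; split.
  rewrite -[leLHS](mean_cst (- e)); apply: le_mean => //; first exact: bm_cst.
  by move=> w; have := fg w; rewrite ler_norml => /andP[].
rewrite -[leRHS](mean_cst e); apply: le_mean => //; first exact: bm_cst.
by move=> w; have := fg w; rewrite ler_norml => /andP[].
Qed.

(** Pairwise uncorrelated centred variables are orthogonal, so that the second
  moments add up. *)
Lemma mean_sqr_empirical (Y : nat -> T -> R) (mu v : R) (L : nat) :
  (0 < L)%N -> (forall l, bounded_mfun (Y l)) -> (forall l, mean (Y l) = mu) ->
  (forall l m, l != m -> mean (fun w => Y l w * Y m w) = mu * mu) ->
  (forall l, mean (fun w => Y l w * Y l w) = v) ->
  mean (fun w => (L%:R^-1 * \sum_(l < L) Y l w - mu) ^+ 2) <= L%:R^-1 * v.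
Proof.
move=> L0 bY EY EYY EY2.
pose Z l w := Y l w - mu.
have bZ l : bounded_mfun (Z l) by apply: bmB => //; exact: bm_cst.
have EZZ l m : mean (fun w => Z l w * Z m w) = mean (fun w => Y l w * Y m w) - mu * mu.
  have -> : (fun w => Z l w * Z m w) =
      (fun w => (Y l w * Y m w + mu * mu) - (mu * Y l w + mu * Y m w)).
    by apply/funext => w; rewrite /Z; ring.
  have b1 : bounded_mfun (fun w => Y l w * Y m w) by exact: bmM.
  have b2 : bounded_mfun (fun w => mu * Y l w) by exact: bmZ.
  have b3 : bounded_mfun (fun w => mu * Y m w) by exact: bmZ.
  rewrite (meanB (bmD b1 (bm_cst _)) (bmD b2 b3)) (meanD b1 (bm_cst _)) (meanD b2 b3).
  by rewrite mean_cst (meanZ _ (bY l)) (meanZ _ (bY m)) !EY; ring.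
have LN0 : L%:R != 0 :> R by rewrite pnatr_eq0 -lt0n.
have -> : (fun w => (L%:R^-1 * \sum_(l < L) Y l w - mu) ^+ 2) =
    (fun w => L%:R^-2 * \sum_(l < L) \sum_(m < L) Z l w * Z m w).
  apply/funext => w.
  have -> : L%:R^-1 * \sum_(l < L) Y l w - mu = L%:R^-1 * \sum_(l < L) Z l w.
    by rewrite /Z sumrB sumr_const card_ord mulrBr -[mu *+ L]mulr_natl mulKf.
  rewrite exprMn exprVn; congr (_ * _).
  by rewrite expr2 big_distrlr.
have bs l : bounded_mfun (fun w => \sum_(m < L) Z l w * Z m w).
  by apply: bm_sum => m; exact: bmM.
rewrite meanZ; last exact: bm_sum.
rewrite mean_sum//.
have -> : \sum_(l < L) mean (fun w => \sum_(m < L) Z l w * Z m w) = L%:R * (v - mu * mu).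
  rewrite -[in RHS](card_ord L) -sum1_card natr_sum mulr_suml.
  apply: eq_bigr => l _; rewrite mean_sum; last by move=> m; exact: bmM.
  rewrite (bigD1 l)//= big1 ?addr0 ?mul1r ?EZZ ?EY2// => m ml.
  by rewrite EZZ EYY ?subrr// eq_sym.
rewrite mulrA (_ : L%:R^-2 * L%:R = L%:R^-1); last by field.
by rewrite ler_wpM2l ?invr_ge0// gerBl -expr2 sqr_ge0.
Qed.

Lemma measurable_ge f (a : R) : measurable_fun setT f -> measurable [set w | a <= f w].
Proof.
move=> mf; have := mf measurableT _ (measurable_itv `[a, +oo[).
by rewrite setTI; congr (measurable _); apply/seteqP; split => w /=;
  rewrite in_itv/= andbT.
Qed.

Lemma markov_mean f (c a : R) : bounded_mfun f -> (forall w, 0 <= f w) -> 0 < a ->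
  mean f <= c -> (P [set w | (a <= f w)%R] <= (c / a)%:E)%E.
Proof.
move=> bf f0 a0 fc; pose A := [set w | (a <= f w)%R].
have mA : measurable A by exact: measurable_ge bf.1.
have b1 : bounded_mfun (\1_A : T -> R).
  split; first exact: measurable_indic.
  by exists 1 => w; rewrite indicE; case: (_ \in _); rewrite ?normr1 ?normr0.
have : mean (fun w => a * \1_A w) <= mean f.
  apply: le_mean => //; first exact: bmZ.
  move=> w; rewrite indicE; case: (boolP (w \in A)) => [|_]; last by rewrite mulr0.
  by rewrite inE /A /= mulr1.
rewrite meanZ// => h.
have -> : P A = (mean (\1_A : T -> R))%:E.
  rewrite /mean /Rintegral fineK; last exact: integrable_fin_num (bm_integrable b1).
  by rewrite integral_indic// setIT.
by rewrite lee_fin ler_pdivlMr// mulrC (le_trans h).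
Qed.

End bounded_measurable.

Section independence.
Context d (T : measurableType d) (R : realType) (P : probability T R).
Variable x : nat -> T -> 'rV[R]_3.
Hypothesis mx : forall l, random_vector (x l).
Hypothesis x_indep : mutually_independent P x.

Lemma independent_pair l m (A B : set (borel3 R)) : l != m ->
  measurable A -> measurable B ->
  P (x l @^-1` A `&` x m @^-1` B) = (P (x l @^-1` A) * P (x m @^-1` B))%E.
Proof.
move=> lm mA mB.
pose C i : set (borel3 R) := if i == l then A else B.
have mC i : measurable (C i) by rewrite /C; case: ifP.
have Cl : C l = A by rewrite /C eqxx.
have Cm : C m = B by rewrite /C eq_sym (negbTE lm).
have := x_indep [fset l; m]%fset mC.
rewrite big_fsetU1/= ?inE// big_seq_fset1 Cl Cm => <-.
congr (P _); apply/seteqP; split => [w [Aw Bw] i /=|w h].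
  by rewrite !inE => /orP[/eqP ->|/eqP ->]; rewrite ?Cl ?Cm.
split; first by have := h l; rewrite /= !inE eqxx Cl; exact.
by have := h m; rewrite /= !inE eqxx orbT Cm; exact.
Qed.

(** By uniqueness of product measures the joint law of two of the variables is the
  product of their laws, and Fubini's theorem applies. *)
Lemma mean_indep l m (g h : borel3 R -> R) (M N : R) : l != m ->
  measurable_fun setT g -> measurable_fun setT h ->
  (forall y, `|g y| <= M) -> (forall y, `|h y| <= N) ->
  mean P (fun w => g (x l w) * h (x m w)) =
  mean P (fun w => g (x l w)) * mean P (fun w => h (x m w)).
Proof.
move=> lm mg mh gM hN.
pose X i : {mfun T >-> borel3 R} := HB.pack (x i : T -> borel3 R)
    (isMeasurableFun.Build _ _ _ _ (x i : T -> borel3 R) (mx i)).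
have mZ : measurable_fun setT (fun w => (x l w : borel3 R, x m w : borel3 R)).
  by apply/measurable_fun_pairP; split; exact: mx.
pose Z : {mfun T >-> (borel3 R * borel3 R)%type} :=
  HB.pack (fun w => (x l w : borel3 R, x m w : borel3 R))
    (isMeasurableFun.Build _ _ _ _ _ mZ).
pose m1 := distribution P (X l); pose m2 := distribution P (X m).
pose m12 := distribution P Z.
have prodE (B : set (borel3 R * borel3 R)) : measurable B -> (m1 \x m2)%E B = m12 B.
  apply: product_measure_unique => A1 A2 mA1 mA2.
  exact: independent_pair.
pose G (z : borel3 R * borel3 R) := g z.1 * h z.2.
have mG : measurable_fun setT G.
  by apply: measurable_funM; exact: measurableT_comp.
have GM z : `|G z| <= M * N by rewrite normrM ler_pM.
have iG : m12.-integrable setT (EFin \o G).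
  by apply: bm_integrable; split => //; exists (M * N).
have ig : m1.-integrable setT (EFin \o g) by apply: bm_integrable; split => //; exists M.
have ih : m2.-integrable setT (EFin \o h) by apply: bm_integrable; split => //; exists N.
have iGp : (m1 \x m2)%E.-integrable setT (EFin \o G).
  by apply: (@bm_integrable _ _ R (m1 \x m2)%E); split => //; exists (M * N).
have bG : bounded_mfun (fun w => G (x l w, x m w)).
  by split; [exact: (measurableT_comp mG mZ)|exists (M * N)].
have bg : bounded_mfun (fun w => g (x l w)).
  by split; [exact: (measurableT_comp mg (mx l))|exists M].
have bh : bounded_mfun (fun w => h (x m w)).
  by split; [exact: (measurableT_comp mh (mx m))|exists N].
pose Eg := mean P (fun w => g (x l w)); pose Eh := mean P (fun w => h (x m w)).
have hE : (\int[m2]_v (h v)%:E = Eh%:E)%E.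
  rewrite /Eh /mean /Rintegral fineK; last exact: integrable_fin_num (bm_integrable P bh).
  have mEh : measurable_fun setT (EFin \o h) by exact/measurable_EFinP.
  exact: (integral_pushforward (mx m) mEh (bm_integrable P bh) measurableT).
have gE : (\int[m1]_u (g u)%:E = Eg%:E)%E.
  rewrite /Eg /mean /Rintegral fineK; last exact: integrable_fin_num (bm_integrable P bg).
  have mEg : measurable_fun setT (EFin \o g) by exact/measurable_EFinP.
  exact: (integral_pushforward (mx l) mEg (bm_integrable P bg) measurableT).
have GE : (\int[m12]_z (G z)%:E = (mean P (fun w => g (x l w) * h (x m w)))%:E)%E.
  rewrite /mean /Rintegral fineK; last exact: integrable_fin_num (bm_integrable P bG).
  have mEG : measurable_fun setT (EFin \o G) by exact/measurable_EFinP.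
  exact: (integral_pushforward mZ mEG (bm_integrable P bG) measurableT).
suff : (mean P (fun w => g (x l w) * h (x m w)))%:E = (Eg * Eh)%:E by move=> [].
rewrite -GE -(@eq_measure_integral _ _ R setT m12 (m1 \x m2)%E); last first.
  by move=> B mB _; exact: prodE.
rewrite -(integral12_prod_meas1 iGp) EFinM -gE.
transitivity (\int[m1]_u ((g u)%:E * Eh%:E))%E.
  apply: eq_integral => u _; rewrite /fubini_F /G /= -hE.
  under eq_integral do rewrite EFinM.
  by rewrite integralZl.
by rewrite integralZr.
Qed.

End independence.

(** * A uniform law of large numbers with rate *)

Section uniform_law.
Context d (T : measurableType d) (R : realType) (P : probability T R).
Variable x : nat -> T -> 'rV[R]_3.
Hypothesis mx : forall l, random_vector (x l).
Hypothesis x_indep : mutually_independent P x.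
Hypothesis x_ident : forall (g : borel3 R -> R) l,
  measurable_fun setT g -> (exists M, forall y, `|g y| <= M) ->
  mean P (fun w => g (x l w)) = mean P (fun w => g (x 0 w)).

(** Kernels are controlled on the sphere only, where the observations lie almost
  surely; truncation makes them bounded everywhere. *)
Definition trunc_sphere (b : 'rV[R]_3 -> R) (y : 'rV[R]_3) : R :=
  if enorm y == 1 then b y else 0.

Lemma trunc_sphereE b y : sphere2 y -> trunc_sphere b y = b y.
Proof. by move=> Sy; rewrite /trunc_sphere (eqP (introT eqP Sy)) eqxx. Qed.

Lemma measurable_trunc (b : 'rV[R]_3 -> R) :
  measurable_fun setT (b : borel3 R -> R) ->
  measurable_fun setT (trunc_sphere b : borel3 R -> R).
Proof.
move=> mb; apply: measurable_fun_ifT => //.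
by apply: measurable_fun_eqr => //; exact: measurable_enorm.
Qed.

Lemma trunc_bound (b : 'rV[R]_3 -> R) (M : R) : 0 <= M ->
  (forall y, sphere2 y -> `|b y| <= M) -> forall y, `|trunc_sphere b y| <= M.
Proof.
move=> M0 bM y; rewrite /trunc_sphere; case: eqP => [/bM//|_].
by rewrite normr0.
Qed.

(** A linearized Cauchy-Schwarz inequality, used with [eta = 1 / sqrt L] so that the
  bound is affine in [\sum_j b j ^+ 2] and its expectation can be taken. *)
Lemma amgm_sum (J : finType) (a b : J -> R) (eta : R) : 0 < eta ->
  `|\sum_j a j * b j| <= eta / 2 * (\sum_j a j ^+ 2) + eta^-1 / 2 * (\sum_j b j ^+ 2).
Proof.
move=> eta0; apply: (le_trans (ler_norm_sum _ _ _)).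
rewrite !mulr_sumr -big_split/=; apply: ler_sum => j _.
move: (a j) (b j) => u v.
have etaN : eta != 0 by rewrite gt_eqF.
have i0 : 0 <= eta^-1 / 2 by rewrite divr_ge0// invr_ge0 ltW.
have h1 : 0 <= eta^-1 / 2 * (eta * u - v) ^+ 2 by rewrite mulr_ge0 ?sqr_ge0.
have h2 : 0 <= eta^-1 / 2 * (eta * u + v) ^+ 2 by rewrite mulr_ge0 ?sqr_ge0.
have e1 : eta^-1 / 2 * (eta * u - v) ^+ 2 =
    eta / 2 * u ^+ 2 + eta^-1 / 2 * v ^+ 2 - u * v by field.
have e2 : eta^-1 / 2 * (eta * u + v) ^+ 2 =
    eta / 2 * u ^+ 2 + eta^-1 / 2 * v ^+ 2 - (- (u * v)) by field.
rewrite e1 subr_ge0 in h1; rewrite e2 subr_ge0 in h2.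
by rewrite ler_norml h1 lerNl h2.
Qed.

(** Approximate [k] within [1 / sqrt L] by a kernel of finite rank.  The deviation
  of the latter is [\sum_j al j q * S j w], where [S j] is the deviation of the
  empirical mean of the [j]-th feature; [\sum_j S j ^+ 2] does not involve [q]
  and its mean is at most [C / L], since the variances of the features add up
  to at most [C].  A random bound [W] avoids the measurability of a supremum
  over the sphere. *)
Lemma uniform_law_rate (C : R) (k : 'rV[R]_3 -> 'rV[R]_3 -> R) (L : nat) :
  0 <= C -> kernel_class C k ->
  (forall q, measurable_fun setT (k q : borel3 R -> R)) -> (0 < L)%N ->
  exists W : T -> R, [/\ bounded_mfun W, forall w, 0 <= W w,
    mean P W <= (2 + C) / Num.sqrt L%:R &
    forall w, (forall l, (l < L)%N -> sphere2 (x l w)) -> forall q, sphere2 q ->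
      `|L%:R^-1 * \sum_(l < L) k q (x l w) -
        mean P (fun w => trunc_sphere (k q) (x 0 w))| <= W w].
Proof.
move=> C0 kC mk L0.
have Lp : 0 < L%:R :> R by rewrite ltr0n.
pose r : R := Num.sqrt L%:R.
have r0 : 0 < r by rewrite sqrtr_gt0.
have rN : r != 0 by rewrite gt_eqF.
have r2 : r ^+ 2 = L%:R by rewrite sqr_sqrtr// ltW.
have ri0 : 0 < r^-1 by rewrite invr_gt0.
have [k' [J [al [be [mbe h1 h2 h3]]]] kk'] := kC _ ri0.
pose b j := trunc_sphere (be j).
have mb j : measurable_fun setT (b j : borel3 R -> R) by exact: measurable_trunc.
have b2 y : \sum_j b j y ^+ 2 <= C.
  rewrite /b /trunc_sphere; case: eqP => [/h2//|_].
  by rewrite big1// => j _; rewrite expr0n.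
have bC j y : `|b j y| <= C + 1.
  have : b j y ^+ 2 <= C.
    apply: le_trans (b2 y); rewrite (bigD1 j)//= lerDl sumr_ge0// => i _.
    exact: sqr_ge0.
  move: (b j y) => t ht; rewrite ler_norml; clear -ht C0.
  have h1 := sqr_ge0 (t - 1); have h2 := sqr_ge0 (t + 1).
  by apply/andP; split; nra.
have bbm j l : bounded_mfun (fun w => b j (x l w)).
  by split; [exact: (measurableT_comp (mb j) (mx l))|exists (C + 1)].
pose mu j := mean P (fun w => b j (x 0 w)).
pose S j w := L%:R^-1 * \sum_(l < L) b j (x l w) - mu j.
have bS j : bounded_mfun (S j).
  by apply: bmB; [apply/bmZ/bm_sum|exact: bm_cst].
have ES j : mean P (fun w => S j w ^+ 2) <= L%:R^-1 * mean P (fun w => b j (x 0 w) ^+ 2).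
  have e : mean P (fun w => b j (x 0 w) ^+ 2) = mean P (fun w => b j (x 0 w) * b j (x 0 w)) by [].
  rewrite e; apply: (mean_sqr_empirical (Y := fun l w => b j (x l w))) => //.
  - by move=> l; apply: x_ident => //; exists (C + 1).
  - move=> l m lm; rewrite (mean_indep mx x_indep lm (mb j) (mb j) (bC j) (bC j)).
    by congr (_ * _); apply: x_ident => //; exists (C + 1).
  - move=> l; rewrite [LHS](x_ident (g := fun y => b j y * b j y)) => //.
    + exact: measurable_funM.
    + exists ((C + 1) * (C + 1)) => y; rewrite normrM; apply: ler_pM => //.
pose U w := \sum_j S j w ^+ 2.
have bS2 j : bounded_mfun (fun w => S j w ^+ 2) by apply: bmM.
have bU : bounded_mfun U by exact: bm_sum.
have bb2 j : bounded_mfun (fun w => b j (x 0 w) ^+ 2) by apply: bmM.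
have EU : mean P U <= L%:R^-1 * C.
  rewrite /U mean_sum//; apply: (le_trans (ler_sum _ (fun j _ => ES j))).
  rewrite -mulr_sumr; apply: ler_wpM2l; first by rewrite invr_ge0 ltW.
  rewrite -mean_sum//.
  apply: (@le_trans _ _ (mean P (fun _ => C))); last by rewrite mean_cst.
  apply: le_mean; [exact: bm_sum|exact: bm_cst|].
  by move=> w; exact: b2.
pose W w := (2 * r^-1 + r^-1 / 2 * C) + r / 2 * U w.
exists W; split.
- by apply: bmD; [exact: bm_cst|exact: bmZ].
- move=> w; apply: addr_ge0; first apply: addr_ge0.
  + by rewrite mulr_ge0// ltW.
  + by rewrite mulr_ge0// divr_ge0// ltW.
  + apply: mulr_ge0; first by rewrite divr_ge0// ltW.
    by apply: sumr_ge0 => j _; exact: sqr_ge0.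
- rewrite /W meanD ?mean_cst ?meanZ//; [|exact: bm_cst|exact: bmZ].
  have h : r / 2 * mean P U <= r / 2 * (L%:R^-1 * C).
    by apply: ler_wpM2l => //; rewrite divr_ge0// ltW.
  apply: le_trans (lerD (lexx _) h) _.
  by rewrite -/r -r2 le_eqVlt; apply/orP; left; apply/eqP; field.
- move=> w Sw q Sq.
  pose kq y := trunc_sphere (k q) y.
  pose kq' y := \sum_j al j q * b j y.
  have kqq y : `|kq y - kq' y| <= r^-1.
    rewrite /kq /kq' /b /trunc_sphere; case: eqP => [Sy|_].
      by rewrite -h3// kk'.
    by rewrite big1 ?subrr ?normr0; [exact: ltW|] => j _; rewrite mulr0.
  have bkq' : bounded_mfun (fun w => kq' (x 0 w)).
    by apply: bm_sum => j; apply: bmZ; exact: bbm.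
  have [M kqM] : exists M, forall y, `|kq' y| <= M.
    exists (\sum_j `|al j q| * (C + 1)) => y.
    apply: (le_trans (ler_norm_sum _ _ _)); apply: ler_sum => j _.
    by rewrite normrM ler_wpM2l.
  have bkq : bounded_mfun (fun w => kq (x 0 w)).
    split; first exact: (measurableT_comp (measurable_trunc (mk q)) (mx 0)).
    exists (r^-1 + M) => v.
    rewrite -(subrK (kq' (x 0 v)) (kq (x 0 v))).
    by apply: (le_trans (ler_normD _ _)); exact: lerD.
  have e1 : `|mean P (fun w => kq' (x 0 w)) - mean P (fun w => kq (x 0 w))| <= r^-1.
    by rewrite distrC; apply: mean_dist => // v; exact: kqq.
  have e2 : `|L%:R^-1 * \sum_(l < L) k q (x l w) - L%:R^-1 * \sum_(l < L) kq' (x l w)| <= r^-1.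
    rewrite -mulrBr -sumrB normrM ger0_norm; last by rewrite invr_ge0 ltW.
    rewrite ler_pdivrMl//; apply: (le_trans (ler_norm_sum _ _ _)).
    rewrite -[in leRHS](card_ord L) -sum1_card natr_sum mulr_suml; apply: ler_sum => l _.
    by rewrite mul1r -(trunc_sphereE (k q) (Sw l (ltn_ord l))) -/(kq _) kqq.
  have e3 : L%:R^-1 * \sum_(l < L) kq' (x l w) - mean P (fun w => kq' (x 0 w)) =
      \sum_j al j q * S j w.
    rewrite mean_sum; last by move=> j; apply: bmZ; exact: bbm.
    rewrite exchange_big/= mulr_sumr -sumrB; apply: eq_bigr => j _.
    rewrite meanZ// /S mulrBr; congr (_ - _).
    by rewrite -mulr_sumr mulrCA.
  have e4 := amgm_sum (al ^~ q) (S ^~ w) ri0.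
  rewrite invrK in e4.
  have e5 : r^-1 / 2 * (\sum_j al j q ^+ 2) <= r^-1 / 2 * C.
    by rewrite ler_wpM2l ?divr_ge0 ?h1// ltW.
  have -> : L%:R^-1 * \sum_(l < L) k q (x l w) - mean P (fun w => kq (x 0 w)) =
    (L%:R^-1 * \sum_(l < L) k q (x l w) - L%:R^-1 * \sum_(l < L) kq' (x l w)) +
    (\sum_j al j q * S j w) + (mean P (fun w => kq' (x 0 w)) - mean P (fun w => kq (x 0 w))).
    by rewrite -e3; ring.
  apply: (le_trans (ler_normD _ _)); apply: (@le_trans _ _ ((r^-1 + (r^-1 / 2 * C + r / 2 * U w)) + r^-1)).
    apply: lerD e1; apply: (le_trans (ler_normD _ _)); apply: lerD e2 _.
    by apply: (le_trans e4); apply: lerD.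
  by rewrite /W le_eqVlt; apply/orP; left; apply/eqP; ring.
Qed.

End uniform_law.

(** * The law of a projected normal vector *)

Section coordinates_dot.
Variable R : realType.
Implicit Types (p q : R * (R * R)) (x y : 'rV[R]_3) (s : R).

Lemma dot_coord3 x y : dot x y = dotp (coord3 x) (coord3 y).
Proof. exact: dotE. Qed.

Lemma dot_vec3 p q : dot (vec3 p) (vec3 q) = dotp p q.
Proof. by rewrite dot_coord3 !vec3K. Qed.

Lemma vec3B p y : vec3 p - y = vec3 (p - coord3 y).
Proof.
apply/rowP; apply: ord3E; rewrite !mxE; move: y p => y [a [b c]] //=.
Qed.

Lemma normal3_pdfE mu s p : normal3_pdf mu s (vec3 p) = dens s (coord3 mu) p.
Proof.
rewrite /normal3_pdf /dens vec3B /enorm dot_vec3 sqr_sqrtr//.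
exact: dotpp_ge0.
Qed.

Lemma sqr_enorm x : enorm x ^+ 2 = dot x x.
Proof. by rewrite sqr_sqrtr// dot_coord3 dotpp_ge0. Qed.

Lemma enorm_eq0 x : enorm x = 0 -> x = 0.
Proof.
move=> x0; have := sqr_enorm x; rewrite x0 expr0n/= dot_coord3 => /esym/dotpp_eq0 h.
by rewrite -(coord3K x) h; apply/rowP; apply: ord3E; rewrite vec3E mxE.
Qed.

Lemma dotZl a x y : dot (a *: x) y = a * dot x y.
Proof. by rewrite !dotE !mxE; ring. Qed.

Lemma dotZr a x y : dot x (a *: y) = a * dot x y.
Proof. by rewrite !dotE !mxE; ring. Qed.

Lemma enormZ a x : enorm (a *: x) = `|a| * enorm x.
Proof. by rewrite /enorm dotZl dotZr mulrA -expr2 sqrtrM ?sqr_ge0// sqrtr_sqr. Qed.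

Lemma enorm_pr x : x != 0 -> enorm (pr x) = 1.
Proof.
move=> x0; have e0 : enorm x != 0 by apply: contra x0 => /eqP/enorm_eq0/eqP.
by rewrite /pr enormZ normfV ger0_norm ?sqrtr_ge0// mulVf.
Qed.

End coordinates_dot.

Section projected_normal.
Variables (R : realType) (mu : 'rV[R]_3) (sigma : R).
Hypotheses (mu_neq0 : mu != 0) (sigma_gt0 : 0 < sigma).
Variables (d' : measure_display) (T' : measurableType d') (P' : probability T' R).
Variables (X : T' -> 'rV[R]_3) (X_normal : isotropic_normal P' X mu sigma).

Lemma normal_lawE (B : set (borel3 R)) : measurable B ->
  P' (X @^-1` B) =
  (\int[leb3 R]_(p in @vec3 R @^-1` B) (dens sigma (coord3 mu) p)%:E)%E.
Proof.
move=> mB.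
have -> : (fun p => (dens sigma (coord3 mu) p)%:E) =
    (fun p => (normal3_pdf mu sigma (vec3 p))%:E).
  by apply/funext => p; rewrite normal3_pdfE.
exact: (X_normal.2 B mB).
Qed.

(** The total mass of the law of [X], transported to another mean by a
  translation. *)
Lemma normal_dens_mass M : (\int[leb3 R]_p (dens sigma M p)%:E = 1)%E.
Proof.
have h : (\int[leb3 R]_p (dens sigma (coord3 mu) p)%:E = 1)%E.
  have := normal_lawE measurableT; rewrite !preimage_setT probability_setT => ->.
  exact: erefl.
rewrite -(integral_leb3_shift (M - coord3 mu)%R); last 2 first.
- by apply/measurable_EFinP; exact: measurable_dens.
- by move=> p; rewrite lee_fin dens_ge0.
rewrite -[RHS]h; apply: eq_integral => p _; congr (_ %:E).
rewrite /dens; have -> : (p + (M - coord3 mu) - M = p - coord3 mu)%R by rewrite addrA addrAC addrK.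
exact: erefl.
Qed.

Lemma normal_eq0_null : P' [set w | X w = 0] = 0%E.
Proof.
have m0 : measurable ([set 0] : set (borel3 R)).
  have := measurable_enorm measurableT (measurable_set1 (0 : R)); rewrite setTI.
  congr (measurable _); apply/seteqP; split => [y /= /enorm_eq0//|y /= ->].
  by rewrite /enorm dotE !mxE !mul0r !addr0 sqrtr0.
rewrite (normal_lawE m0); apply: null_set_integral.
- by rewrite -[X in measurable X]setTI; apply: measurable_vec3.
- by apply: measurable_funTS; apply/measurable_EFinP; exact: measurable_dens.
have -> : @vec3 R @^-1` [set 0] = [set 0%R] `*` ([set 0%R] `*` [set 0%R]).
  apply/seteqP; split => [p /= h|[a [b c]] /= [-> [-> ->]]].
    have := vec3K p; rewrite h => <-.
    by rewrite /coord3 !mxE.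
  by apply/rowP; apply: ord3E; rewrite vec3E mxE.
have e : leb3 R ([set 0%R] `*` ([set 0%R] `*` [set 0%R])) =
    (leb1 R [set 0%R] * leb2 R ([set 0%R] `*` [set 0%R]))%E.
  by apply: product_measure1E => //; exact: measurableX.
by apply: (etrans e); rewrite lebesgue_measure_set1 mul0e.
Qed.

Variables (d : measure_display) (T : measurableType d) (P : probability T R).
Variables (x : T -> 'rV[R]_3) (mx : random_vector x).
Hypothesis x_law : same_law P P' x (fun w => pr (X w)).

Lemma projected_off_sphere_null : P [set w | enorm (x w) != 1] = 0%E.
Proof.
have mB : measurable ([set y | enorm y != 1] : set (borel3 R)).
  have := measurable_enorm measurableT (measurableC (measurable_set1 (1 : R))); rewrite setTI.
  by congr (measurable _); apply/seteqP; split => y /= /eqP.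
rewrite [LHS](x_law mB) (_ : _ @^-1` _ = [set w | X w = 0]) ?normal_eq0_null//.
apply/seteqP; split => w /=.
  by apply: contraPP => /eqP/enorm_pr ->; rewrite eqxx.
by move=> ->; rewrite /pr enormZ {2}/enorm dotE !mxE !mul0r !addr0 sqrtr0 mulr0 eq_sym oner_neq0.
Qed.

Lemma projected_lawE (phi : borel3 R -> \bar R) : measurable_fun setT phi ->
  (forall y, (0 <= phi y)%E) ->
  (\int[P]_w phi (x w) =
   \int[leb3 R]_p (phi (pr (vec3 p)) * (dens sigma (coord3 mu) p)%:E))%E.
Proof.
move=> mphi phi0.
pose Y : {mfun T >-> borel3 R} := HB.pack (x : T -> borel3 R)
    (isMeasurableFun.Build _ _ _ _ (x : T -> borel3 R) mx).
have mg : measurable_fun setT (fun p => pr (vec3 p) : borel3 R).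
  exact: (measurableT_comp (@measurable_pr R) (@measurable_vec3 R)).
have e : (\int[P]_w phi (x w) = \int[distribution P Y]_y phi y)%E.
  by rewrite ge0_integral_distribution.
have lawE (B : set (borel3 R)) : measurable B -> distribution P Y B =
    (\int[leb3 R]_(p in (fun p => pr (vec3 p)) @^-1` B) (dens sigma (coord3 mu) p)%:E)%E.
  move=> mB; have mB' : measurable (@pr R @^-1` B : set (borel3 R)).
    by rewrite -[X in measurable X]setTI; exact: measurable_pr.
  exact: (etrans (x_law mB) (normal_lawE mB')).
rewrite e; have <- := integral_density (lam := leb3 R) (nu := distribution P Y) mg
  (measurable_dens sigma (coord3 mu)) (@dens_ge0 _ _ _) lawE mphi phi0.
exact: erefl.
Qed.

Definition sqdist (q y : 'rV[R]_3) : R := acos (dot q y) ^+ 2.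

Lemma measurable_sqdist q : measurable_fun setT (sqdist q : borel3 R -> R).
Proof.
apply: measurable_funX; apply: (measurableT_comp (@measurable_acos R)).
by apply: measurable_dot; [exact: measurable_cst|exact: measurable_id].
Qed.

Lemma sqdist_ge0 q y : 0 <= sqdist q y. Proof. exact: sqr_ge0. Qed.

Lemma sqdist_le q y : sphere2 q -> sphere2 y -> sqdist q y <= pi ^+ 2.
Proof.
move=> Sq Sy; have h := dot_sphere_itv Sq Sy.
by rewrite /sqdist ler_pXn2r ?nnegrE ?acos_ge0 ?acos_lepi// pi_ge0.
Qed.

(** Truncation only changes the integrand on a null event.  At [p = 0] both
  sides evaluate [acos 0], because [pr 0 = 0] and [0 / 0 = 0]. *)
Lemma mean_projected_sqdist q : sphere2 q ->
  ((mean P (fun w => trunc_sphere (sqdist q) (x w)))%:E =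
   mean_sqdist sigma (coord3 mu) (coord3 q))%E.
Proof.
move=> Sq.
have mt := measurable_trunc (measurable_sqdist q).
have bt : bounded_mfun (fun w => trunc_sphere (sqdist q) (x w)).
  split; first exact: (measurableT_comp mt mx).
  exists (pi ^+ 2) => w; apply: trunc_bound; first exact: sqr_ge0.
  by move=> y Sy; rewrite ger0_norm ?sqdist_ge0// sqdist_le.
have -> : (mean P (fun w => trunc_sphere (sqdist q) (x w)))%:E =
    (\int[P]_w (trunc_sphere (sqdist q) (x w))%:E)%E.
  by rewrite /mean /Rintegral fineK//; exact: integrable_fin_num (bm_integrable P bt).
have ms : measurable_fun setT (fun y : borel3 R => (sqdist q y)%:E).
  by apply/measurable_EFinP; exact: measurable_sqdist.
transitivity (\int[P]_w (sqdist q (x w))%:E)%E.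
  apply: ge0_ae_eq_integral.
  - exact: measurableT.
  - by apply/measurable_EFinP; exact: bt.1.
  - exact: (measurableT_comp ms mx).
  - move=> w _; rewrite lee_fin /trunc_sphere; case: ifP => // _; exact: sqdist_ge0.
  - by move=> w _; rewrite lee_fin sqdist_ge0.
  - exists [set w | enorm (x w) != 1]; split; last first.
    + move=> w /= h; apply/negP => /eqP Sw; apply: h => _.
      by rewrite trunc_sphereE.
    + exact: projected_off_sphere_null.
    + have := measurableT_comp (@measurable_enorm R) mx.
      move=> /(_ measurableT _ (measurableC (measurable_set1 (1 : R)))); rewrite setTI.
      by congr (measurable _); apply/seteqP; split => y /= /eqP.
rewrite (projected_lawE ms) => [|y]; last by rewrite lee_fin sqdist_ge0.
rewrite /mean_sqdist; apply: eq_integral => p _.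
rewrite -EFinM; congr (_ * _)%:E.
rewrite /sqdist /sqcolat /pr dotZr /enorm dot_vec3 mulrC; congr (acos (_ / _) ^+ 2).
by rewrite dot_coord3 vec3K dotpC.
Qed.

Let lambda := sigma ^+ 2 / enorm mu ^+ 2.

Lemma pr_sphere : sphere2 (pr mu). Proof. exact: enorm_pr. Qed.

Lemma coord3_pr_mu : coord3 mu = scalep (enorm mu) (coord3 (pr mu)).
Proof.
have e0 : enorm mu != 0 by apply: contra mu_neq0 => /eqP/enorm_eq0/eqP.
by rewrite /coord3 /scalep /pr !mxE /= !mulVKf.
Qed.

Lemma dotp_sphere (q : 'rV[R]_3) : sphere2 q -> dotp (coord3 q) (coord3 q) = 1.
Proof. by move=> Sq; rewrite -dot_coord3 -sqr_enorm Sq expr1n. Qed.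

Lemma mean_sqdist_pr_mu :
  mean P (fun w => trunc_sphere (sqdist (pr mu)) (x w)) = 2 * f_cov lambda.
Proof.
have e0 : 0 < enorm mu.
  by rewrite lt_def sqrtr_ge0 andbT; apply: contra mu_neq0 => /eqP/enorm_eq0/eqP.
have := mean_projected_sqdist pr_sphere.
rewrite coord3_pr_mu (mean_sqdistE normal_dens_mass sigma_gt0 e0); last exact: dotp_sphere pr_sphere.
by move=> [].
Qed.

Lemma mean_sqdist_ge q : sphere2 q ->
  2 * f_cov lambda <= mean P (fun w => trunc_sphere (sqdist q) (x w)).
Proof.
move=> Sq; rewrite -mean_sqdist_pr_mu -lee_fin.
rewrite (mean_projected_sqdist Sq) (mean_projected_sqdist pr_sphere) coord3_pr_mu.
apply: (mean_sqdist_min normal_dens_mass); [exact: sqrtr_ge0| |exact: dotp_sphere].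
exact: dotp_sphere pr_sphere.
Qed.

End projected_normal.

Lemma same_law_mean (R : realType) d d' d1 (T : measurableType d) (T1 : measurableType d1)
    (T' : measurableType d') (P : probability T R) (P1 : probability T1 R)
    (P' : probability T' R)
    (x : T -> 'rV[R]_3) (y : T1 -> 'rV[R]_3) (z : T' -> 'rV[R]_3) (g : borel3 R -> R) :
  random_vector x -> random_vector y -> same_law P P' x z -> same_law P1 P' y z ->
  measurable_fun setT g -> (exists M, forall y, `|g y| <= M) ->
  mean P (fun w => g (x w)) = mean P1 (fun w => g (y w)).
Proof.
move=> mx my xz yz mg [M gM].
pose X : {mfun T >-> borel3 R} := HB.pack (x : T -> borel3 R)
    (isMeasurableFun.Build _ _ _ _ (x : T -> borel3 R) mx).
pose Y : {mfun T1 >-> borel3 R} := HB.pack (y : T1 -> borel3 R)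
    (isMeasurableFun.Build _ _ _ _ (y : T1 -> borel3 R) my).
have mEg : measurable_fun setT (EFin \o g) by exact/measurable_EFinP.
have bx : bounded_mfun (fun w => g (x w)).
  by split; [exact: (measurableT_comp mg mx)|exists M].
have bY : bounded_mfun (fun w => g (y w)).
  by split; [exact: (measurableT_comp mg my)|exists M].
have hx : (\int[distribution P X]_u (g u)%:E = \int[P]_w (g (x w))%:E)%E.
  exact: (integral_pushforward mx mEg (bm_integrable P bx) measurableT).
have hy : (\int[distribution P1 Y]_u (g u)%:E = \int[P1]_w (g (y w))%:E)%E.
  exact: (integral_pushforward my mEg (bm_integrable P1 bY) measurableT).
rewrite /mean /Rintegral -hx -hy; congr fine.
apply: eq_measure_integral => B mB _.
exact: (etrans (xz B mB) (esym (yz B mB))).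
Qed.

(** * The logarithm at the empirical mean *)

Section logarithm.
Variable R : realType.
Implicit Types (q y e : 'rV[R]_3) (t : R).

Lemma dotC q y : dot q y = dot y q.
Proof. by rewrite !dot_coord3 dotpC. Qed.

Lemma dotDr q y e : dot q (y + e) = dot q y + dot q e.
Proof. by rewrite !dotE !mxE; ring. Qed.

Lemma dotDl q y e : dot (y + e) q = dot y q + dot e q.
Proof. by rewrite !(dotC _ q) dotDr. Qed.

Lemma dot_eq0 y : dot y y = 0 -> y = 0.
Proof. by move=> y0; apply: enorm_eq0; rewrite /enorm y0 sqrtr0. Qed.

Lemma sphere_antipode q y : sphere2 q -> sphere2 y -> dot q y = -1 -> y = - q.
Proof.
move=> /dot_sphere q1 /dot_sphere y1 qy; apply/eqP; rewrite -subr_eq0 opprK; apply/eqP.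
by apply: dot_eq0; rewrite !(dotDr, dotDl) q1 y1 (dotC y) qy; ring.
Qed.

Lemma sphere_eq q y : sphere2 q -> sphere2 y -> dot q y = 1 -> y = q.
Proof.
move=> /dot_sphere q1 /dot_sphere y1 qy; apply/eqP; rewrite -subr_eq0; apply/eqP.
apply: dot_eq0; rewrite -scaleN1r !(dotDr, dotDl, dotZl, dotZr) q1 y1 (dotC y) qy.
by ring.
Qed.

(** The vector [(theta / sin theta) *: (y - cos theta *: q)] is a logarithm of [y],
  and any [v] with [sphere_exp q v = y] and [enorm v < pi] satisfies
  [cos (enorm v) = dot q y], which determines its norm. *)
Lemma enorm_sphere_log q y : sphere2 q -> sphere2 y -> y <> - q ->
  enorm (sphere_log q y) = acos (dot q y).
Proof.
move=> Sq Sy yq; have q1 := dot_sphere Sq; have y1 := dot_sphere Sy.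
have /andP[c1 c2] := dot_sphere_itv Sq Sy.
have cN1 : -1 < dot q y.
  by rewrite lt_neqAle c1 andbT eq_sym; apply/eqP => /(sphere_antipode Sq Sy).
pose th := acos (dot q y).
have th0 : 0 <= th by rewrite acos_ge0// c1.
have thpi : th < pi by rewrite acos_ltpi// cN1.
have cth : cos th = dot q y by rewrite acosK// in_itv/= c1.
have : exists v, [/\ tangent q v, enorm v < pi & sphere_exp q v = y].
  have [th00|thN] := eqVneq th 0.
    exists 0; have n0 : enorm (0 : 'rV[R]_3) = 0 by rewrite /enorm dotE !mxE !mul0r !addr0 sqrtr0.
    split; rewrite /tangent /sphere_exp /= ?n0 ?pi_gt0//.
      by rewrite dotE !mxE !mulr0 !addr0.
    rewrite cos0 scale1r scaler0 addr0; apply/esym/sphere_eq => //.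
    by rewrite -cth th00 cos0.
  have thp : 0 < th by rewrite lt_def thN.
  have s0 : 0 < sin th by apply: sin_gt0_pi; rewrite thp.
  pose v := (th / sin th) *: (y + (- dot q y) *: q).
  have nv : enorm v = th.
    apply/eqP; rewrite -(eqrXn2 (n := 2))// ?sqrtr_ge0//; apply/eqP.
    rewrite sqr_enorm /v !(dotZl, dotZr, dotDl, dotDr) q1 y1 (dotC y q).
    transitivity ((th / sin th) ^+ 2 * (1 - dot q y ^+ 2)); first by ring.
    by rewrite -cth -sin2cos2; field; rewrite gt_eqF.
  exists v; split; rewrite /tangent /sphere_exp /= ?nv//.
    by rewrite /v !(dotZr, dotDr) q1; ring.
  rewrite /v scalerA (_ : sin th / th * (th / sin th) = 1); last first.
    by field; rewrite thN gt_eqF.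
  by rewrite cth scale1r scaleNr addrC subrK.
move=> /(xgetPex 0); rewrite -/(sphere_log q y) => -[tv vpi ey].
set v := sphere_log q y in tv vpi ey *.
rewrite -ey /sphere_exp dotDr !dotZr q1 tv mulr0 addr0 mulr1 cosK//.
by rewrite in_itv/= sqrtr_ge0 ltW.
Qed.

(** The difference quotients at [t] and at [- t] both tend to the derivative. *)
Lemma second_difference (h : R -> R) (D e : R) : is_derive (0 : R) 1 h D -> 0 < e ->
  exists2 r, 0 < r & forall t, 0 < t < r -> h t + h (- t) - 2 * h 0 <= e * t.
Proof.
move=> [dh _] e0.
pose k s := s^-1 *: (h (s *: 1 + 0) - h 0).
have e20 : 0 < e / 2 by rewrite divr_gt0.
have /cvgrPdist_lt/(_ _ e20) : k s @[s --> 0^'] --> lim (k s @[s --> 0^']) by exact: dh.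
set l := lim _ => -[r /= r0 kr].
exists r => // t /andP[t0 tr].
have tN : t != 0 by rewrite gt_eqF.
have h1 : `|l - k t| < e / 2.
  by apply: kr => //=; rewrite sub0r normrN gtr0_norm.
have h2 : `|l - k (- t)| < e / 2.
  by apply: kr => //=; rewrite ?oppr_eq0// sub0r opprK gtr0_norm.
have -> : h t + h (- t) - 2 * h 0 = t * (k t - k (- t)).
  by rewrite /k /GRing.scale/= !mulr1 !addr0; field; rewrite ?oppr_eq0 tN.
rewrite mulrC; apply: ler_wpM2r; first exact: ltW.
move: (k t) (k (- t)) h1 h2 => u v; rewrite !ltr_norml; clear.
by move=> /andP[? ?] /andP[? ?]; lra.
Qed.

(** The great circle through [q] with direction [e], of unit speed when [q] and
  [e] are orthonormal. *)
Definition arc q e t : 'rV[R]_3 := cos t *: q + sin t *: e.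

Lemma arc0 q e : arc q e 0 = q.
Proof. by rewrite /arc cos0 sin0 scale1r scale0r addr0. Qed.

Lemma arc_sphere q e t : sphere2 q -> sphere2 e -> dot q e = 0 -> sphere2 (arc q e t).
Proof.
move=> /dot_sphere q1 /dot_sphere e1 qe; rewrite /sphere2 /= /enorm /arc.
rewrite !(dotDl, dotDr, dotZl, dotZr) q1 e1 (dotC e) qe.
have -> : cos t * (cos t * 1 + sin t * 0) + sin t * (cos t * 0 + sin t * 1) =
    cos t ^+ 2 + sin t ^+ 2 by ring.
by rewrite cos2Dsin2 sqrtr1.
Qed.

Lemma dot_arc y q e t : dot y (arc q e t) = cos t * dot y q + sin t * dot y e.
Proof. by rewrite /arc dotDr !dotZr. Qed.

Lemma acos_cos_abs t : `|t| <= pi -> acos (cos t) = `|t|.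
Proof.
move=> tpi; rewrite -[RHS]cosK ?in_itv/= ?normr_ge0//.
by case: (ger0P t) => _; rewrite ?cosN.
Qed.

(** For [y] other than [q] and [- q] the squared distance is differentiable along
  the arc, and for [y = q] it is [t ^+ 2]. *)
Lemma sqdist_second_difference q e y (eps : R) :
  sphere2 q -> sphere2 e -> dot q e = 0 -> sphere2 y -> y <> - q -> 0 < eps ->
  exists2 r, 0 < r & forall t, 0 < t < r ->
    sqdist y (arc q e t) + sqdist y (arc q e (- t)) - 2 * sqdist y q <= eps * t.
Proof.
move=> Sq Se qe Sy yq e0; have q1 := dot_sphere Sq.
have /andP[c1 c2] := dot_sphere_itv Sy Sq.
have cN1 : -1 < dot y q.
  rewrite lt_neqAle c1 andbT eq_sym; apply/eqP; rewrite dotC.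
  by move=> /(sphere_antipode Sq Sy).
have [c1'|cN] := eqVneq (dot y q) 1.
  have -> : y = q by apply: sphere_eq => //; rewrite dotC.
  have pi0 := pi_gt0 R.
  exists (Num.min pi (eps / 2)) => [|t /andP[t0]]; first by rewrite lt_min pi0 divr_gt0.
  rewrite lt_min => /andP[tpi te].
  have tb : `|t| <= pi by rewrite gtr0_norm// ltW.
  rewrite /sqdist !dot_arc q1 qe !mulr1 !mulr0 !addr0 acos1 expr0n/=.
  rewrite !acos_cos_abs ?normrN// (gtr0_norm t0); clear -t0 te.
  by rewrite mulr0 subr0 -mulr2n -mulr_natl expr2 mulrA ler_wpM2r// ltW// mulrC -ltr_pdivlMr.
pose k t := cos t * dot y q + sin t * dot y e.
have dk : is_derive (0 : R) 1 k (dot y e).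
  apply: is_derive_eq; rewrite /GRing.scale/= cos0 sin0; ring.
have k0 : k 0 = dot y q by rewrite /k cos0 sin0 mul1r mul0r addr0.
have bk : -1 < k 0 < 1 by rewrite k0 cN1 lt_neqAle cN.
have da := is_derive1_acos bk.
have dc := @is_derive1_comp R (@acos R) k 0 _ _ da dk.
have ds : is_derive (0 : R) 1 (fun t => acos (k t) ^+ 2)
    (acos (k 0) *: (- (Num.sqrt (1 - k 0 ^+ 2))^-1 * dot y e) *+ 2).
  have -> : (fun t => acos (k t) ^+ 2) = (acos \o k) * (acos \o k).
    by apply/funext => t; rewrite expr2.
  by apply: (is_derive_eq (is_deriveM dc dc)); rewrite mulr2n.
have [r r0 hr] := second_difference ds e0.
exists r => // t tr; have := hr t tr.
by rewrite k0 /sqdist !dot_arc.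
Qed.

Lemma sqdist_antipode q e t :
  sphere2 q -> sphere2 e -> dot q e = 0 -> `|t| <= pi ->
  sqdist (- q) (arc q e t) = (pi - `|t|) ^+ 2.
Proof.
move=> /dot_sphere q1 Se qe tpi.
rewrite /sqdist dot_arc -scaleN1r !dotZl q1 qe mulr0 mulr0 addr0 mulr1 mulrN1.
by rewrite acosN ?cos_geN1 ?cos_le1// acos_cos_abs.
Qed.

(** The first two coordinates [(a, b)] of [q] give the orthogonal vector
  [(- b, a, 0)] if [a] is nonzero, and the first basis vector if [a] is zero. *)
Lemma orthogonal_unit q : exists2 e, sphere2 e & dot q e = 0.
Proof.
suff [v v0 qv] : exists2 v : 'rV[R]_3, v != 0 & dot q v = 0.
  exists (pr v); first exact: enorm_pr.
  by rewrite /pr dotZr qv mulr0.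
have [q0|q0] := eqVneq (q 0 0) 0.
  exists (vec3 (1, (0, 0))); last by rewrite dotE !vec3E /= q0 !mulr0 mul0r !addr0.
  by apply/eqP => /rowP/(_ 0)/eqP; rewrite vec3E mxE oner_eq0.
exists (vec3 (- q 0 1, (q 0 0, 0))); last by rewrite dotE !vec3E /=; ring.
apply/eqP => /rowP/(_ 1)/eqP; rewrite vec3E mxE /=.
by apply/negP.
Qed.

(** At the minimizer [q] the symmetric second difference along any great circle is
  nonnegative.  An observation at [- q] contributes
  [2 * (pi - t) ^+ 2 - 2 * pi ^+ 2 = - 4 * pi * t + 2 * t ^+ 2] to it, and all the
  others together at most [pi * t] for small [t > 0]. *)
Lemma mean_not_antipodal (L : nat) (y : nat -> 'rV[R]_3) q :
  (forall l, (l < L)%N -> sphere2 (y l)) -> empirical_mean L y q ->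
  forall l, (l < L)%N -> y l <> - q.
Proof.
move=> Sy [Sq minq] l0 l0L yl0.
have [e Se qe] := orthogonal_unit q.
have pi0 := pi_gt0 R.
have L0 : 0 < L%:R :> R by rewrite ltr0n (leq_ltn_trans _ l0L).
pose F l t := sqdist (y l) (arc q e t) + sqdist (y l) (arc q e (- t)) - 2 * sqdist (y l) q.
have e0 : sqdist (- q) q = pi ^+ 2.
  have := sqdist_antipode Sq Se qe (t := 0).
  by rewrite arc0 normr0 subr0 => ->//; exact: ltW.
have Fq l t : 0 < t < pi -> y l = - q -> F l t = 2 * (pi - t) ^+ 2 - 2 * pi ^+ 2.
  move=> /andP[t0 tpi] yq; rewrite /F yq e0.
  have tb : `|t| <= pi by rewrite gtr0_norm// ltW.
  have tb' : `|- t| <= pi by rewrite normrN.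
  rewrite (sqdist_antipode Sq Se qe tb) (sqdist_antipode Sq Se qe tb') normrN.
  by rewrite (gtr0_norm t0); ring.
have ep : 0 < pi / L%:R :> R by rewrite divr_gt0.
have F1 l : (l < L)%N -> exists2 r, 0 < r & forall t, 0 < t < r -> F l t <= pi / L%:R * t.
  move=> lL; have [yq|yq] := pselect (y l = - q); last first.
    exact: (sqdist_second_difference Sq Se qe (Sy l lL) yq ep).
  exists pi => // t tb; rewrite (Fq _ _ tb yq); have /andP[t0 tpi] := tb.
  apply: (@le_trans _ _ 0); last by rewrite mulr_ge0 ?ltW.
  clear -t0 tpi; nra.
have F0 : exists2 r, 0 < r & forall t, 0 < t < r -> F l0 t <= - (2 * pi) * t.
  exists pi => // t tb; rewrite (Fq _ _ tb yl0); have /andP[t0 tpi] := tb.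
  clear -t0 tpi; nra.
have FL n : (n <= L)%N -> exists2 r, 0 < r & forall t, 0 < t < r ->
    forall l, (l < n)%N -> F l t <= pi / L%:R * t.
  elim: n => [_|n IHn nL]; first by exists 1.
  have [r r0 hr] := IHn (ltnW nL); have [r' r'0 hr'] := F1 n nL.
  exists (Num.min r r') => [|t /andP[t0]]; first by rewrite lt_min r0.
  rewrite lt_min => /andP[tr tr'] l; rewrite ltnS leq_eqVlt => /predU1P[->|ln].
    by apply: hr'; rewrite t0.
  by apply: hr => //; rewrite t0.
have [r r0 hr] := FL L (leqnn L); have [r' r'0 hr'] := F0.
pose t := Num.min r r' / 2.
have m0 : 0 < Num.min r r' by rewrite lt_min r0.
have t0 : 0 < t by rewrite divr_gt0.
have tm : t < Num.min r r' by rewrite ltr_pdivrMr// ltr_pMr// ltr1n.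
have /andP[tr tr'] : (t < r) && (t < r') by rewrite -lt_min.
have le_sum s : sum_sqdist L y q <= sum_sqdist L y (arc q e s).
  have [->//|/minq h] := pselect (arc q e s = q).
  by apply/ltW/h; exact: arc_sphere.
have : 0 <= \sum_(l < L) F l t.
  rewrite /F sumrB big_split/= -mulr_sumr subr_ge0 mulr_natl mulr2n.
  by apply: lerD; exact: le_sum.
apply/negP; rewrite -ltNge (bigD1 (Ordinal l0L))//=.
apply: (@le_lt_trans _ _ (- (2 * pi) * t + \sum_(l < L) pi / L%:R * t)); last first.
  rewrite sumr_const card_ord -[_ *+ L]mulr_natl.
  have -> : L%:R * (pi / L%:R * t) = pi * t by field; rewrite gt_eqF.
  by rewrite -mulrDl nmulr_rlt0//; lra.
apply: lerD; first by apply: hr'; rewrite t0.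
rewrite [leRHS](bigD1 (Ordinal l0L))//=.
apply: (@le_trans _ _ (\sum_(i < L | i != Ordinal l0L) pi / L%:R * t)).
  by apply: ler_sum => l _; apply: hr; rewrite ?t0 ?ltn_ord.
by rewrite lerDr mulr_ge0// ltW.
Qed.

Lemma trace_empirical_cov (L : nat) (y : nat -> 'rV[R]_3) q :
  (forall l, (l < L)%N -> sphere2 (y l)) -> empirical_mean L y q ->
  \tr (empirical_cov L y q) = (L%:R - 1)^-1 * \sum_(l < L) sqdist q (y l).
Proof.
move=> Sy mq; rewrite /empirical_cov mxtraceZ raddf_sum/=; congr (_ * _).
apply: eq_bigr => l _.
have lL := ltn_ord l; have yq := mean_not_antipodal Sy mq lL.
rewrite mxtrace_mulC /mxtrace big_ord1 mxE.
transitivity (enorm (sphere_log q (y l)) ^+ 2).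
  by rewrite sqr_enorm /dot; apply: eq_bigr => k _; rewrite mxE.
by rewrite enorm_sphere_log//; [exact: mq.1|exact: Sy].
Qed.

Lemma sum_sqdistE (L : nat) (y : nat -> 'rV[R]_3) q :
  sum_sqdist L y q = \sum_(l < L) sqdist q (y l).
Proof. by apply: eq_bigr => l _; rewrite /sdist /sqdist dotC. Qed.

End logarithm.

(** * Convergence in probability and its rate *)

Section outer_probability.
Context d (T : measurableType d) (R : realType) (P : probability T R).

Lemma outer_le (A N B : set T) : measurable A -> P.-negligible N ->
  B `<=` A `|` N -> ((P^*)%mu B <= P A)%E.
Proof.
move=> mA [N' [mN' N'0 NN']] BA.
have mAN : measurable (A `|` N') by exact: measurableU.
have BAN : B `<=` A `|` N'.
  by move=> w /BA[Aw|/NN' Nw]; [left|right].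
apply: (le_trans (le_mu_ext P BAN)); rewrite measurable_mu_extE//.
apply: (le_trans (measureU2 _ mA mN')).
by rewrite [X in (_ + X)%E]N'0 adde0.
Qed.

(** The event [eps <= |Z L - z|] lies in [M < sqrt L * |Z L - z|] as soon as
  [M < sqrt L * eps]. *)
Lemma cvg_in_prob_rate (Z : nat -> T -> R) (z : R) :
  bounded_in_prob P (fun L w => Num.sqrt L%:R * (Z L w - z)) ->
  cvg_in_prob P Z z.
Proof.
move=> bZ eps eps0.
pose u L : \bar R := (P^*)%mu [set w | eps <= `|Z L w - z|].
have u0 L : (0 <= u L)%E by exact: mu_ext_ge0.
have usmall (del : R) : 0 < del -> \forall L \near \oo, (u L <= del%:E)%E.
  move=> del0; have [M hM] := bZ _ del0.
  near=> L; have : ((P^*)%mu [set w | (M < `|Num.sqrt L%:R * (Z L w - z)|)%R] <= del%:E)%E.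
    by near: L.
  apply: le_trans; apply: le_mu_ext => w /= ew.
  rewrite normrM ger0_norm ?sqrtr_ge0//.
  apply: (@lt_le_trans _ _ (Num.sqrt L%:R * eps)); last by rewrite ler_wpM2l ?sqrtr_ge0.
  rewrite -ltr_pdivrMr//; apply: (le_lt_trans (ler_norm _)).
  rewrite -[ltLHS]sqrtr_sqr ltr_sqrt; last by rewrite ltr0n; near: L; exact: nbhs_infty_gt.
  by near: L; exact: nbhs_infty_gtr.
apply/fine_cvgP; split.
  near=> L; rewrite ge0_fin_numE; last exact: u0.
  apply: (@le_lt_trans _ _ 1%E); last by rewrite ltry.
  by near: L; exact: usmall.
apply/cvgrPdist_le => del del0; near=> L.
rewrite sub0r normrN ger0_norm; last by apply: fine_ge0; exact: u0.
have : (u L <= del%:E)%E by near: L; exact: usmall.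
rewrite /=; rewrite -/(u L); have := u0 L; case: (u L) => //= r _; rewrite lee_fin; exact.
Unshelve. all: by end_near. Qed.

End outer_probability.

(** With [S] and [S'] the sums of squared distances from the minimizer and from
  [pr mu], [f] the target and [G >= 2 * f] the expectation at the minimizer: the
  average at the minimizer lies between [G - W] and [2 * f + W].  Replacing
  [1 / l] by [1 / (l - 1)] costs at most [p / l], where [p] bounds the
  squared distances. *)
Lemma half_trace_bound (R : realType) (f G W p S S' l : R) :
  0 <= W -> 0 <= p -> 2 <= l ->
  `|l^-1 * S' - 2 * f| <= W -> `|l^-1 * S - G| <= W -> S <= S' -> 0 <= S ->
  S <= l * p -> 2 * f <= G ->
  `|(l - 1)^-1 * S / 2 - f| <= W + p / l.
Proof.
move=> W0 p0 Lr; have Lp : 0 < l by lra.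
rewrite !ler_norml => /andP[_ up] /andP[low _] cmp S0 Spi Gf.
have lN : l != 0 by rewrite gt_eqF.
have lN1 : l - 1 != 0 by rewrite gt_eqF//; lra.
have l10 : 0 < l - 1 by lra.
pose A := l^-1 * S.
have e : (l - 1)^-1 * S = A + A / (l - 1) by rewrite /A; field; rewrite lN lN1.
have A0 : 0 <= A by rewrite mulr_ge0// invr_ge0 ltW.
have Ap : A <= p by rewrite /A ler_pdivrMl.
have AS : A <= l^-1 * S' by rewrite /A ler_wpM2l// invr_ge0 ltW.
have B0 : 0 <= A / (l - 1) by rewrite divr_ge0// ltW.
have Bp : A / (l - 1) <= 2 * (p / l).
  rewrite ler_pdivrMr// (_ : 2 * (p / l) * (l - 1) = p * (2 * (l - 1) / l)); last by field.
  apply: (le_trans Ap); rewrite ler_peMr// ler_pdivlMr// mul1r; lra.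
rewrite e -/A in low *; move: (A / (l - 1)) (p / l) B0 Bp => b c B0 Bp.
by apply/andP; split; lra.
Qed.

Section estimator.
Variables (R : realType) (mu : 'rV[R]_3) (sigma : R).
Hypotheses (mu_neq0 : mu != 0) (sigma_gt0 : 0 < sigma).
Variables (d' : measure_display) (T' : measurableType d') (P' : probability T' R).
Variables (X : T' -> 'rV[R]_3) (X_normal : isotropic_normal P' X mu sigma).
Variables (d : measure_display) (T : measurableType d) (P : probability T R).
Variables (x : nat -> T -> 'rV[R]_3) (x_measurable : forall l, random_vector (x l)).
Hypothesis x_indep : mutually_independent P x.
Hypothesis x_law : forall l, same_law P P' (x l) (fun w => pr (X w)).
Variables (xihat : nat -> T -> 'rV[R]_3).
Hypothesis xihat_mean : forall L : nat, (2 <= L)%N ->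
  {ae P, forall w, empirical_mean L (fun l => x l w) (xihat L w)}.

Let lambda := sigma ^+ 2 / enorm mu ^+ 2.
Let half_trace L w := \tr (empirical_cov L (fun l => x l w) (xihat L w)) / 2.

Lemma negligible_off_sphere : P.-negligible [set w | exists l, enorm (x l w) != 1].
Proof.
have -> : [set w | exists l, enorm (x l w) != 1] =
    \bigcup_l [set w | enorm (x l w) != 1].
  by apply/seteqP; split => w /= [l]; [exists l|move=> _; exists l].
apply: negligible_bigcup => l.
exists [set w | enorm (x l w) != 1]; split => //.
  have := measurableT_comp (@measurable_enorm R) (x_measurable l).
  move=> /(_ measurableT _ (measurableC (measurable_set1 (1 : R)))); rewrite setTI.
  by congr (measurable _); apply/seteqP; split => y /= /eqP.
exact: (projected_off_sphere_null X_normal (@x_law l)).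
Qed.

(** The bound [D] is the uniform deviation of the averages plus [pi ^+ 2 / L] for
  the normalization by [L - 1]; both are [O(1 / sqrt L)] in mean. *)
Lemma half_trace_rate (L : nat) : (2 <= L)%N ->
  exists D : T -> R, exists N : set T, [/\ bounded_mfun D, forall w, 0 <= D w,
    mean P D <= (2 + 2 * pi ^+ 2) / Num.sqrt L%:R, P.-negligible N &
    forall w, ~ N w -> `|half_trace L w - f_cov lambda| <= D w].
Proof.
move=> L2; have L0 : (0 < L)%N by exact: leq_trans L2.
have x_ident (g : borel3 R -> R) l : measurable_fun setT g ->
    (exists M, forall y, `|g y| <= M) ->
    mean P (fun w => g (x l w)) = mean P (fun w => g (x 0 w)).
  by apply: same_law_mean (x_measurable l) (x_measurable 0) (@x_law l) (@x_law 0%N).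
have [W [bW W0 EW hW]] := uniform_law_rate x_measurable x_indep x_ident
  (sqr_ge0 pi) (@kernel_class_sqdist R) (@measurable_sqdist R) L0.
have pi20 : 0 <= pi ^+ 2 :> R by exact: sqr_ge0.
have Lp : 1 < L%:R :> R by rewrite ltr1n.
have Lr : 2 <= L%:R :> R by rewrite ler_nat.
exists (fun w => W w + pi ^+ 2 / L%:R).
exists ([set w | exists l, enorm (x l w) != 1] `|`
        [set w | ~ empirical_mean L (fun l => x l w) (xihat L w)]); split.
- by apply: bmD => //; exact: bm_cst.
- by move=> w; rewrite addr_ge0// divr_ge0// ler0n.
- rewrite meanD ?mean_cst//; last exact: bm_cst.
  have h : pi ^+ 2 / L%:R <= pi ^+ 2 / Num.sqrt L%:R :> R.
    apply: ler_wpM2l => //; rewrite lef_pV2 ?posrE ?sqrtr_gt0 ?ltr0n//.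
    rewrite -[leRHS]ger0_norm ?ler0n// -sqrtr_sqr ler_sqrt ?sqr_ge0//.
    by rewrite expr2 ler_peMr ?ler0n// ltW.
  by apply: le_trans (lerD EW h) _; rewrite -mulrDl mulr_natl mulr2n addrA.
- by apply: negligibleU; [exact: negligible_off_sphere|exact: xihat_mean].
- move=> w /not_orP[hS /contrapT hM].
  have Sx l : sphere2 (x l w).
    by apply/eqP/negPn/negP => h; apply: hS; exists l.
  have {}hW := hW w (fun l _ => Sx l).
  rewrite /half_trace (trace_empirical_cov (fun l _ => Sx l) hM).
  have [Sxi xi_min] := hM.
  have Sm := pr_sphere mu_neq0.
  have up := hW _ Sm; have low := hW _ Sxi.
  have cmp : \sum_(l < L) sqdist (xihat L w) (x l w) <=
      \sum_(l < L) sqdist (pr mu) (x l w).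
    rewrite -!(sum_sqdistE L (fun l => x l w)); have [->//|pq] := pselect (pr mu = xihat L w).
    by apply/ltW/xi_min.
  have S0 : 0 <= \sum_(l < L) sqdist (xihat L w) (x l w).
    by apply: sumr_ge0 => l _; exact: sqdist_ge0.
  have Spi : \sum_(l < L) sqdist (xihat L w) (x l w) <= L%:R * pi ^+ 2.
    rewrite -[in leRHS](card_ord L) -sum1_card natr_sum mulr_suml; apply: ler_sum => l _.
    by rewrite mul1r sqdist_le.
  have Eup := mean_sqdist_pr_mu mu_neq0 sigma_gt0 X_normal (x_measurable 0) (@x_law 0%N).
  have Elow := mean_sqdist_ge mu_neq0 sigma_gt0 X_normal (x_measurable 0) (@x_law 0%N) Sxi.
  rewrite -/lambda in Eup Elow.
  rewrite Eup in up.
  exact: half_trace_bound (W0 w) pi20 Lr up low cmp S0 Spi Elow.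
Qed.

(** Outside of an event of probability at most [del] the deviation [D] is below
  [a / sqrt L], hence for large [L] below the radius of stability of the inverse
  of [f_cov]. *)
Lemma lambda_hat_rate (dflt : R -> R) :
  bounded_in_prob P (fun L w =>
    Num.sqrt L%:R * (f_cov_inv dflt (half_trace L w) - lambda)).
Proof.
move=> del del0.
have e0 : 0 < enorm mu.
  by rewrite lt_def sqrtr_ge0 andbT; apply: contra mu_neq0 => /eqP/enorm_eq0/eqP.
have [C [C0 [eta [eta0 stable]]]] :=
  f_cov_inv_stable sigma_gt0 (normal_dens_mass X_normal) e0.
pose K : R := 2 + 2 * pi ^+ 2.
have K0 : 0 < K by rewrite ltr_wpDr// mulr_ge0// sqr_ge0.
pose a := K / del.
have a0 : 0 < a by rewrite divr_gt0.
exists (C * a); near=> L.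
have L2 : (2 <= L)%N by near: L; exact: nbhs_infty_ge.
have r0 : 0 < Num.sqrt L%:R :> R by rewrite sqrtr_gt0 ltr0n (leq_trans _ L2).
have aL : a / Num.sqrt L%:R < eta.
  rewrite ltr_pdivrMr// mulrC -ltr_pdivrMr//; apply: (le_lt_trans (ler_norm _)).
  rewrite -[ltLHS]sqrtr_sqr ltr_sqrt; last by rewrite ltr0n (leq_trans _ L2).
  by near: L; exact: nbhs_infty_gtr.
have [D [N [bD D0 ED nN hD]]] := half_trace_rate L2.
have mA := measurable_ge (a / Num.sqrt L%:R) bD.1.
apply: (@le_trans _ _ (P [set w | a / Num.sqrt L%:R <= D w])); last first.
  have <- : K / Num.sqrt L%:R / (a / Num.sqrt L%:R) = del.
    by rewrite /a; field; rewrite !gt_eqF.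
  exact: markov_mean bD D0 (divr_gt0 a0 r0) ED.
apply: (outer_le mA nN) => w /= hw.
have [Nw|Nw] := pselect (N w); first by right.
left; rewrite /= leNgt; apply/negP => Da.
have hv := hD w Nw.
have := stable dflt _ (le_lt_trans hv (lt_trans Da aL)) => st.
move: hw; apply/negP; rewrite -leNgt normrM ger0_norm ?sqrtr_ge0//.
apply: (@le_trans _ _ (Num.sqrt L%:R * (C * (a / Num.sqrt L%:R)))).
  apply: ler_wpM2l; first exact: ltW.
  apply: (le_trans st); apply: ler_wpM2l; first exact: ltW.
  by apply: (le_trans hv); exact: ltW.
by rewrite le_eqVlt; apply/orP; left; apply/eqP; field; rewrite gt_eqF.
Unshelve. all: by end_near. Qed.

End estimator.

Theorem theorem2p8 (R : realType)
    (mu : 'rV[R]_3) (sigma : R) (mu_neq0 : mu != 0) (sigma_gt0 : 0 < sigma)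
    (d' : measure_display) (T' : measurableType d') (P' : probability T' R)
    (X : T' -> 'rV[R]_3) (X_normal : isotropic_normal P' X mu sigma)
    (d : measure_display) (T : measurableType d) (P : probability T R)
    (x : nat -> T -> 'rV[R]_3)
    (x_measurable : forall l, random_vector (x l))
    (x_indep : mutually_independent P x)
    (x_law : forall l, same_law P P' (x l) (fun w => pr (X w)))
    (xihat : nat -> T -> 'rV[R]_3)
    (xihat_mean : forall L : nat, (2 <= L)%N ->
       {ae P, forall w, empirical_mean L (fun l => x l w) (xihat L w)})
    (dflt : R -> R) :
  let lambda := sigma ^+ 2 / enorm mu ^+ 2 in
  let lambdahat := fun (L : nat) (w : T) =>
    lambda_hat dflt L (fun l => x l w) (xihat L w) in
  cvg_in_prob P lambdahat lambda /\
  bounded_in_prob P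
    (fun L w => Num.sqrt L%:R * (lambdahat L w - lambda)).
Proof.
move=> lambda lambdahat.
have h := lambda_hat_rate mu_neq0 sigma_gt0 X_normal x_measurable x_indep x_law xihat_mean dflt.
by split; [exact: cvg_in_prob_rate|].
Qed.
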